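(* There exist tight $N$-point simplices in $\mathbb{H}\mathbb{P}^{d-1}$ for the following pairs $(N,d)$: $d=3$ and $5\le N\le 11$; $d=4$ and $6\le N\le 21$; $d=5$ and $8\le N\le 27$; $d=6$ and $9\le N\le 34$.
   Context: $\mathbb{H}\mathbb{P}^{d-1}$ is the space of quaternionic lines in $\mathbb{H}^d$ (scalars acting on the right), points represented by unit vectors $x\in\mathbb{H}^d$, with $\langle x,y\rangle = x^\dagger y$. A tight simplex of $N$ points in $\mathbb{H}\mathbb{P}^{d-1}$ is a set of $N$ distinct points $x_1,\dots,x_N$ with $|\langle x_i,x_j\rangle|^2=\frac{N-d}{d(N-1)}$ for all $i\ne j$. *)

(* Defs.v *)
From mathcomp Require Import all_boot all_order all_algebra.
From mathcomp Require Import reals.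
Set Implicit Arguments. Unset Strict Implicit. Unset Printing Implicit Defensive.
Import Order.TTheory GRing.Theory Num.Theory.
Local Open Scope ring_scope.

Record quat (R : Type) := Quat { qre : R; qi : R; qj : R; qk : R }.

Section Quat.
Variable R : pzRingType.

(* Hamilton product (i^2 = j^2 = k^2 = ijk = -1) *)
Definition qmul (p q : quat R) : quat R :=
  Quat (qre p * qre q - qi p * qi q - qj p * qj q - qk p * qk q)
       (qre p * qi q + qi p * qre q + qj p * qk q - qk p * qj q)
       (qre p * qj q - qi p * qk q + qj p * qre q + qk p * qi q)
       (qre p * qk q + qi p * qj q - qj p * qi q + qk p * qre q).

Definition qconj (q : quat R) : quat R :=
  Quat (qre q) (- qi q) (- qj q) (- qk q).

Definition qnorm2 (q : quat R) : R :=
  qre q ^+ 2 + qi q ^+ 2 + qj q ^+ 2 + qk q ^+ 2.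

Definition qsum (d : nat) (F : 'I_d -> quat R) : quat R :=
  Quat (\sum_(k < d) qre (F k)) (\sum_(k < d) qi (F k))
       (\sum_(k < d) qj (F k)) (\sum_(k < d) qk (F k)).

Definition hvec (d : nat) := 'I_d -> quat R.

Definition hinner (d : nat) (x y : hvec d) : quat R :=
  qsum (fun k => qmul (qconj (x k)) (y k)).

Definition hnorm2 (d : nat) (x : hvec d) : R := \sum_(k < d) qnorm2 (x k).

Definition same_line (d : nat) (x y : hvec d) : Prop :=
  exists l : quat R, forall k, y k = qmul (x k) l.

End Quat.

(* A tight simplex of N points in HP^{d-1}: N unit vectors representing
   pairwise distinct quaternionic lines with
   |<x_i,x_j>|^2 = (N-d)/(d(N-1)) for i <> j. *)
Definition tight_simplex (R : realType) (N d : nat) (x : 'I_N -> hvec R d) : Prop :=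
  [/\ forall i, hnorm2 (x i) = 1,
      forall i j, i != j -> ~ same_line (x i) (x j)
    & forall i j, i != j ->
        qnorm2 (hinner (x i) (x j)) = (N%:R - d%:R) / (d%:R * (N%:R - 1))].

(* Main.v *)
(* The simplices are unions of at most four orbits of a cyclic group acting on H^d by left
   multiplication with diag(z^b_0, ..., z^b_(d-1)), z a complex root of unity.  For such a union
   the frame condition sum_i x_i x_i^* = (N/d) 1 is automatic off the blocks of equal characters,
   and it fixes the sum of the overlaps |<x_i, x_j>|^2 over j; so it is enough to impose the
   frame equations on those blocks, unit norms, and the equality of all overlaps but one per
   orbit.  In each of the 69 cases this is a system of n real quadratic equations, n <= 59, in n
   chosen real coordinates, the remaining ones being frozen at dyadic values.  A simple zero
   exists by a Newton-Krawczyk contraction around an approximate solution.  Its hypotheses are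
   inequalities between integers, tested in fixed-point arithmetic; the rounding errors and the
   variation of the gradients in the box are bounded once and for all. *)
From HB Require Import structures.
Require Import Defs.
From mathcomp Require Import all_boot all_order all_algebra.
From mathcomp Require Import boolp classical_sets reals.
From Stdlib Require Import ZArith NArith.
From mathcomp Require Import ring lra zify ssrZ.
Set Implicit Arguments. Unset Strict Implicit. Unset Printing Implicit Defensive.
Import Order.TTheory GRing.Theory Num.Theory.
Local Open Scope ring_scope.


(** * The ring of quaternions *)

(** The defining equations cannot be handed to Newton's method as they stand: among unit vectors the
    sum of all overlaps is minimal at a tight simplex, so their gradients are dependent there and no
    zero is simple. Frame equations supply the lost rank, and the overlaps that depend on them are
    removed by exact counting. Complex characters on a quaternionic space bring a twist. With H = C
    + Cj, the (k, l) entry of the frame operator carries the character b_k - b_l on its complex part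
    and b_k + b_l on its j part. Keeping every b_k in [0, L/2], L the order of z, the second is
    trivial only when b_k = b_l too, so only equal characters need equations. The order is L = 4 q
    because cos (2 pi / 4 q) is a simple zero of the Chebyshev polynomial T_q and can be located by
    a sign change, while T_n = 1 has double roots inside (-1, 1). Since the equations are built from
    norms, products and overlaps of vectors of length about 1, one bound 2^-9 on the variation of
    the gradients over a box of radius 2^-20 serves all cases. *)

Section QuatRing.
Variable R : realType.
Implicit Types (p q : quat R).

Definition quat_tuple q := (qre q, qi q, qj q, qk q).
Definition tuple_quat (t : R * R * R * R) : quat R :=
  let: (a, b, c, e) := t in Quat a b c e.
Lemma quat_tupleK : cancel quat_tuple tuple_quat. Proof. by case. Qed.

HB.instance Definition _ := Choice.copy (quat R) (can_type quat_tupleK).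

Definition qadd p q := Quat (qre p + qre q) (qi p + qi q) (qj p + qj q) (qk p + qk q).
Definition qopp q : quat R := Quat (- qre q) (- qi q) (- qj q) (- qk q).
Definition qzero : quat R := Quat 0 0 0 0.
Definition qone : quat R := Quat 1 0 0 0.

Lemma quatP p q : qre p = qre q -> qi p = qi q -> qj p = qj q -> qk p = qk q -> p = q.
Proof. by case: p; case: q => /= ? ? ? ? ? ? ? ? -> -> -> ->. Qed.

Fact qaddA : associative qadd. Proof. by move=> *; apply: quatP => /=; ring. Qed.
Fact qaddC : commutative qadd. Proof. by move=> *; apply: quatP => /=; ring. Qed.
Fact qadd0 : left_id qzero qadd. Proof. by move=> *; apply: quatP => /=; ring. Qed.
Fact qaddN : left_inverse qzero qopp qadd. Proof. by move=> *; apply: quatP => /=; ring. Qed.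
HB.instance Definition _ := GRing.isZmodule.Build (quat R) qaddA qaddC qadd0 qaddN.

Fact qmulA : associative (@qmul R). Proof. by move=> *; apply: quatP => /=; ring. Qed.
Fact qmul1q : left_id qone (@qmul R). Proof. by move=> *; apply: quatP => /=; ring. Qed.
Fact qmulq1 : right_id qone (@qmul R). Proof. by move=> *; apply: quatP => /=; ring. Qed.
Fact qmulDl : left_distributive (@qmul R) +%R. Proof. by move=> *; apply: quatP => /=; ring. Qed.
Fact qmulDr : right_distributive (@qmul R) +%R. Proof. by move=> *; apply: quatP => /=; ring. Qed.
HB.instance Definition _ := GRing.Zmodule_isPzRing.Build (quat R) qmulA qmul1q qmulq1 qmulDl qmulDr.

Lemma qmulE p q : qmul p q = p * q. Proof. by []. Qed.

Fact qre_additive : zmod_morphism (@qre R). Proof. by []. Qed.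
HB.instance Definition _ := GRing.isZmodMorphism.Build _ _ (@qre R) qre_additive.
Fact qi_additive : zmod_morphism (@qi R). Proof. by []. Qed.
HB.instance Definition _ := GRing.isZmodMorphism.Build _ _ (@qi R) qi_additive.
Fact qj_additive : zmod_morphism (@qj R). Proof. by []. Qed.
HB.instance Definition _ := GRing.isZmodMorphism.Build _ _ (@qj R) qj_additive.
Fact qk_additive : zmod_morphism (@qk R). Proof. by []. Qed.
HB.instance Definition _ := GRing.isZmodMorphism.Build _ _ (@qk R) qk_additive.
Fact qconj_additive : zmod_morphism (@qconj R).
Proof. by move=> p q; apply: quatP => /=; ring. Qed.
HB.instance Definition _ := GRing.isZmodMorphism.Build _ _ (@qconj R) qconj_additive.

Lemma qconjM p q : qconj (p * q) = qconj q * qconj p.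
Proof. by apply: quatP => /=; ring. Qed.
Lemma qconjK : involutive (@qconj R).
Proof. by move=> q; apply: quatP => /=; rewrite ?opprK. Qed.

Definition qreal (a : R) : quat R := Quat a 0 0 0.
Lemma qrealC a q : qreal a * q = q * qreal a.
Proof. by apply: quatP => /=; ring. Qed.
Lemma qmulC q : q * qconj q = qreal (qnorm2 q).
Proof. by apply: quatP => /=; rewrite /qnorm2; ring. Qed.
Lemma qCmul q : qconj q * q = qreal (qnorm2 q).
Proof. by apply: quatP => /=; rewrite /qnorm2; ring. Qed.

Lemma qnorm2M p q : qnorm2 (p * q) = qnorm2 p * qnorm2 q.
Proof. by rewrite /qnorm2 /=; ring. Qed.
Lemma qnorm2C q : qnorm2 (qconj q) = qnorm2 q.
Proof. by rewrite /qnorm2 /=; ring. Qed.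
Lemma qnorm2N q : qnorm2 (- q) = qnorm2 q.
Proof. by rewrite /qnorm2 /=; ring. Qed.
Lemma qnorm2_ge0 q : 0 <= qnorm2 q.
Proof. by rewrite /qnorm2 !addr_ge0 ?sqr_ge0. Qed.

Lemma hinnerE d (x y : hvec R d) : hinner x y = \sum_k qconj (x k) * y k.
Proof. by apply: quatP; rewrite /= raddf_sum. Qed.

Lemma hinnerC d (x y : hvec R d) : qconj (hinner x y) = hinner y x.
Proof.
by rewrite !hinnerE raddf_sum; apply: eq_bigr => k _; rewrite /= qconjM qconjK.
Qed.

Lemma hinner_ext d (x x' y y' : hvec R d) : x =1 x' -> y =1 y' -> hinner x y = hinner x' y'.
Proof. by move=> ex ey; rewrite !hinnerE; apply: eq_bigr => k _; rewrite ex ey. Qed.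

Lemma hinnerxx d (x : hvec R d) : hinner x x = qreal (hnorm2 x).
Proof.
rewrite hinnerE /hnorm2 (eq_bigr (fun k => qreal (qnorm2 (x k)))); last first.
  by move=> k _; rewrite qCmul.
by apply: quatP; rewrite raddf_sum //= big1.
Qed.

Lemma hinner_mulr d (x y : hvec R d) l :
  hinner x (fun k => y k * l) = hinner x y * l.
Proof. by rewrite !hinnerE mulr_suml; apply: eq_bigr => k _; rewrite mulrA. Qed.

(** If y = x l, then <x, y> = |x|^2 l = l, and comparing norms gives |l| = 1. Used in contrapositive
    form: an overlap different from 1 separates lines. *)
Lemma same_line_norm d (x y : hvec R d) : hnorm2 x = 1 -> hnorm2 y = 1 ->
  same_line x y -> qnorm2 (hinner x y) = 1.
Proof.
move=> x1 y1 [l yl].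
have yE : hinner x y = l.
  rewrite hinnerE (eq_bigr (fun k => qconj (x k) * x k * l)); last first.
    by move=> k _; rewrite yl qmulE mulrA.
  rewrite -mulr_suml -hinnerE hinnerxx x1.
  by apply: quatP => /=; ring.
rewrite yE -y1 /hnorm2 (eq_bigr (fun k => qnorm2 (x k) * qnorm2 l)); last first.
  by move=> k _; rewrite yl qmulE qnorm2M.
by rewrite -mulr_suml -/(hnorm2 x) x1 mul1r.
Qed.

End QuatRing.

(** * Quaternionic norms and the Cauchy-Schwarz inequality *)

Section Norms.
Variable R : realType.
Implicit Types p q : quat R.

Definition qabs q := Num.sqrt (qnorm2 q).

Lemma qabs_ge0 q : 0 <= qabs q. Proof. exact: sqrtr_ge0. Qed.
Lemma sqr_qabs q : qabs q ^+ 2 = qnorm2 q.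
Proof. by rewrite sqr_sqrtr ?qnorm2_ge0. Qed.
Lemma qabsM p q : qabs (p * q) = qabs p * qabs q.
Proof. by rewrite /qabs qnorm2M sqrtrM ?qnorm2_ge0. Qed.
Lemma qabsC q : qabs (qconj q) = qabs q.
Proof. by rewrite /qabs qnorm2C. Qed.
Lemma qabsN q : qabs (- q) = qabs q.
Proof. by rewrite /qabs qnorm2N. Qed.
Lemma qabs0 : qabs 0 = 0.
Proof. by rewrite /qabs /qnorm2 /= expr0n !addr0 sqrtr0. Qed.

Lemma qabs_le q e : 0 <= e -> (qabs q <= e) = (qnorm2 q <= e ^+ 2).
Proof. by move=> e0; rewrite -sqr_qabs ler_sqr ?nnegrE ?qabs_ge0. Qed.

Lemma qcomp_le q : [/\ `|qre q| <= qabs q, `|qi q| <= qabs q,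
  `|qj q| <= qabs q & `|qk q| <= qabs q].
Proof.
have H x : x ^+ 2 <= qnorm2 q -> `|x| <= qabs q.
  by rewrite -sqr_qabs -(ler_sqr _ (qabs_ge0 q)) ?nnegrE ?normr_ge0 // real_normK ?num_real.
by split; apply: H; rewrite /qnorm2;
  move: (sqr_ge0 (qre q)) (sqr_ge0 (qi q)) (sqr_ge0 (qj q)) (sqr_ge0 (qk q));
  move: (qre q ^+ 2) (qi q ^+ 2) (qj q ^+ 2) (qk q ^+ 2) => *; lra.
Qed.

Lemma sqr_le_norm (x e : R) : `|x| <= e -> x ^+ 2 <= e ^+ 2.
Proof. by move=> xe; rewrite -(real_normK (num_real x)) lerXn2r ?nnegrE // (le_trans _ xe). Qed.

Lemma qnorm2_comp q e : `|qre q| <= e -> `|qi q| <= e -> `|qj q| <= e -> `|qk q| <= e ->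
  qnorm2 q <= 4 * e ^+ 2.
Proof.
move=> /sqr_le_norm h0 /sqr_le_norm h1 /sqr_le_norm h2 /sqr_le_norm h3; rewrite /qnorm2.
move: h0 h1 h2 h3; move: (qre q ^+ 2) (qi q ^+ 2) (qj q ^+ 2) (qk q ^+ 2) (e ^+ 2) => *; lra.
Qed.

Lemma qabs_comp q e : `|qre q| <= e -> `|qi q| <= e -> `|qj q| <= e -> `|qk q| <= e ->
  qabs q <= 2 * e.
Proof.
move=> h0 h1 h2 h3; have e0 := le_trans (normr_ge0 _) h0.
by rewrite qabs_le ?mulr_ge0 // exprMn -natrX (qnorm2_comp h0 h1 h2 h3).
Qed.

Lemma qabsD p q : qabs (p + q) <= qabs p + qabs q.
Proof.
rewrite qabs_le ?addr_ge0 ?qabs_ge0 //.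
have -> : qnorm2 (p + q) = qnorm2 p + 2 * qre (qconj p * q) + qnorm2 q.
  by rewrite /qnorm2 /=; ring.
have [h _ _ _] := qcomp_le (qconj p * q).
have := le_trans (ler_norm _) h; rewrite qabsM qabsC sqrrD !sqr_qabs.
move: (qnorm2 p) (qnorm2 q) (qre _) (qabs p * qabs q) => *; lra.
Qed.

Lemma qabsB p q : qabs (p - q) <= qabs p + qabs q.
Proof. by rewrite -(qabsN q) qabsD. Qed.

Lemma qabs_sum I (r : seq I) (P : pred I) (F : I -> quat R) :
  qabs (\sum_(i <- r | P i) F i) <= \sum_(i <- r | P i) qabs (F i).
Proof.
elim/big_ind2: _ => //; first by rewrite qabs0.
by move=> x x' y y' h1 h2; apply: le_trans (qabsD _ _) (lerD h1 h2).
Qed.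

Lemma qabs_real (a : R) : qabs (qreal a) = `|a|.
Proof. by rewrite /qabs /qnorm2 /= expr0n !addr0 sqrtr_sqr. Qed.

(** Lagrange's identity: the difference of the two sides is half of a double sum of squares. *)
Lemma cauchy_schwarz (I : finType) (a b : I -> R) :
  (\sum_i a i * b i) ^+ 2 <= (\sum_i a i ^+ 2) * (\sum_i b i ^+ 2).
Proof.
rewrite -subr_ge0.
have : 0 <= \sum_i \sum_j (a i * b j - a j * b i) ^+ 2.
  by apply: sumr_ge0 => i _; apply: sumr_ge0 => j _; rewrite sqr_ge0.
have E : \sum_i \sum_j (a i * b j - a j * b i) ^+ 2 =
  2 * ((\sum_i a i ^+ 2) * (\sum_i b i ^+ 2) - (\sum_i a i * b i) ^+ 2).
  rewrite (eq_bigr (fun i => a i ^+ 2 * \sum_j b j ^+ 2 + b i ^+ 2 * \sum_j a j ^+ 2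
      - 2 * (a i * b i * \sum_j a j * b j))); last first.
    move=> i _; rewrite !mulr_sumr -!big_split -sumrB /=.
    by apply: eq_bigr => j _; ring.
  rewrite sumrB big_split /= -!mulr_suml -mulr_sumr -mulr_suml; ring.
by rewrite E; move: (_ - _) => x; lra.
Qed.

Variable d : nat.
Implicit Types x y : hvec R d.

Definition hnorm x := Num.sqrt (hnorm2 x).

Lemma hnorm2_ge0 x : 0 <= hnorm2 x.
Proof. by apply: sumr_ge0 => k _; apply: qnorm2_ge0. Qed.
Lemma hnorm_ge0 x : 0 <= hnorm x. Proof. exact: sqrtr_ge0. Qed.
Lemma sqr_hnorm x : hnorm x ^+ 2 = hnorm2 x.
Proof. by rewrite sqr_sqrtr ?hnorm2_ge0. Qed.
Lemma hnorm_le x e : 0 <= e -> (hnorm x <= e) = (hnorm2 x <= e ^+ 2).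
Proof. by move=> e0; rewrite -sqr_hnorm ler_sqr ?nnegrE ?hnorm_ge0. Qed.

Let CS x y : \sum_k qabs (x k) * qabs (y k) <= hnorm x * hnorm y.
Proof.
rewrite -ler_sqr ?nnegrE ?mulr_ge0 ?hnorm_ge0 ?sumr_ge0 //; last first.
  by move=> k _; rewrite mulr_ge0 ?qabs_ge0.
rewrite exprMn !sqr_hnorm; apply: le_trans (cauchy_schwarz _ _) _.
have E (z : hvec R d) : \sum_k qabs (z k) ^+ 2 = hnorm2 z by apply: eq_bigr => k _;
  rewrite sqr_qabs.
by rewrite !E.
Qed.

Lemma qabs_hinner x y : qabs (hinner x y) <= hnorm x * hnorm y.
Proof.
rewrite hinnerE; apply: le_trans (qabs_sum _ _ _) _.
by rewrite (eq_bigr (fun k => qabs (x k) * qabs (y k))) // => k _; rewrite qabsM qabsC.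
Qed.

Lemma hnorm_add x y : hnorm (fun k => x k + y k) <= hnorm x + hnorm y.
Proof.
rewrite hnorm_le ?addr_ge0 ?hnorm_ge0 // sqrrD !sqr_hnorm /hnorm2.
apply: (@le_trans _ _ (\sum_k (qabs (x k) + qabs (y k)) ^+ 2)).
  by apply: ler_sum => k _; rewrite -qabs_le ?qabsD ?addr_ge0 ?qabs_ge0.
rewrite (eq_bigr (fun k => qnorm2 (x k) + qabs (x k) * qabs (y k) *+ 2 + qnorm2 (y k))); last first.
  by move=> k _; rewrite sqrrD !sqr_qabs.
by rewrite 2!big_split /= sumrMnl lerD2r lerD2l lerMn2r CS orbT.
Qed.

(** At most 24 real components of size at most [e] give squared norm at most 24 e^2 <= (5 e)^2. *)
Lemma hnorm_comp x e : (d <= 6)%nat -> 0 <= e ->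
  (forall k, [/\ `|qre (x k)| <= e, `|qi (x k)| <= e, `|qj (x k)| <= e & `|qk (x k)| <= e]) ->
  hnorm x <= 5 * e.
Proof.
move=> d6 e0 H; rewrite hnorm_le ?mulr_ge0 // /hnorm2.
apply: (@le_trans _ _ (\sum_(k < d) 4 * e ^+ 2)).
  by apply: ler_sum => k _; have [h0 h1 h2 h3] := H k; apply: qnorm2_comp.
rewrite sumr_const card_ord -[leLHS]mulr_natr.
have d6' : d%:R <= 6 :> R by rewrite ler_nat.
have e2 := sqr_ge0 e; have := ler_wpM2l e2 d6'.
rewrite exprMn; have -> : (5 : R) ^+ 2 = 25 by ring.
by move: (e ^+ 2) (d%:R) e2 => a b ? ?; lra.
Qed.

Lemma hinnerBl x x' y : hinner (fun k => x k - x' k) y = hinner x y - hinner x' y.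
Proof.
by rewrite !hinnerE -sumrB; apply: eq_bigr => k _; rewrite raddfB mulrBl.
Qed.
Lemma hinnerBr x y y' : hinner x (fun k => y k - y' k) = hinner x y - hinner x y'.
Proof.
by rewrite !hinnerE -sumrB; apply: eq_bigr => k _; rewrite mulrBr.
Qed.

End Norms.

(** * Unions of orbits of a diagonal cyclic group *)

Lemma periodic_modn T (f : nat -> T) m n :
  (forall k, f (k + m)%nat = f k) -> f n = f (n %% m)%nat.
Proof.
move=> fm; rewrite {1}(divn_eq n m) addnC.
by elim: (n %/ m)%nat (n %% m)%nat => [|c IH] e; rewrite ?addn0 // mulSnr addnA fm.
Qed.

(** Bezout: the gcd is a multiple of [m] minus a multiple of [n], hence itself a period. *)
Lemma periodic_gcdn T (f : nat -> T) m n k : (0 < m)%nat ->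
  (forall k, f (k + m)%nat = f k) -> (forall k, f (k + n)%nat = f k) ->
  f k = f (k %% gcdn m n)%nat.
Proof.
move=> m0 fm fn; apply: periodic_modn => {}k.
have mulp p c e : (forall k, f (k + p)%nat = f k) -> f (e + c * p)%nat = f e.
  by move=> fp; elim: c e => [|c IH] e; rewrite ?addn0 // mulSnr addnA fp.
case: (egcdnP n m0) => km kn E _.
by rewrite -[LHS](mulp n kn _ fn) -addnA [(gcdn _ _ + _)%nat]addnC -E (mulp m).
Qed.

Lemma sum_periodic (V : zmodType) (f : nat -> V) m c :
  (forall k, f (k + m)%nat = f k) ->
  \sum_(j < c * m) f j = (\sum_(j < m) f j) *+ c.
Proof.
move=> fm; elim: c => [|c IH]; first by rewrite mul0n big_ord0.
rewrite mulSnr mulrSr -IH -!(big_mkord xpredT f) (big_cat_nat (n := (c * m)%nat)) ?leq_addr //=.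
congr (_ + _); rewrite -{1}[(c * m)%nat]add0n big_addn addKn.
apply: eq_bigr => i _; elim: c {IH} => [|c IH]; first by rewrite mul0n addn0.
by rewrite mulSnr addnA fm.
Qed.

Section Orbits.
Variables (R : realType) (d L : nat) (u : nat -> quat R) (b : 'I_d -> nat).
Hypothesis L_gt0 : (0 < L)%nat.
Hypothesis uD : forall m n, u (m + n)%nat = u m * u n.
Hypothesis uL : u L = 1.
Hypothesis u_cpx : forall n, qj (u n) = 0 /\ qk (u n) = 0.
Hypothesis u_unit : forall n, qnorm2 (u n) = 1.
Hypothesis u_prim : forall n, (u n == 1) = (L %| n)%nat.
(** A normalisation: left multiplication of one coordinate by j is an isometry that turns the
    character b into -b. It makes b_k + b_l divisible by L only for b_k = b_l = 0 or b_k = b_l =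
    L/2. *)
Hypothesis b_le : forall k, ((b k).*2 <= L)%nat.

(** The action of the m-th power of the diagonal generator, [u n] playing the role of z^n. Acting on
    the left, it commutes with right scalars and so descends to quaternionic lines. *)
Definition twist m (x : hvec R d) : hvec R d := fun k => u (b k * m) * x k.

Let u0 : u 0 = 1.
Proof. by apply/eqP; rewrite u_prim dvdn0. Qed.

Let uK m n : (L %| m + n)%nat -> u m * u n = 1.
Proof. by rewrite -u_prim uD => /eqP. Qed.

Lemma twistD m n x k : twist (m + n) x k = twist m (twist n x) k.
Proof. by rewrite /twist mulnDr uD mulrA. Qed.

Lemma u_mulL k m : u (k * (m * L)) = 1.
Proof. by apply/eqP; rewrite u_prim mulnA dvdn_mull. Qed.

Lemma twistL x m k : twist (m * L) x k = x k.
Proof. by rewrite /twist u_mulL mul1r. Qed.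

Lemma hinner_twist m x y : hinner (twist m x) (twist m y) = hinner x y.
Proof.
rewrite !hinnerE; apply: eq_bigr => k _; rewrite /twist qconjM.
rewrite mulrA -[_ * _ * u _]mulrA qCmul u_unit.
by congr (_ * _); apply: quatP => /=; ring.
Qed.

Lemma hnorm2_twist m x : hnorm2 (twist m x) = hnorm2 x.
Proof. by apply: eq_bigr => k _; rewrite /twist qnorm2M u_unit mul1r. Qed.

Variables (s : nat) (msz : nat -> nat) (V : nat -> hvec R d).
Hypothesis msz_gt0 : forall o, (o < s)%nat -> (0 < msz o)%nat.
Hypothesis msz_dvd : forall o, (o < s)%nat -> (msz o %| L)%nat.
(** Points are lines, so an orbit closes up after [msz o] steps as soon as the vector returns up to
    a unit scalar on the right. *)
Hypothesis V_stab : forall o, (o < s)%nat ->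
  exists2 l, qnorm2 l = 1 & forall k, twist (msz o) (V o) k = V o k * l.

Definition overlap o p m := qnorm2 (hinner (V o) (twist m (V p))).

Lemma qnorm2_hinnerC (x y : hvec R d) : qnorm2 (hinner x y) = qnorm2 (hinner y x).
Proof. by rewrite -hinnerC qnorm2C. Qed.

Lemma stab_inner p v m : (p < s)%nat ->
  qnorm2 (hinner v (twist (m + msz p) (V p))) = qnorm2 (hinner v (twist m (V p))).
Proof.
move=> /V_stab [l l1 Vl].
rewrite (@hinner_ext R d v v _ (fun k => twist m (V p) k * l)) //; last first.
  by move=> k; rewrite twistD {1}/twist Vl mulrA.
by rewrite hinner_mulr qnorm2M l1 mulr1.
Qed.

Lemma overlap_sym o p m n : (L %| m + n)%nat -> overlap o p m = overlap p o n.
Proof.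
case/dvdnP=> c E; rewrite /overlap -(hinner_twist n) qnorm2_hinnerC.
congr qnorm2; apply: hinner_ext => // k.
by rewrite -twistD addnC E twistL.
Qed.

Lemma overlap_periodic_r o p m : (p < s)%nat -> overlap o p (m + msz p) = overlap o p m.
Proof. by move=> ps; rewrite /overlap stab_inner. Qed.

Lemma overlap_periodic_l o p m : (o < s)%nat -> overlap o p (m + msz o) = overlap o p m.
Proof.
move=> os; have [n mn] : exists n, (L %| m + msz o + n)%nat.
  exists ((m + msz o) * L.-1)%nat.
  by rewrite -mulnS prednK // dvdn_mull.
rewrite (overlap_sym o p mn) -(overlap_periodic_r _ _ os).
by symmetry; apply: overlap_sym; rewrite addnA addnAC.
Qed.

(** Stability of either vector makes its orbit size a period in [m], so the gcd of the sizes is one.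
    Two orbits thus have only that many overlaps to control. *)
Lemma overlap_gcd o p m : (o < s)%nat -> (p < s)%nat ->
  overlap o p m = overlap o p (m %% gcdn (msz o) (msz p)).
Proof.
move=> os ps; apply: periodic_gcdn; first exact: msz_gt0.
- by move=> k; exact: overlap_periodic_l.
- by move=> k; exact: overlap_periodic_r.
Qed.

Lemma overlap_pair o p i j : (i <= L)%nat ->
  qnorm2 (hinner (twist i (V o)) (twist j (V p))) = overlap o p (j + (L - i)).
Proof.
move=> iL; rewrite -(hinner_twist (L - i)); congr qnorm2.
apply: hinner_ext => k; rewrite -twistD; last by rewrite addnC.
by rewrite subnK // -[L]mul1n twistL.
Qed.

Variable c : R.

(** The frame matrix of the base vectors before averaging. The weight [msz p] compensates for the
    later sum over all L powers, which runs L / [msz p] times through orbit [p]; that sum, [Pi], is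
    L times the frame operator of the union. *)
Let Q k l : quat R := \sum_(p < s) (V p k * qconj (V p l)) *+ msz p.
Hypothesis tight_diag : forall k, \sum_(p < s) qnorm2 (V p k) *+ msz p = c.
Hypothesis tight_off : forall k l : 'I_d, (k < l)%nat -> b k = b l ->
  [/\ qre (Q k l) = 0, qi (Q k l) = 0 &
   (L %| (b k).*2)%nat -> qj (Q k l) = 0 /\ qk (Q k l) = 0].

Let Qc k l : qconj (Q k l) = Q l k.
Proof.
rewrite /Q raddf_sum; apply: eq_bigr => p _.
by rewrite raddfMn /= qconjM qconjK.
Qed.

Let tight_off_sym (k l : 'I_d) : k != l -> b k = b l ->
  [/\ qre (Q k l) = 0, qi (Q k l) = 0 &
   (L %| (b k).*2)%nat -> qj (Q k l) = 0 /\ qk (Q k l) = 0].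
Proof.
move=> kl bkl; have [lt|lt|/val_inj/eqP] := ltngtP k l; last by rewrite (negbTE kl).
  exact: tight_off.
have [q0 q1 q2] := tight_off lt (esym bkl).
rewrite -Qc /= q0 q1 oppr0; split=> //.
by rewrite bkl => /q2 [-> ->]; rewrite oppr0.
Qed.

Let Pi k l : quat R := \sum_(j < L) u (b k * j) * Q k l * qconj (u (b l * j)).

(** Conjugation by the generator shifts the summation index cyclically, the generator having order
    dividing L. *)
Lemma Pi_shift k l : u (b k) * Pi k l * qconj (u (b l)) = Pi k l.
Proof.
rewrite /Pi mulr_sumr mulr_suml.
rewrite (eq_bigr (fun j : 'I_L => u (b k * j.+1) * Q k l * qconj (u (b l * j.+1)))); last first.
  move=> j _; rewrite !mulnS !uD qconjM.
  by rewrite !mulrA.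
have key (f : nat -> quat R) : f L = f 0 -> \sum_(j < L) f j.+1 = \sum_(j < L) f j.
  move=> fL; apply: (addrI (f 0)); rewrite -(big_ord_recl L (fun j => f j)).
  by rewrite big_ord_recr /= fL addrC.
apply: (key (fun j => u (b k * j) * Q k l * qconj (u (b l * j)))).
have uLk e : u (e * L) = u (e * 0).
  by rewrite muln0 u0 -[in LHS](mul1n L) u_mulL.
by rewrite !uLk.
Qed.

(** Complex numbers commute with C and pass through Cj up to conjugation, so x -> p x q^* acts on
    the complex part as p q^* and on the j part as p q. *)
Lemma cpx_sandwich (p q x : quat R) : qj p = 0 -> qk p = 0 -> qj q = 0 -> qk q = 0 ->
  let y := p * x * qconj q in let v := p * qconj q in let w := p * q in
  [/\ qre y = qre v * qre x - qi v * qi x,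
      qi y = qre v * qi x + qi v * qre x,
      qj y = qre w * qj x - qi w * qk x &
      qk y = qre w * qk x + qi w * qj x].
Proof. by move=> p0 p1 q0 q1; split; rewrite /= p0 p1 q0 q1; ring. Qed.

(** The linear map minus the identity has determinant (a - 1)^2 + e^2, which is nonzero. *)
Lemma rot_fixed (a e x y : R) : (a, e) != (1, 0) ->
  x = a * x - e * y -> y = a * y + e * x -> x = 0 /\ y = 0.
Proof.
move=> ae ex ey.
have D : (a - 1) ^+ 2 + e ^+ 2 != 0.
  apply: contra ae; rewrite paddr_eq0 ?sqr_ge0 // !sqrf_eq0 subr_eq0.
  by case/andP=> /eqP -> /eqP ->.
have f1 : (a - 1) * x - e * y = 0 by rewrite mulrBl mul1r addrAC -ex subrr.
have f2 : (a - 1) * y + e * x = 0 by rewrite mulrBl mul1r addrAC -ey subrr.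
split; apply: (mulfI D); rewrite mulr0.
  transitivity ((a - 1) * ((a - 1) * x - e * y) + e * ((a - 1) * y + e * x)); first by ring.
  by rewrite f1 f2; ring.
transitivity ((a - 1) * ((a - 1) * y + e * x) - e * ((a - 1) * x - e * y)); first by ring.
by rewrite f1 f2; ring.
Qed.

(** By [Pi_shift] the complex and j parts of the entry are fixed by the rotations of characters b_k
    - b_l and b_k + b_l, and vanish when these are nontrivial. The trivial ones occur only for b_k =
    b_l, where [tight_off] makes the corresponding part of every summand zero. *)
Lemma Pi_off k l : k != l -> Pi k l = 0.
Proof.
move=> kl.
have [k0 k1] := u_cpx (b k); have [l0 l1] := u_cpx (b l).
pose w2 (p q : quat R) :=
  (qre p * qre q - qi p * qi q - qj p * qj q - qk p * qk q,
   qre p * qi q + qi p * qre q + qj p * qk q - qk p * qj q).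
have w2E p q : w2 p q = (qre (p * q), qi (p * q)) by [].
have := cpx_sandwich (Pi k l) k0 k1 l0 l1; rewrite Pi_shift /= => -[e0 e1 e2 e3].
(* This writes the character b_k - b_l with a natural exponent, b_k + (L - b_l). *)
have uV e : (e <= L)%nat -> qconj (u e) = u (L - e).
  move=> eL; have E : u e * u (L - e) = 1 by apply: uK; rewrite subnKC // dvdnn.
  rewrite -[LHS]mulr1 -E mulrA qCmul u_unit.
  by apply: quatP => /=; ring.
have bL e : (b e <= L)%nat by apply: leq_trans (b_le e); rewrite -addnn leq_addr.
have nz e (ne : ~~ (L %| e)%nat) : (qre (u e), qi (u e)) != (1, 0).
  apply: contra ne; rewrite -u_prim => /eqP [E1 E2]; apply/eqP.
  by have [E3 E4] := u_cpx e; apply: quatP.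
have Z (x : quat R -> R) : (forall j : 'I_L, x (u (b k * j) * Q k l * qconj (u (b l * j))) = 0) ->
  (forall y z, x (y + z) = x y + x z) -> x 0 = 0 -> x (Pi k l) = 0.
  move=> xj xD x0; rewrite /Pi; elim/big_rec: _ => // j y _ IH.
  by rewrite xD IH xj addr0.
have [bkl|bkl] := eqVneq (b k) (b l).
  have [q0 q1 q23] := tight_off_sym kl bkl.
  have C j : [/\ qj (u (b k * j)) = 0, qk (u (b k * j)) = 0,
      qj (u (b l * j)) = 0 & qk (u (b l * j)) = 0].
    by have [? ?] := u_cpx (b k * j); have [? ?] := u_cpx (b l * j).
  have P0 : qre (Pi k l) = 0.
    apply: Z => // j; have [c0 c1 c2 c3] := C j.
    by have [-> _ _ _] := cpx_sandwich (Q k l) c0 c1 c2 c3; rewrite q0 q1 !mulr0 subr0.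
  have P1 : qi (Pi k l) = 0.
    apply: Z => // j; have [c0 c1 c2 c3] := C j.
    by have [_ -> _ _] := cpx_sandwich (Q k l) c0 c1 c2 c3; rewrite q0 q1 !mulr0 addr0.
  have [Lb|Lb] := boolP (L %| (b k).*2)%nat.
    have [q2 q3] := q23 Lb.
    apply: quatP => //=.
      apply: Z => // j; have [c0 c1 c2 c3] := C j.
      by have [_ _ -> _] := cpx_sandwich (Q k l) c0 c1 c2 c3; rewrite q2 q3 !mulr0 subr0.
    apply: Z => // j; have [c0 c1 c2 c3] := C j.
    by have [_ _ _ ->] := cpx_sandwich (Q k l) c0 c1 c2 c3; rewrite q2 q3 !mulr0 addr0.
  have [|P2 P3] := rot_fixed _ e2 e3; last by apply: quatP.
  by rewrite -/(w2 (u (b k)) (u (b l))) w2E -uD nz // -bkl addnn.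
have [|P0 P1] := rot_fixed _ e0 e1.
  rewrite -/(w2 (u (b k)) (qconj (u (b l)))) w2E.
  rewrite uV // -uD nz //.
  have [lt|lt|E] := ltngtP (b k) (b l); last by rewrite E eqxx in bkl.
    have H : (0 < b k + (L - b l) < L)%nat.
      by have := b_le l; rewrite -addnn; lia.
    by case/andP: H => H0 H1; rewrite gtnNdvd.
  have -> : (b k + (L - b l) = L + (b k - b l))%nat by have := bL l; lia.
  have H : (0 < b k - b l < L)%nat.
    by have := b_le k; rewrite -addnn; lia.
  by case/andP: H => H0 H1; rewrite dvdn_addr // gtnNdvd.
have [|P2 P3] := rot_fixed _ e2 e3; last by apply: quatP.
have H : (0 < b k + b l < L)%nat.
  by have := b_le k; have := b_le l; move/eqP: bkl; rewrite -!addnn; lia.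
by case/andP: H => H0 H1; rewrite -/(w2 (u (b k)) (u (b l))) w2E -uD nz // gtnNdvd.
Qed.

Let Pi_diag k : Pi k k = qreal (c *+ L).
Proof.
rewrite /Pi (eq_bigr (fun=> qreal c)); last first.
  move=> j _; rewrite /Q (eq_bigr (fun p : 'I_s => qreal (qnorm2 (V p k) *+ msz p))); last first.
    move=> p _; rewrite qmulC; elim: (msz p) => [|m IH]; last by rewrite !mulrS IH;
      apply: quatP => /=; ring.
    by rewrite !mulr0n.
  have -> : \sum_(p < s) qreal (qnorm2 (V p k) *+ msz p) = qreal c.
    by rewrite -(tight_diag k); apply: quatP; rewrite raddf_sum //= big1.
  rewrite -qrealC -mulrA qmulC u_unit.
  by apply: quatP => /=; ring.
rewrite sumr_const card_ord; elim: L => [|m IH]; first by rewrite !mulr0n.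
by rewrite !mulrS IH; apply: quatP => /=; ring.
Qed.

(** After multiplication by L the inner sums extend to a full period with weight [msz p]. Expanding
    the squares gives the hermitian form with matrix [Pi], which is c L times the identity. *)
Lemma frame (v : hvec R d) :
  \sum_(p < s) \sum_(j < msz p) qnorm2 (hinner v (twist j (V p))) = c * hnorm2 v.
Proof.
have L0 : (L%:R : R) != 0 by rewrite pnatr_eq0 -lt0n.
apply: (mulfI L0); rewrite mulr_sumr.
transitivity (\sum_(p < s) \sum_(j < L) (qnorm2 (hinner v (twist j (V p))) *+ msz p)).
  apply: eq_bigr => p _; have ps := ltn_ord p.
  have := sum_periodic (f := fun j => qnorm2 (hinner v (twist j (V p)))) (m := msz p) (L %/ msz p)
    (fun k => stab_inner v k ps).
  rewrite divnK ?msz_dvd // sumrMnl => ->.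
  by rewrite -mulrnA divnK ?msz_dvd // mulr_natl.
have E p j : qnorm2 (hinner v (twist j (V p))) = \sum_k \sum_l
    qre (qconj (v k) * (u (b k * j) * (V p k * qconj (V p l)) * qconj (u (b l * j))) * v l).
  have -> : forall x : quat R, qnorm2 x = qre (x * qconj x) by move=> x; rewrite qmulC.
  rewrite hinnerC !hinnerE mulr_suml raddf_sum; apply: eq_bigr => k _.
  rewrite mulr_sumr raddf_sum; apply: eq_bigr => l _.
  by rewrite /twist qconjM !mulrA.
transitivity (\sum_k \sum_l qre (qconj (v k) * Pi k l * v l)).
  pose T k l (p j : nat) := qre (qconj (v k) *
    (u (b k * j) * (V p k * qconj (V p l)) * qconj (u (b l * j))) * v l) *+ msz p.
  transitivity (\sum_(p < s) \sum_(j < L) \sum_k \sum_l T k l p j).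
    apply: eq_bigr => p _; apply: eq_bigr => j _; rewrite E -sumrMnl.
    by apply: eq_bigr => k _; rewrite -sumrMnl.
  transitivity (\sum_k \sum_l \sum_(j < L) \sum_(p < s) T k l p j).
    rewrite (eq_bigr (fun p : 'I_s => \sum_k \sum_l \sum_(j < L) T k l p j)); last first.
      by move=> p _; rewrite exchange_big; apply: eq_bigr => k _; rewrite exchange_big.
    rewrite exchange_big; apply: eq_bigr => k _.
    rewrite exchange_big; apply: eq_bigr => l _.
    by rewrite exchange_big.
  apply: eq_bigr => k _; apply: eq_bigr => l _.
  rewrite /Pi mulr_sumr mulr_suml raddf_sum; apply: eq_bigr => j _.
  rewrite /Q mulr_sumr !mulr_suml mulr_sumr mulr_suml raddf_sum; apply: eq_bigr => p _.
  by rewrite /T mulrnAr mulrnAl mulrnAr mulrnAl raddfMn.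
rewrite /hnorm2 mulrA mulr_sumr; apply: eq_bigr => k _.
rewrite (bigD1 k) // big1 ?addr0; last by move=> l lk;
  rewrite (_ : Pi k l = 0) ?mulr0 ?mul0r // Pi_off // eq_sym.
by rewrite Pi_diag /qnorm2 /= -mulr_natl; ring.
Qed.

(** * Constancy of the overlaps from the frame identity *)

Variables (N : nat) (gam : R).
Hypothesis size_sum : (\sum_(p < s) msz p = N)%nat.
Hypothesis V_unit : forall o, (o < s)%nat -> hnorm2 (V o) = 1.
Hypothesis c_gam : c = 1 + gam *+ N.-1.

Let T : finType := {o : 'I_s & 'I_(msz o)}.
Let x (t : T) : hvec R d := twist (tagged t) (V (tag t)).
Let f t t' := qnorm2 (hinner (x t) (x t')).

Let f_id t : f t t = 1.
Proof.
rewrite /f hinnerxx hnorm2_twist V_unit ?ltn_ord // /qnorm2 /=.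
by rewrite expr1n expr0n !addr0.
Qed.

Let cardT : #|T| = N.
Proof. by rewrite card_tagged sumnE big_map big_enum -size_sum; apply: eq_bigr => o _;
  rewrite card_ord. Qed.

(** By the frame identity at x_t the other entries of the row sum to c - 1 = (N - 1) gam. If the
    only values are [gam] and [w], all deviations from [gam] have the sign of w - gam and sum to
    zero, so each is zero. This is what allows one unknown overlap per orbit. *)
Let row t (w : R) : (forall t', t' != t -> f t t' = gam \/ f t t' = w) ->
  forall t', t' != t -> f t t' = gam.
Proof.
move=> H; have S0 : \sum_(t' | t' != t) (f t t' - gam) = 0.
  rewrite sumrB sumr_const.
  have -> : #|(fun t' => t' != t)| = N.-1 by rewrite -cardT (cardC1 t).
  have : \sum_t' f t t' = c.
    rewrite -[RHS]mulr1 -(V_unit (ltn_ord (tag t))) -(hnorm2_twist (tagged t)) -frame.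
    by rewrite sig_big_dep.
  rewrite (bigD1 t) //= f_id c_gam => /addrI ->.
  by rewrite subrr.
have [E|gw] := eqVneq w gam; first by move=> t' /H [] ->.
(* Multiplying by w - gam makes every deviation nonnegative, whatever its sign. *)
have [a [a0 Ha]] : exists a : R, a != 0 /\ forall t', t' != t -> 0 <= a * (f t t' - gam).
  exists (w - gam); rewrite subr_eq0; split=> // t' /H [] ->.
    by rewrite subrr mulr0.
  by rewrite -expr2 sqr_ge0.
move=> t' tt'; apply/eqP; rewrite -subr_eq0 -(mulrI_eq0 _ (mulfI a0)).
have /psumr_eq0P : forall t', t' != t -> 0 <= a * (f t t' - gam) by [].
move=> P; apply/eqP; apply: P => //; rewrite -mulr_sumr.
by apply/eqP; rewrite S0 mulr0.
Qed.

Let f_overlap (t t' : T) : f t t' = overlap (tag t) (tag t') (tagged t' + (L - tagged t)).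
Proof.
apply: overlap_pair; apply: (leq_trans (ltnW (ltn_ord _))); apply: dvdn_leq => //.
exact: msz_dvd.
Qed.

(** Opposite shifts give conjugate inner products, and shifts matter only modulo the orbit size;
    hence half of the shifts within an orbit suffice. *)
Let overlap_sym_o o m n : (o < s)%nat -> (msz o %| m + n)%nat -> overlap o o m = overlap o o n.
Proof.
move=> os mn; have Lm : (m <= m * L)%nat by rewrite leq_pmulr.
rewrite (@overlap_sym o o m (m * L - m)); last by rewrite subnKC // dvdn_mull.
have per e := overlap_periodic_l o e os.
rewrite (periodic_modn _ per) [RHS](periodic_modn _ per); congr (overlap o o _).
apply/eqP; rewrite -(eqn_modDl m) subnKC //.
by move: mn; rewrite /dvdn => /eqP ->; rewrite -/(dvdn _ _) dvdn_mull ?msz_dvd.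
Qed.

Hypothesis pair_self : forall o m, (o < s)%nat -> (2 <= m <= (msz o)./2)%nat -> overlap o o m = gam.
Hypothesis pair_diff : forall o p m, (o < p < s)%nat -> (m < gcdn (msz o) (msz p))%nat ->
  ~~ ((o == 0) && (msz p == 1))%nat -> overlap o p m = gam.
Hypothesis one_pos : forall p, (p < s)%nat -> msz p = 1%nat -> (0 < p)%nat.

(** Symmetry reduces to o < p and periodicity to m below the gcd. What the hypotheses leave open is
    orbit 0 against a one-point orbit. *)
Let pair_all o p m : (o < s)%nat -> (p < s)%nat -> o != p -> overlap o p m = gam.
Proof.
have gt0 e e' : (e < s)%nat -> (0 < gcdn (msz e) (msz e'))%nat.
  by move=> es; rewrite gcdn_gt0 msz_gt0.
have half e e' n : (e < e' < s)%nat -> ~~ ((e == 0) && (msz e' == 1))%nat -> overlap e e' n = gam.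
  move=> /andP [ee' e's]; have es := ltn_trans ee' e's.
  by rewrite (overlap_gcd _ es e's) => H; apply: pair_diff; rewrite ?ee' ?ltn_mod ?gt0.
have sym e e' n : (e' < e < s)%nat -> ~~ ((e' == 0) && (msz e == 1))%nat -> overlap e e' n = gam.
  move=> H1 H2; have nL : (n <= n * L)%nat by rewrite leq_pmulr.
  rewrite (@overlap_sym e e' n (n * L - n)); first exact: half.
  by rewrite subnKC // dvdn_mull.
(* Against a one-point orbit the overlaps of orbit 0 share one value, the gcd being 1; [row] applied
   to that point, with this value as the unknown, determines it. *)
have zero e n : (e < s)%nat -> msz e = 1%nat -> overlap 0 e n = gam.
  move=> es e1; have e0 := one_pos es e1; have s0 := leq_ltn_trans (leq0n e) es.
  have e1' : (0 < msz e)%nat by rewrite e1.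
  pose t : T := Tagged (fun o : 'I_s => 'I_(msz o)) (i := Ordinal es) (Ordinal e1').
  pose t0 : T := Tagged (fun o : 'I_s => 'I_(msz o)) (i := Ordinal s0) (Ordinal (msz_gt0 s0)).
  have Gper k : overlap e 0 k = overlap e 0 0.
    by rewrite (overlap_gcd k es s0) e1 gcd1n modn1.
  have /(_ t0) : forall t', t' != t -> f t t' = gam.
    apply: (@row t (overlap e 0 0)) => -[[a as_] j] tt'; rewrite f_overlap /=;
      move: (_ + _)%nat => n'.
    have [o0|o0] := eqVneq a 0%nat; first by right; rewrite o0 Gper.
    left; have oe : a != e.
      apply: contra tt' => /eqP oe; subst a.
      have {j}-> : j = Ordinal (msz_gt0 as_).
        have j1 : (j < 1)%nat by rewrite -e1; exact: (ltn_ord j).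
        by apply: val_inj => /=; case: (nat_of_ord j) j1.
      by rewrite /t (bool_irrelevance as_ es) (bool_irrelevance e1' (msz_gt0 es)).
    have [lt|gt|E] := ltngtP a e; last by rewrite E eqxx in oe.
    - by apply: sym; rewrite ?lt // (negbTE o0).
    - by apply: half; rewrite ?gt // eqn0Ngt e0.
  rewrite f_overlap /= Gper => H.
  have nL : (n <= n * L)%nat by rewrite leq_pmulr.
  rewrite (@overlap_sym 0 e n (n * L - n)); last by rewrite subnKC // dvdn_mull.
  rewrite Gper; apply/H/eqP => /(congr1 (fun z : T => val (tag z))) /= E.
  by rewrite -E in e0.
move=> os ps; rewrite neq_ltn => /orP [lt|gt].
- have [/andP [/eqP -> /eqP p1]|H] := boolP ((o == 0) && (msz p == 1))%nat; first exact: zero.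
  by apply: half; rewrite ?lt.
- have [/andP [/eqP -> /eqP p1]|H] := boolP ((p == 0) && (msz o == 1))%nat.
    have nL : (m <= m * L)%nat by rewrite leq_pmulr.
    rewrite (@overlap_sym o 0 m (m * L - m)); last by rewrite subnKC // dvdn_mull.
    exact: zero.
  by apply: sym; rewrite ?gt.
Qed.

(** Within an orbit the residues 1 and -1 give the single unknown value fed to [row]; every other
    nonzero residue is brought into [2, M/2] by symmetry. *)
Let f_gam t t' : t' != t -> f t t' = gam.
Proof.
case: t => o i; apply: (@row _ (overlap o o 1)) => -[p j] tt'; rewrite f_overlap /=.
have [po|op] := eqVneq p o; last first.
  by left; apply: pair_all => //; rewrite eq_sym.
subst p; have ij : (i != j :> nat).
  by apply: contra tt' => /eqP E; apply/eqP; congr existT; apply: val_inj.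
have iL : (i <= L)%nat.
  by rewrite (leq_trans (ltnW (ltn_ord i))) // dvdn_leq // msz_dvd.
set m := (j + (L - i))%nat; set M := msz o.
have per e := overlap_periodic_l o e (ltn_ord o).
rewrite (periodic_modn m per) -/M; set r := (m %% M)%nat.
have M0 : (0 < M)%nat by apply: msz_gt0.
have rM : (r < M)%nat by rewrite ltn_mod.
have r0 : (0 < r)%nat.
  rewrite lt0n -/(dvdn _ _); apply: contra ij => D.
  have E : (m + i = j + L)%nat by rewrite /m; lia.
  have : (i = j %[mod M])%nat.
    have : (m + i = 0 + i %[mod M])%nat by apply/eqP; rewrite eqn_modDr mod0n.
    rewrite E add0n => <-; rewrite -modnDmr.
    by move: (msz_dvd (ltn_ord o)); rewrite -/M /dvdn => /eqP ->; rewrite addn0.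
  by rewrite !modn_small ?ltn_ord // => ->.
have [->|r1] := eqVneq r 1%nat; first by right.
have [rl|rl] := eqVneq r M.-1.
  by right; apply: overlap_sym_o => //; rewrite rl addn1 prednK.
left; have [h|h] := leqP r M./2.
  by apply: pair_self => //; rewrite h andbT; lia.
rewrite (@overlap_sym_o o r (M - r)) //; last by rewrite subnKC ?dvdnn // ltnW.
by apply: pair_self => //; lia.
Qed.

Lemma orbits_tight_simplex : gam != 1 -> gam = (N%:R - d%:R) / (d%:R * (N%:R - 1)) ->
  exists y : 'I_N -> hvec R d, tight_simplex y.
Proof.
move=> g1 gE; exists (fun i => x (enum_val (cast_ord (esym cardT) i))).
have E i j : i != j -> enum_val (cast_ord (esym cardT) j) != enum_val (cast_ord (esym cardT) i).
  by apply: contra => /eqP /enum_val_inj /cast_ord_inj ->.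
split=> [i|i j /E ij|i j /E ij]; first by rewrite hnorm2_twist V_unit.
- move=> /same_line_norm; rewrite -[qnorm2 _]/(f _ _) f_gam // => H.
  by case/eqP: g1; apply: H; rewrite hnorm2_twist V_unit.
- by rewrite -gE -(f_gam ij).
Qed.

End Orbits.

(** * A contraction criterion for zeros *)

Section Krawczyk.
Variable R : realType.

Lemma half_exp (r : R) k : r / 2 ^+ k.+1 = r / 2 ^+ k / 2.
Proof. by rewrite exprSr invfM mulrA. Qed.

(** The lower ends w_k - r/2^k increase, the upper ends w_k + r/2^k decrease, and each lower end is
    below each upper end; the supremum of the lower ends is therefore within r/2^k of w_k. *)
Lemma geometric_limit (w : nat -> R) (r : R) :
  (forall k, `|w k.+1 - w k| <= r / 2 ^+ k.+1) ->
  exists l, forall k, `|l - w k| <= r / 2 ^+ k.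
Proof.
move=> step.
have p2 k : 0 < (2 : R) ^+ k by rewrite exprn_gt0.
have half k : r / 2 ^+ k = r / 2 ^+ k.+1 + r / 2 ^+ k.+1.
  by rewrite half_exp; lra.
pose lo k := w k - r / 2 ^+ k; pose hi k := w k + r / 2 ^+ k.
have lo_inc k m : lo k <= lo (k + m)%nat.
  elim: m => [|m IH]; rewrite ?addn0 // addnS (le_trans IH) // /lo.
  move: (step (k + m)%nat) (half (k + m)%nat); rewrite ler_norml.
  by move: (r / 2 ^+ (k + m)) (r / 2 ^+ (k + m).+1) => a e /andP [? ?] ?; lra.
have hi_dec k m : hi (k + m)%nat <= hi k.
  elim: m => [|m IH]; rewrite ?addn0 // addnS (le_trans _ IH) // /hi.
  move: (step (k + m)%nat) (half (k + m)%nat); rewrite ler_norml.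
  by move: (r / 2 ^+ (k + m)) (r / 2 ^+ (k + m).+1) => a e /andP [? ?] ?; lra.
have r0 : 0 <= r by have := le_trans (normr_ge0 _) (step 0); rewrite expr1; lra.
have lohi k m : lo k <= hi m.
  apply: (le_trans (lo_inc k m)); apply: (le_trans _ (hi_dec m k)).
  have : 0 <= r / 2 ^+ (m + k) by rewrite divr_ge0 // ltW.
  by rewrite addnC /lo /hi; move: (r / _) => a ?; lra.
pose E : set R := fun y => exists k, y = lo k.
have supE : has_sup E.
  split; first by exists (lo 0), 0.
  by exists (hi 0) => _ [k ->].
exists (sup E) => k; rewrite ler_distl; apply/andP; split.
  by apply: (sup_upper_bound supE); exists k.
by apply: ge_sup; [exists (lo 0), 0 | move=> _ [m ->]; exact: lohi].
Qed.

Lemma le_geometric (y r : R) : 0 <= r -> (forall k, y <= r / 2 ^+ k) -> y <= 0.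
Proof.
move=> r0 H; rewrite leNgt; apply/negP => y0.
have := archi_boundP (divr_ge0 r0 (ltW y0)); set n := Num.bound _ => Hn.
have := H n; rewrite leNgt => /negP; apply.
rewrite ltr_pdivrMr ?exprn_gt0 // -ltr_pdivrMl // mulrC (lt_trans Hn) //.
by rewrite -natrX ltr_nat ltn_expl.
Qed.

Variables (n : nat) (A J : 'M[R]_n) (F : 'cV[R]_n -> 'cV[R]_n) (f0 : 'cV[R]_n).
Variables (r rho eps : R).

Definition in_box (v : 'cV[R]_n) (m : R) := forall i, `|v i 0| <= m.

(** Absolute row sums bound operators in the sup norm. The term in [rho] pays for the deviation of
    [F] from its linear part [J], and in the next hypothesis the term in [eps] pays for knowing F(0)
    only through the rounded vector [f0]. *)
Hypothesis contr : forall i,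
  \sum_j `|(1%:M - A *m J) i j| + rho * \sum_j `|A i j| <= 1 / 2.
Hypothesis resid : forall i, `|(A *m f0) i 0| + eps * \sum_j `|A i j| <= r / 2.
Hypothesis approx : in_box (F 0 - f0) eps.
Hypothesis slope : forall x y m, in_box x r -> in_box y r -> in_box (x - y) m ->
  in_box (F x - F y - J *m (x - y)) (rho * m).
Hypothesis r_ge0 : 0 <= r.
Hypothesis rho_ge0 : 0 <= rho.

Let T x := x - A *m F x.

Lemma mulmx_box (M : 'M[R]_n) v m i : in_box v m ->
  `|(M *m v) i 0| <= m * \sum_j `|M i j|.
Proof.
move=> vm; rewrite mxE mulr_sumr (le_trans (ler_norm_sum _ _ _)) //.
by apply: ler_sum => j _; rewrite normrM mulrC ler_wpM2r.
Qed.

(** Split T x - T y as (1 - A J)(x - y) - A (F x - F y - J (x - y)); the two parts are the two terms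
    of [contr]. *)
Let T_contr x y m : in_box x r -> in_box y r -> in_box (x - y) m ->
  in_box (T x - T y) (m / 2).
Proof.
move=> xr yr xym i.
have m0 : 0 <= m by apply: le_trans (xym i).
have -> : T x - T y = (1%:M - A *m J) *m (x - y) - A *m (F x - F y - J *m (x - y)).
  rewrite /T mulmxBl mul1mx !mulmxBr !mulmxA.
  by apply/matrixP => a b; rewrite !mxE; ring.
rewrite mxE [X in _ + X]mxE (le_trans (ler_normB _ _)) //.
have h1 := mulmx_box (1%:M - A *m J) i xym.
have h2 := mulmx_box A i (slope xr yr xym).
rewrite (le_trans (lerD h1 h2)) //.
rewrite [rho * m]mulrC -mulrA -mulrDr ler_wpM2l //.
by have := contr i; rewrite mul1r.
Qed.

Let T0_box : in_box (T 0) (r / 2).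
Proof.
move=> i; have -> : T 0 = - (A *m f0) - A *m (F 0 - f0).
  by rewrite /T mulmxBr; apply/matrixP => a b; rewrite !mxE; ring.
rewrite mxE [X in _ + X]mxE mxE (le_trans (ler_normB _ _)) // normrN.
by rewrite (le_trans _ (resid i)) // lerD2l mulmx_box.
Qed.

Let box0 m : 0 <= m -> in_box 0 m.
Proof. by move=> m0 i; rewrite mxE normr0. Qed.

Let w k := ssrnat.iter k T 0.

(** The steps r/2, r/4, ... add up to r - r/2^k after k iterations, so the iterates never leave the
    box in which contraction is known. *)
Let w_box k : in_box (w k) r /\ in_box (w k.+1 - w k) (r / 2 ^+ k.+1).
Proof.
suff H : in_box (w k) (r - r / 2 ^+ k) /\ in_box (w k.+1 - w k) (r / 2 ^+ k.+1).
  split; last by case: H.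
  by move=> i; rewrite (le_trans (H.1 i)) // gerBl divr_ge0 // exprn_ge0.
elim: k => [|k [IH1 IH2]].
  split; first by rewrite expr0 divr1 subrr; exact: box0.
  by rewrite /w /= subr0 expr1.
have E : r - r / 2 ^+ k.+1 = (r - r / 2 ^+ k) + r / 2 ^+ k.+1.
  by rewrite half_exp; lra.
have b1 : in_box (w k.+1) (r - r / 2 ^+ k.+1).
  move=> i; rewrite E; have -> : w k.+1 i 0 = w k i 0 + (w k.+1 - w k) i 0.
    by rewrite !mxE; ring.
  by rewrite (le_trans (ler_normD _ _)) // lerD.
split=> //.
have sub m : in_box m (r - r / 2 ^+ k) \/ in_box m (r - r / 2 ^+ k.+1) -> in_box m r.
  by case=> H i; rewrite (le_trans (H i)) // gerBl divr_ge0 // exprn_ge0.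
rewrite [r / 2 ^+ k.+2]half_exp.
by apply: (T_contr _ _ IH2); apply: sub; [right | left].
Qed.

(** [A J] differs from the identity by row sums at most 1/2, hence is invertible: for a vector z of
    its kernel z = (1 - A J) z, which would halve the largest coordinate. Injectivity of [A] turns a
    fixed point of [T] into a zero of [F]. *)
Let A_inj (v : 'cV[R]_n) : A *m v = 0 -> v = 0.
Proof.
suff U : A \in unitmx by move=> Av; rewrite -[v](mulKmx U) Av mulmx0.
suff : A *m J \in unitmx by rewrite unitmx_mul => /andP [].
set M := A *m J; apply: contraT => /negbTE nU.
have : ~~ row_free M^T by rewrite row_free_unit unitmx_tr nU.
rewrite -kermx_eq0 => /rowV0Pn [z /sub_kermxP zM z0].
have Mz : M *m z^T = 0 by apply: trmx_inj; rewrite trmx_mul trmxK zM trmx0.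
have E : z^T = (1%:M - M) *m z^T by rewrite mulmxBl mul1mx Mz subr0.
have [i0 _] : exists i : 'I_n, z 0 i != 0 by move/rV0Pn: z0 => [i zi]; exists i.
pose i := [arg max_(i > i0) `|z 0 i|]%O.
have imax j : `|z 0 j| <= `|z 0 i|.
  by rewrite /i; case: arg_maxP => // k _ /(_ j isT).
have zi0 : 0 < `|z 0 i|.
  move/rV0Pn: z0 => [j zj]; apply: lt_le_trans (imax j); by rewrite normr_gt0.
have b : in_box z^T `|z 0 i| by move=> j; rewrite mxE.
have := mulmx_box (1%:M - M) i b; rewrite -E mxE.
rewrite -[leLHS]mulr1 ler_pM2l // => H.
have : \sum_j `|(1%:M - M) i j| <= 1 / 2.
  apply: le_trans (contr i); rewrite lerDl mulr_ge0 // sumr_ge0 //.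
by move: H; lra.
Qed.

Theorem krawczyk : exists2 x, in_box x r & F x = 0.
Proof.
have [l Hl] : exists l : 'I_n -> R, forall i k, `|l i - w k i 0| <= r / 2 ^+ k.
  have H i : exists li, forall k, `|li - w k i 0| <= r / 2 ^+ k.
    by apply: geometric_limit => k; have := (w_box k).2 i; rewrite !mxE.
  have [l Hl] := boolp.choice H; by exists l.
pose x : 'cV[R]_n := \col_i l i.
have xw k : in_box (x - w k) (r / 2 ^+ k) by move=> i; rewrite !mxE.
have xr : in_box x r.
  by move=> i; have := xw 0 i; rewrite /w /= subr0 expr0 divr1.
exists x => //; apply: A_inj; apply/matrixP => i j; rewrite ord1 {j} [RHS]mxE.
apply/eqP; rewrite -normr_le0; apply: (@le_geometric _ (r + r)); first by rewrite addr_ge0.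
(* Here w_(k+1) = T w_k and A F x = x - T x; both differences decay geometrically, so no continuity
   argument is required. *)
move=> k; have -> : (A *m F x) = (x - w k.+1) - (T x - T (w k)).
  by rewrite /T /w /=; apply/matrixP => a b; rewrite !mxE; ring.
rewrite mxE [X in _ + X]mxE (le_trans (ler_normB _ _)) //.
have h1 := xw k.+1 i; have h2 := T_contr xr (w_box k).1 (xw k) i.
apply: (le_trans (lerD h1 h2)).
have : 0 <= r / 2 ^+ k by rewrite divr_ge0 // exprn_ge0.
by rewrite half_exp mulrDl; move: (r / 2 ^+ k) => a ?; lra.
Qed.

End Krawczyk.

(** * The fixed-point certificate *)

Section FixedPoint.
Local Open Scope Z_scope.

(** Drops [n] binary digits. Extended by oddness in [shr], it truncates toward zero, with an error
    of less than one unit for either sign. *)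
Fixpoint pshr (n : nat) (p : positive) : Z :=
  match n, p with
  | O, _ => Zpos p
  | S n', xH => 0
  | S n', xO p' | S n', xI p' => pshr n' p'
  end.
Definition shr n z :=
  match z with Z0 => 0 | Zpos p => pshr n p | Zneg p => Z.opp (pshr n p) end.

Definition zsum (s : seq Z) := foldr Z.add 0 s.
Fixpoint dotp (x y : seq Z) : Z :=
  match x, y with a :: x', b :: y' => a * b + dotp x' y' | _, _ => 0 end.

Definition zqadd (p q : quat Z) :=
  Quat (qre p + qre q) (qi p + qi q) (qj p + qj q) (qk p + qk q).
Definition zqmul (p q : quat Z) : quat Z :=
  Quat (qre p * qre q - qi p * qi q - qj p * qj q - qk p * qk q)
       (qre p * qi q + qi p * qre q + qj p * qk q - qk p * qj q)
       (qre p * qj q - qi p * qk q + qj p * qre q + qk p * qi q)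
       (qre p * qk q + qi p * qj q - qj p * qi q + qk p * qre q).
Definition zqconj (q : quat Z) := Quat (qre q) (- qi q) (- qj q) (- qk q).
Definition zqn2 (q : quat Z) := qre q * qre q + qi q * qi q + qj q * qj q + qk q * qk q.
Definition qmap S T (f : S -> T) (q : quat S) :=
  Quat (f (qre q)) (f (qi q)) (f (qj q)) (f (qk q)).
Definition zrot (u : Z * Z) (q : quat Z) :=
  Quat (u.1 * qre q - u.2 * qi q) (u.1 * qi q + u.2 * qre q)
       (u.1 * qj q - u.2 * qk q) (u.1 * qk q + u.2 * qj q).
Definition zq0 : quat Z := Quat 0 0 0 0.
Definition qcomp T (c : nat) (q : quat T) : T :=
  match c with O => qre q | 1%nat => qi q | 2%nat => qj q | _ => qk q end.
Definition zbasis (c : nat) : quat Z :=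
  match c with
  | O => Quat 1 0 0 0 | 1%nat => Quat 0 1 0 0 | 2%nat => Quat 0 0 1 0 | _ => Quat 0 0 0 1
  end.
Definition ziq (q : quat Z) := Quat (- qi q) (qre q) (- qk q) (qj q).

Definition rotstep (c s : Z) (u : Z * Z) : Z * Z :=
  (shr 56 (c * u.1 - s * u.2), shr 56 (s * u.1 + c * u.2)).
(** A candidate sine, which [tab_ok] compares with the true one up to 32 units. The margin is needed
    because moving the cosine by one unit moves the sine by cot (pi / 2q) units, about 13 for q =
    21. *)
Definition sin_of (c : Z) := Z.sqrt (2 ^ 112 - c * c).
(** Powers are computed with 56 fractional bits and stored with 38; the 18 guard bits absorb the
    accumulated error. *)
Definition mktab (c : Z) (n : nat) : seq (Z * Z) :=
  let s := sin_of c in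
  [seq (shr 18 u.1, shr 18 u.2) | u <- traject (rotstep c s) (2 ^ 56, 0) n].
Definition zcheb (x : Z) (n : nat) : Z * Z :=
  ssrnat.iter n (fun t => (t.2, 2 * x * t.2 - 2 ^ 112 * t.1)) (1, x).
(* [zcheb x n] is the Chebyshev value T_n (x / 2^56), scaled by 2^(56 n).  A sign change of T_q
   around [c / 2^56] yields an exact cosine whose unit complex number [z] satisfies z^(4 q) = 1;
   primitivity is read off the table, no entry of which but the first is 1. *)
Definition tab_ok (c : Z) (q : nat) (tab : seq (Z * Z)) : bool :=
  let s := sin_of c in
  [&& (0 < q <= 30)%nat, (zcheb (c - 1) q).1 <=? 0, 0 <=? (zcheb (c + 1) q).1,
      1 <=? c, 32 <=? s, (s - 32) * (s - 32) <=? 2 ^ 112 - (c + 1) * (c + 1),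
      2 ^ 112 - (c - 1) * (c - 1) <=? (s + 32) * (s + 32) &
      all (fun u => u.1 + 2 <? 2 ^ 38) (behead tab)].

(* [EOff k l c] is component [c] of the (k, l) entry of the frame operator, [EPair o p m] the
   overlap of the base vector of orbit [o] with the [m]-th vector of orbit [p]. *)
Inductive equation :=
  ENorm of nat | ETight of nat | EOff of nat & nat & nat | EPair of nat & nat & nat.

(* Orbit [o] consists of the vectors [U^m v_o], [m < n_o], where [U] is left multiplication by
   diag(z^b_0, ..., z^b_(d-1)) and [z] has order [4 * cq]; [cchars] lists the [b_k], [corbs] the
   pairs (n_o, e_o) with [U^(n_o) v_o = v_o z^(e_o)].  The real coordinates of v_0, v_1, ...
   (four per quaternion) are [ccoarse], in units of 2^-10, except that [cpiv] overrides
   coordinate i by x * 2^-38 for each of its pairs (i, x): these coordinates are the unknowns. *)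
Record config := Config {
  cdim : nat; cq : nat; cchars : seq nat; corbs : seq (nat * nat);
  ccoarse : seq Z; cpiv : seq (nat * Z) }.

Fixpoint quads (s : seq Z) : seq (quat Z) :=
  match s with a :: b :: c :: e :: s' => Quat a b c e :: quads s' | _ => [::] end.

Section Case.
Variables (g : config) (tab : seq (Z * Z)).
Let d := cdim g.
Definition period := (4 * cq g)%nat.
Definition norb := size (corbs g).
Definition chr k := nth 0%nat (cchars g) k.
Definition osz o := (nth (0, 0) (corbs g) o).1%nat.
Definition npts : nat := sumn [seq osz o | o <- iota 0 norb].

(** The factor 2^28 passes from units of 2^-10 to the common unit 2^-38. *)
Definition vecs : seq (seq (quat Z)) :=
  let l := quads (foldl (fun X iv => set_nth 0 X iv.1 iv.2)
                        [seq 2 ^ 28 * x | x <- ccoarse g] (cpiv g)) in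
  [seq take d (drop (d * o)%nat l) | o <- iota 0 norb].
Definition uidx (b m : nat) : nat :=
  N.to_nat (N.modulo (N.of_nat b * N.of_nat m) (N.of_nat period)).

(* The frame equation for the last coordinate follows from the others and the norms.  One
   overlap per orbit is left out as well ([EPair o o 1], and [EPair 0 p 0] when orbit [p] is a
   single point): since the overlaps with a fixed vector have a known sum, it is determined by
   the others. *)
Definition eqs : seq equation :=
  [seq ENorm o | o <- iota 0 norb] ++ [seq ETight k | k <- iota 0 d.-1] ++
  flatten [seq flatten [seq
      (if (chr k == chr l)%nat then
         [seq EOff k l c | c <- iota 0 (if (period %| (chr k).*2)%nat then 4 else 2)%nat] else [::])
     | l <- iota k.+1 (d - k.+1)] | k <- iota 0 d] ++
  flatten [seq [seq EPair o o m | m <- iota 2 ((osz o)./2 - 1)] ++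
     flatten [seq [seq EPair o p m | m <- iota 0 (gcdn (osz o) (osz p)) &
                                     ~~ ((o == 0) && (osz p == 1))%nat]
        | p <- iota o.+1 (norb - o.+1)] | o <- iota 0 norb].

Definition zN : Z := Z.of_nat npts.
Definition zd : Z := Z.of_nat d.
(** The prescribed squared inner product, rounded down, in units of 2^-38. *)
Definition target : Z := ((zN - zd) * 2 ^ 38) / (zd * (zN - 1)).

Variable V : seq (seq (quat Z)).
Definition vq o k := nth zq0 (nth [::] V o) k.
Definition vc o k := qmap (shr 18) (vq o k).
Definition trig (m : nat) : seq (Z * Z) :=
  [seq nth (0, 0) tab (uidx (chr k) m) | k <- iota 0 d].

(** For complex u = a + i b one has v^* (u w) = a (v^* w) + b (v^* i w). The pairs (v^* w, v^* i w)
    do not depend on the shift m, so they are computed once and [hval] only combines them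
    linearly. *)
Definition abtab : seq (seq (seq (quat Z * quat Z))) :=
  [seq [seq [seq let q := zqconj (vq o k) in let w := vq p k in
       (qmap (shr 38) (zqmul q w), qmap (shr 38) (zqmul q (ziq w)))
     | k <- iota 0 d] | p <- iota 0 norb] | o <- iota 0 norb].
Definition hval (ab : seq (quat Z * quat Z)) (us : seq (Z * Z)) : quat Z :=
  let f c := shr 38 (zsum [seq let u := nth (0, 0) us k in let x := nth (zq0, zq0) ab k in
     u.1 * qcomp c x.1 + u.2 * qcomp c x.2 | k <- iota 0 d]) in
  Quat (f 0%nat) (f 1%nat) (f 2%nat) (f 3%nat).

(* Values have 38 fractional bits, gradients 16; the frame equations are divided by 32 to keep
   their gradients of the size of the others. *)
Definition fval (e : equation) (h : quat Z) : Z :=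
  match e with
  | ENorm o => shr 38 (zsum [seq zqn2 (vq o k) | k <- iota 0 d]) - 2 ^ 38
  | ETight k =>
      shr 43 (zsum [seq Z.of_nat (osz o) * zqn2 (vq o k) | o <- iota 0 norb]) - (zN * 2 ^ 33) / zd
  | EOff k l c =>
      shr 43 (zsum [seq Z.of_nat (osz o) * qcomp c (zqmul (vq o k) (zqconj (vq o l)))
                   | o <- iota 0 norb])
  | EPair o p m => shr 38 (zqn2 h) - target
  end.

(** Derivative with respect to coordinate k of vector o, as a quaternion of four partial
    derivatives. The shifts contain the factor 2 of a differentiated square and the division by 32:
    38 - 16 - 1 = 21 for norms, 22 + 4 = 26 for the diagonal and 22 + 5 = 27 off it, and 40 - 16 - 1
    = 23 for overlaps, computed from data with 20 bits. *)
Definition grad (e : equation) (us : seq (Z * Z)) (h : quat Z) (o k : nat) : quat Z :=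
  match e with
  | ENorm o' => if o == o' then qmap (shr 21) (vq o k) else zq0
  | ETight k' => if k == k' then qmap (fun x => shr 26 (Z.of_nat (osz o) * x)) (vq o k) else zq0
  | EOff k1 k2 c =>
      zqadd (if k == k1 then qmap (fun x => shr 27 (Z.of_nat (osz o) * x))
                               (zqmul (zbasis c) (vq o k2)) else zq0)
            (if k == k2 then qmap (fun x => shr 27 (Z.of_nat (osz o) * x))
                               (zqmul (zqconj (zbasis c)) (vq o k1)) else zq0)
  | EPair o' p m =>
      let u := nth (0, 0) us k in
      zqadd (if o == o' then qmap (shr 23)
               (zqmul (qmap (shr 20) (zrot u (vc p k))) (zqconj h)) else zq0)
            (if o == p then qmap (shr 23)
               (zqmul (qmap (shr 20) (zrot (u.1, - u.2) (vc o' k))) h) else zq0)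
  end.

(** Orbit, coordinate and component encoded by the flat index i = 4 (d o + k) + c. *)
Definition pivpos (i : nat) : nat * nat * nat :=
  (i %/ (4 * d), (i %% (4 * d)) %/ 4, i %% 4)%nat.

Definition eqdata (ab : seq (seq (seq (quat Z * quat Z)))) (e : equation) : quat Z * seq (Z * Z) :=
  if e is EPair o p m then
    let us := trig m in (hval (nth [::] (nth [::] ab o) p) us, us)
  else (zq0, [::]).
Definition system : seq (Z * seq Z) :=
  let ab := abtab in
  let pp := [seq pivpos iv.1 | iv <- cpiv g] in
  [seq let hu := eqdata ab e in
       let us := [seq (shr 18 u.1, shr 18 u.2) | u <- hu.2] in
       let hc := qmap (shr 18) hu.1 in
       (fval e hu.1, [seq qcomp x.2 (grad e us hc x.1.1 x.1.2) | x <- pp])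
  | e <- eqs].

(** An inactive component is frozen at zero, hence is exactly zero in the solution as well. *)
Definition active o k c : bool :=
  ~~ (qcomp c (vq o k) =? 0) || ((4 * (d * o + k) + c)%nat \in [seq iv.1 | iv <- cpiv g]).
(** The relation U^m v = v z^e, component by component: the complex part of v_k commutes with z and
    asks for b_k m = e modulo the period, the j part conjugates z and asks for b_k m = -e. Only
    active components need either. *)
Definition stab_ok : bool :=
  all (fun o => let m := osz o in let e := (nth (0, 0) (corbs g) o).2%nat in
    all (fun k =>
      ((active o k 0 || active o k 1) ==> (chr k * m == e %[mod period])) &&
      ((active o k 2 || active o k 3) ==> (period %| chr k * m + e)))%nat (iota 0 d))
    (iota 0 norb).
(** These bounds on dimension, number of orbits, number of points and norms (squared norm at most 1
    + 2^-16) are the data of the uniform error analysis. Orbit 0 must not be a single point, since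
    one-point orbits leave out their overlap with it. *)
Definition shape_ok : bool :=
  [&& (1 < d <= 6)%nat, (0 < norb <= 4)%nat, (1 < npts <= 64)%nat, (osz 0 != 1)%nat,
      all (fun o => (0 < osz o)%nat && (osz o %| period)%nat) (iota 0 norb),
      all (fun k => ((chr k).*2 <= period)%nat) (iota 0 d),
      uniq [seq iv.1 | iv <- cpiv g],
      all (fun iv => (iv.1 < 4 * d * norb)%nat) (cpiv g) &
      all (fun o => zsum [seq zqn2 (vq o k) | k <- iota 0 d] <=? 2 ^ 76 + 2 ^ 60) (iota 0 norb)].

End Case.

(* In-place Gauss-Jordan inversion; its output is validated by [contracts], so
   nothing is proved about it. *)
Definition gj_upd (pr row : seq Z) : seq Z :=
  if row is f :: t then [seq x.1 - shr 14 (f * x.2) | x <- zip (rcons t 0) pr] else [::].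
Fixpoint gj (n : nat) (dn rest : seq (seq Z)) : seq (seq Z) :=
  match n, rest with
  | S n', (h :: t) :: rest' =>
      let pr := [seq (x * 2 ^ 14) / h | x <- rcons t (2 ^ 14)] in
      gj n' (pr :: [seq gj_upd pr r | r <- dn]) [seq gj_upd pr r | r <- rest']
  | _, _ => rev dn
  end.
Definition inverse (J : seq (seq Z)) : seq (seq Z) :=
  [seq [seq shr 4 x | x <- r] | r <- gj (size J) [::] [seq [seq shr 2 x | x <- r] | r <- J]].

(* [A] has 10 fractional bits, so the two sums carry 26 and 48: they express
   |1 - A J| + |A| / 2^9 <= 1/2 and |A F| + |A| / 2^29 <= 2^-21 row by row. *)
Definition contracts (n : nat) (F : seq Z) (J A : seq (seq Z)) : bool :=
  let JT := [seq [seq nth 0 r j | r <- J] | j <- iota 0 n] in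
  all (fun i => let a := nth [::] A i in let al := zsum [seq Z.abs x | x <- a] in
    [&& (size a == n)%nat,
        zsum [seq Z.abs ((if i == j then 2 ^ 26 else 0) - dotp a (nth [::] JT j)) | j <- iota 0 n]
          + 2 ^ 7 * al <=? 2 ^ 25 &
        Z.abs (dotp a F) + 2 ^ 9 * al <=? 2 ^ 27]) (iota 0 n).

Definition check (g : config) (tab : seq (Z * Z)) : bool :=
  let V := vecs g in
  let S := system g tab V in
  let J := map snd S in
  [&& shape_ok g V, stab_ok g V, size (cpiv g) == size S &
      contracts (size S) (map fst S) J (inverse J)].

End FixedPoint.

(** * The integer arithmetic seen in the reals *)

Section Embedding.
Variable R : realType.

Definition zr (z : Z) : R := (int_of_Z z)%:~R.

Lemma zrD a b : zr (Z.add a b) = zr a + zr b.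
Proof. by rewrite /zr -intrD; congr intmul; lia. Qed.
Lemma zrN a : zr (Z.opp a) = - zr a.
Proof. by rewrite /zr -intrN; congr intmul; lia. Qed.
Lemma zrB a b : zr (Z.sub a b) = zr a - zr b.
Proof. by rewrite /zr -intrB; congr intmul; lia. Qed.
Lemma zrM a b : zr (Z.mul a b) = zr a * zr b.
Proof. by rewrite /zr -intrM; congr intmul; lia. Qed.
Lemma zr_nat n : zr (Z.of_nat n) = n%:R.
Proof. by rewrite /zr -[RHS]/(n%:Z%:~R); congr intmul; lia. Qed.
Lemma zr0 : zr 0%Z = 0. Proof. by []. Qed.
Lemma zr1 : zr 1%Z = 1. Proof. by []. Qed.
Lemma zr_le a b : (zr a <= zr b) = Z.leb a b.
Proof. by rewrite /zr ler_int; lia. Qed.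
Lemma zr_abs a : zr (Z.abs a) = `|zr a|.
Proof. by rewrite /zr -intr_norm; congr intmul; lia. Qed.
Lemma zr_pow n : zr (2 ^ Z.of_nat n)%Z = 2 ^+ n.
Proof.
elim: n => [|n IH]; first by [].
rewrite Nat2Z.inj_succ Z.pow_succ_r; last by lia.
by rewrite zrM IH exprS.
Qed.

Lemma pshrP n p : exists e : Z, (0 <= e < 2 ^ Z.of_nat n)%Z /\ Zpos p = (2 ^ Z.of_nat n * pshr n p
  + e)%Z.
Proof.
elim: n p => [|n IH] p; first by exists 0%Z; rewrite /=; lia.
rewrite Nat2Z.inj_succ Z.pow_succ_r; last by lia.
have p0 : (0 < 2 ^ Z.of_nat n)%Z by apply: Z.pow_pos_nonneg; lia.
case: p => [p|p|]; rewrite [pshr _ _]/=.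
- have [e [He E]] := IH p; exists (2 * e + 1)%Z; rewrite (Pos2Z.inj_xI p) E.
  by move: (2 ^ _)%Z (pshr n p) He => M x He; split; [lia | ring].
- have [e [He E]] := IH p; exists (2 * e)%Z; rewrite (Pos2Z.inj_xO p) E.
  by move: (2 ^ _)%Z (pshr n p) He => M x He; split; [lia | ring].
- by exists 1%Z; move: (2 ^ _)%Z p0 => M p0; split; [lia | ring].
Qed.

Lemma shrP n z : exists e : Z, (Z.abs e < 2 ^ Z.of_nat n)%Z /\ z = (2 ^ Z.of_nat n * shr n z + e)%Z.
Proof.
have p0 : (0 < 2 ^ Z.of_nat n)%Z by apply: Z.pow_pos_nonneg; lia.
case: z => [|p|p] /=; first by exists 0%Z; rewrite Z.mul_0_r.
  by have [e [He E]] := pshrP n p; exists e; split; first by move: (2 ^ _)%Z He => M; lia.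
have [e [He E]] := pshrP n p; exists (- e)%Z; split; first by move: (2 ^ _)%Z He => M; lia.
by rewrite -Pos2Z.opp_pos E; move: (2 ^ _)%Z => M; ring.
Qed.

Lemma zr_shr n z : `|zr (shr n z) - zr z / 2 ^+ n| <= 1.
Proof.
have [e [He E]] := shrP n z; have p0 : (0 : R) < 2 ^+ n by rewrite exprn_gt0.
have -> : zr (shr n z) - zr z / 2 ^+ n = - (zr e / 2 ^+ n).
  by rewrite {2}E zrD zrM zr_pow mulrDl mulrAC mulfV ?gt_eqF // mul1r opprD addNKr.
rewrite normrN normrM normfV (gtr0_norm p0) ler_pdivrMr // mul1r -zr_abs -zr_pow zr_le.
lia.
Qed.

(** * Chebyshev polynomials and the certified root of unity *)

Definition cheb n : {poly R} * {poly R} :=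
  ssrnat.iter n (fun t => (t.2, 'X *+ 2 * t.2 - t.1)) (1, 'X).

Lemma zchebE (x : Z) (n : nat) (b : R) (t := cheb n) (y := zr x / b) :
  b = 2 ^+ 56 ->
  zr (zcheb x n).1 = b ^+ n * t.1.[y] /\ zr (zcheb x n).2 = b ^+ n.+1 * t.2.[y].
Proof.
move=> bE; have p112 : zr (2 ^ 112)%Z = b ^+ 2.
  by rewrite bE -exprM; exact: (zr_pow 112).
have b0 : b != 0 by rewrite bE expf_neq0 ?pnatr_eq0.
have xE : zr x = b * y by rewrite /y mulrCA mulfV ?mulr1.
rewrite /t {t bE}; elim: n => [|n [IH1 IH2]].
  have -> : (cheb 0).1 = 1%:P by rewrite polyC1.
  have -> : (cheb 0).2 = 'X by [].
  rewrite hornerC.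
  rewrite hornerX.
  rewrite mulr1.
  rewrite expr1.
  rewrite expr0.
  by split; [exact: zr1 | exact: xE].
split; first by rewrite -IH2.
have -> : (zcheb x n.+1).2 = (2 * x * (zcheb x n).2 - 2 ^ 112 * (zcheb x n).1)%Z by [].
have -> : (cheb n.+1).2 = 'X *+ 2 * (cheb n).2 - (cheb n).1 by [].
rewrite zrB [zr (_ * (zcheb x n).2)]zrM [zr (_ * (zcheb x n).1)]zrM IH1 IH2 p112 [zr (2 * x)]zrM.
rewrite hornerD hornerN hornerM hornerMn hornerX xE.
have -> : zr 2 = 2 by [].
by rewrite !exprS mulr2n; move: (b ^+ n) => e; ring.
Qed.

Lemma tab_okP (c : Z) (q : nat) (tab : seq (Z * Z)) (s := sin_of c) : tab_ok c q tab ->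
  [/\ (0 < q <= 30)%nat, ((zcheb (c - 1) q).1 <=? 0)%Z && (0 <=? (zcheb (c + 1) q).1)%Z,
      (1 <=? c)%Z && (32 <=? s)%Z,
      ((s - 32) * (s - 32) <=? 2 ^ 112 - (c + 1) * (c + 1))%Z &&
      (2 ^ 112 - (c - 1) * (c - 1) <=? (s + 32) * (s + 32))%Z &
      all (fun u => u.1 + 2 <? 2 ^ 38)%Z (behead tab)].
Proof. by case/and5P => q0 -> -> -> /and4P [-> -> -> ->]. Qed.

Section Table.
Variables (c0 : Z) (q : nat).
Local Opaque tab_ok.
Hypothesis ok : tab_ok c0 q (mktab c0 (4 * q)%nat).
Let ulp : R := 1 / 2 ^+ 56.
Let ulp_gt0 : 0 < ulp. Proof. by rewrite divr_gt0 // exprn_gt0. Qed.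

(** Intermediate value theorem for T_q between (c0 - 1)/2^56 and (c0 + 1)/2^56, where the integer
    recurrence gives exact signs. *)
Lemma cos_root : exists2 c : R, `|c - zr c0 * ulp| <= ulp & (cheb q).1.[c] = 0.
Proof.
have p0 m : (0 : R) < 2 ^+ m by rewrite exprn_gt0.
case: (tab_okP ok) => _ /andP [lo hi] _ _ _.
have [b bE] : exists b : R, b = 2 ^+ 56 by exists (2 ^+ 56).
have [e1 _] := zchebE (c0 - 1) q bE; have [e2 _] := zchebE (c0 + 1) q bE.
have b0 : 0 < b by rewrite bE.
move: lo hi; rewrite -!zr_le zr0 e1 e2.
rewrite !pmulr_rle0 ?pmulr_rge0 ?exprn_gt0 // => lo hi.
have ab : zr (c0 - 1) / b <= zr (c0 + 1) / b.
  by rewrite ler_pM2r ?invr_gt0 // zr_le; lia.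
have /(poly_ivt ab) [c /andP [c1 c2] /eqP rc] :
    (cheb q).1.[zr (c0 - 1) / b] <= 0 <= (cheb q).1.[zr (c0 + 1) / b].
  by rewrite lo.
exists c => //; move: c1 c2; rewrite zrB zrD zr1 /ulp -bE ler_distl mulrBl mulrDl !mul1r.
by move=> -> ->.
Qed.

(** Take z = c + i sqrt (1 - c^2) at the zero c of T_q. Then Re z^q = T_q(c) = 0, so z^q is i or -i
    and z^(4q) = 1. Scaling by 2^56 turns the estimate of the sine into the integer inequalities of
    [tab_ok]. *)
Lemma unit_root : exists z : quat R,
  [/\ [/\ qj z = 0, qk z = 0 & qnorm2 z = 1], z ^+ (4 * q) = 1 &
     `|qre z - zr c0 * ulp| <= ulp /\ `|qi z - zr (sin_of c0) * ulp| <= 32 * ulp].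
Proof.
have [c cc rc] := cos_root.
have [b bE] : exists b : R, b = 2 ^+ 56 by exists (2 ^+ 56).
have p112 : zr (2 ^ 112)%Z = b ^+ 2.
  by rewrite bE -exprM; exact: (zr_pow 112).
have U : ulp * b = 1.
  have b0 : b != 0.
    by rewrite bE expf_neq0 ?pnatr_eq0.
  by rewrite /ulp -bE mul1r mulVf.
move: (ulp) ulp_gt0 U cc => ul ul0 U cc {bE}.
pose x := c * b.
have cE : c = x * ul by rewrite /x -mulrA [_ * ul]mulrC U mulr1.
case: (tab_okP ok) => /andP [q0 _] _ /andP [c1 s32] /andP [slo shi] _.
set s0 := sin_of c0 in s32 slo shi *.
move: (2 ^ 112)%Z p112 cc c1 s32 slo shi => b2 p112.
rewrite -!zr_le !(zrB, zrD, zrM) p112 zr1 -[zr 32]/(32).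
rewrite -!expr2; move: (zr c0) (zr s0) => C S {p112}.
move=> cc C1 S32 slo shi.
have /andP [xb1 xb2] : C - 1 <= x <= C + 1.
  move: (cc); rewrite {1}cE -mulrBl normrM (gtr0_norm ul0) -[leRHS]mul1r ler_pM2r //.
  by rewrite ler_distl.
have C0 : 0 <= C by apply: le_trans C1.
have S0 : 0 <= S by apply: le_trans S32.
have x0 : 0 <= x by rewrite (le_trans _ xb1) // subr_ge0.
have x2l : (C - 1) ^+ 2 <= x ^+ 2 by rewrite ler_sqr ?nnegrE ?subr_ge0.
have x2u : x ^+ 2 <= (C + 1) ^+ 2 by rewrite ler_sqr ?nnegrE ?addr_ge0.
have D0 : 0 <= b ^+ 2 - x ^+ 2.
  by apply: le_trans (sqr_ge0 (S - 32)) _; apply: le_trans slo _; rewrite lerD2l lerN2.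
pose y := Num.sqrt (b ^+ 2 - x ^+ 2).
have y2 : y ^+ 2 = b ^+ 2 - x ^+ 2 by rewrite sqr_sqrtr.
have yb : S - 32 <= y <= S + 32.
  apply/andP; split; rewrite -ler_sqr ?nnegrE ?sqrtr_ge0 ?subr_ge0 ?addr_ge0 ?y2 //.
  - by apply: le_trans slo _; rewrite lerD2l lerN2.
  - by apply: le_trans shi; rewrite lerD2l lerN2.
pose z : quat R := Quat c (y * ul) 0 0.
have zn : qnorm2 z = 1.
  have -> : qnorm2 z = (x ^+ 2 + y ^+ 2) * ul ^+ 2 by rewrite /qnorm2 /= cE; ring.
  by rewrite y2 addrC subrK -exprMn mulrC U expr1n.
(* Characteristic equation of a unit quaternion; it gives the real parts of the powers the Chebyshev
   recurrence. *)
have zz : z * z = qreal (c *+ 2) * z - 1.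
  apply: quatP => /=; rewrite ?mulr2n; try ring.
  by move: zn; rewrite /qnorm2 /= => H; rewrite -H; ring.
have zc n : [/\ qj (z ^+ n) = 0, qk (z ^+ n) = 0 & qnorm2 (z ^+ n) = 1].
  elim: n => [|n [IH1 IH2 IH3]].
    by rewrite expr0 /qnorm2 /= expr1n expr0n !addr0.
  by rewrite exprS qnorm2M zn IH3 /= IH1 IH2; split; ring.
have re n : qre (z ^+ n) = (cheb n).1.[c] /\ qre (z ^+ n.+1) = (cheb n).2.[c].
  elim: n => [|n [IH1 IH2]]; first by rewrite expr0 expr1 hornerC hornerX.
  split=> //; rewrite [cheb n.+1]/= hornerD hornerN hornerM hornerMn hornerX -IH1 -IH2.
  by rewrite exprS exprS mulrA zz mulrBl mul1r -mulrA -exprS /= !mul0r !subr0.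
exists z; split=> //; last split.
- have [zj zk zn'] := zc q; have [rq _] := re q; rewrite rc in rq.
  have z2 : z ^+ q * z ^+ q = - 1.
    move: zn'; rewrite /qnorm2 rq zj zk expr0n !addr0 add0r => zi.
    by apply: quatP; rewrite /= rq zj zk !(mul0r, mulr0, subr0, addr0, sub0r, oppr0) // -expr2 zi.
  rewrite mulnC exprM -[4%nat]/(2 + 2)%nat exprD expr2 z2.
  by rewrite mulrNN mulr1.
- by [].
- rewrite /= -mulrBl normrM (gtr0_norm ul0) ler_pM2r // ler_distl.
  by case/andP: yb => -> ->.
Qed.

(** Errors only add up along the recursion, since multiplication by the exact unit z preserves the
    norm. One unit of 2^-38 covers the accumulated error and another the final truncation. *)
Lemma trig_table : exists z : quat R,
  [/\ [/\ qj z = 0, qk z = 0 & qnorm2 z = 1], z ^+ (4 * q) = 1 &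
   forall n, (n < 4 * q)%nat -> let t := nth (0, 0)%Z (mktab c0 (4 * q)%nat) n in
     `|qre (z ^+ n) - zr t.1 / 2 ^+ 38| <= 2 / 2 ^+ 38 /\
     `|qi (z ^+ n) - zr t.2 / 2 ^+ 38| <= 2 / 2 ^+ 38].
Proof.
have [z [[zj zk zn] zL [zc zs]]] := unit_root.
case: (tab_okP ok) => /andP [q0 q30] _ _ _ _.
exists z; split=> // n nq.
have q30' : (4 * q <= 120)%nat by lia.
have n120 : (n <= 120)%nat by lia.
have zabs m : qabs (z ^+ m) = 1.
  elim: m => [|m IH]; first by rewrite expr0 /qabs /qnorm2 /= expr1n expr0n !addr0 sqrtr1.
  by rewrite exprS qabsM IH /qabs zn sqrtr1 mulr1.
have [b bE] : exists b : R, b = 2 ^+ 56 by exists (2 ^+ 56).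
have b0 : 0 < b by rewrite bE exprn_gt0.
(* At most 120 steps of 68 units of 2^-56 stay below 10^4 units, hence below 2^18 units, that is
   2^-38. *)
have b18 : (100 * 100 : R) <= b / 2 ^+ 38.
  rewrite bE -[56%nat]/(38 + 18)%nat exprD mulrAC mulfV ?expf_neq0 ?pnatr_eq0 // mul1r.
  rewrite -[18%nat]/(9 + 9)%nat exprD (_ : (2 : R) ^+ 9 = 512); [lra | ring].
pose s0 := sin_of c0.
pose w m := ssrnat.iter m (rotstep c0 s0) (2 ^ 56, 0)%Z.
pose Zw m : quat R := Quat (zr (w m).1 / b) (zr (w m).2 / b) 0 0.
pose z1 : quat R := Quat (zr c0 / b) (zr s0 / b) 0 0.
have ulpb : ulp = b^-1 by rewrite /ulp mul1r bE.
have qabs2 (x y e f : R) : `|x| <= e -> `|y| <= f -> qabs (Quat x y 0 0) <= e + f.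
  move=> xe yf; rewrite (_ : Quat x y 0 0 = qreal x + Quat 0 y 0 0); last first.
    by apply: quatP => /=; ring.
  apply: le_trans (qabsD _ _) _; apply: lerD; first by rewrite qabs_real.
  by rewrite /qabs /qnorm2 /= expr0n add0r !addr0 sqrtr_sqr.
have z1z : qabs (z1 - z) <= 33 / b.
  have -> : z1 - z = Quat (zr c0 / b - qre z) (zr s0 / b - qi z) 0 0.
    by apply: quatP => /=; rewrite ?zj ?zk ?subr0.
  have -> : 33 / b = ulp + 32 * ulp by rewrite ulpb; ring.
  by apply: qabs2; rewrite distrC -ulpb.
have step m : qabs (Zw m.+1 - z1 * Zw m) <= 2 / b.
  have -> : Zw m.+1 - z1 * Zw m = Quat
      ((zr (w m.+1).1 - zr (c0 * (w m).1 - s0 * (w m).2) / b) / b)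
      ((zr (w m.+1).2 - zr (s0 * (w m).1 + c0 * (w m).2) / b) / b) 0 0.
    by apply: quatP; rewrite /= ?(zrB, zrD, zrM); field; rewrite gt_eqF.
  have -> : 2 / b = b^-1 + b^-1 by ring.
  by apply: qabs2; rewrite normrM normfV (gtr0_norm b0) -[leRHS]mul1r ler_pM2r ?invr_gt0 // bE
    zr_shr.
(* One step costs 2 units of truncation plus 33, the error of [z1], times the bound 2 on [Zw m]. *)
have err m : (m <= 120)%nat -> qabs (Zw m - z ^+ m) <= m%:R * (68 / b).
  elim: m => [|m IH] mn.
    have z56 : zr (2 ^ 56)%Z = b by rewrite bE; exact: (zr_pow 56).
    have w1 : zr (w 0%nat).1 = b by rewrite -z56.
    have w2 : zr (w 0%nat).2 = 0 by [].
    have -> : Zw 0%nat = 1 by rewrite /Zw w1 w2 mulfV ?mul0r ?gt_eqF.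
    by rewrite expr0 subrr qabs0 mul0r.
  have {}IH := IH (ltnW mn).
  have small : m%:R * (68 / b) <= 1.
    rewrite mulrA ler_pdivrMr // mul1r.
    have : (m%:R : R) <= 120 by rewrite ler_nat ltnW.
    have : (100 * 100 : R) <= b.
      have P1 : (1 : R) <= 2 ^+ 38 by rewrite exprn_ege1 // ler1n.
      apply: le_trans b18 _; rewrite ler_pdivrMr ?exprn_gt0 //.
      by rewrite ler_peMr // ltW.
    by move: (m%:R) => M *; lra.
  have Zw2 : qabs (Zw m) <= 2.
    have -> : Zw m = (Zw m - z ^+ m) + z ^+ m by rewrite subrK.
    apply: le_trans (qabsD _ _) _; rewrite zabs.
    by apply: le_trans (lerD (le_trans IH small) (lexx 1)) _; lra.
  have -> : Zw m.+1 - z ^+ m.+1 =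
      (Zw m.+1 - z1 * Zw m) + ((z1 - z) * Zw m + z * (Zw m - z ^+ m)).
    by rewrite exprS mulrBl mulrBr !addrA !subrK.
  apply: le_trans (qabsD _ _) _.
  have h1 : qabs ((z1 - z) * Zw m + z * (Zw m - z ^+ m)) <= 66 / b + m%:R * (68 / b).
    apply: le_trans (qabsD _ _) _; apply: lerD.
      rewrite qabsM (_ : 66 / b = 33 / b * 2); last by ring.
      by rewrite ler_pM ?qabs_ge0.
    by rewrite qabsM -(expr1 z) zabs mul1r.
  apply: le_trans (lerD (step m) h1) _.
  by rewrite -natr1 mulrDl mul1r; lra.
rewrite /mktab; move: (4 * q)%nat nq q30' => LL nq q30'.
rewrite (nth_map (2 ^ 56, 0)%Z) ?size_traject // nth_traject // -/(w n).
have En : qabs (Zw n - z ^+ n) <= 1 / 2 ^+ 38.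
  apply: le_trans (err n n120) _.
  have n120R : (n%:R : R) <= 120 by rewrite ler_nat.
  rewrite mulrA ler_pdivrMr // mul1r [_^-1 * b]mulrC; apply: le_trans b18.
  by move: (n%:R) n120R => M *; lra.
have [E0 E1 _ _] := qcomp_le (Zw n - z ^+ n).
have fin (x : Z) (y : R) : `|zr x / b - y| <= 1 / 2 ^+ 38 ->
    `|y - zr (shr 18 x) / 2 ^+ 38| <= 2 / 2 ^+ 38.
  move=> H; rewrite distrC.
  have -> : zr (shr 18 x) / 2 ^+ 38 - y =
     (zr (shr 18 x) - zr x / 2 ^+ 18) / 2 ^+ 38 + (zr x / b - y).
    have -> : b = 2 ^+ 18 * 2 ^+ 38 by rewrite bE -exprD.
    by rewrite (invfM (2 ^+ 18) (2 ^+ 38)); move: (2 ^+ 18)^-1 (2 ^+ 38)^-1 => A B; ring.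
  apply: le_trans (ler_normD _ _) _.
  have -> : (2 : R) / 2 ^+ 38 = 1 / 2 ^+ 38 + 1 / 2 ^+ 38 by rewrite -mulrDl.
  apply: lerD => //; rewrite normrM ler_pM ?zr_shr //.
  by rewrite normfV ger0_norm // exprn_ge0.
by split; apply: fin; [apply: le_trans E0 En | apply: le_trans E1 En].
Qed.

End Table.
End Embedding.

(** * Fixed-point quaternions and their rounding errors *)

Section Rounding.
Variable R : realType.
Implicit Types p q u : quat R.

Local Notation zr := (zr R).
Definition qR (s : nat) (q : quat Z) : quat R := qmap (fun x => zr x / 2 ^+ s) q.
(** Truncation and the Krawczyk box both bound components separately; passing to the Euclidean norm
    costs a factor 2 per quaternion. *)
Definition qle q (e : R) := forall c, `|qcomp c q| <= e.

Lemma qleP q e : `|qre q| <= e -> `|qi q| <= e -> `|qj q| <= e -> `|qk q| <= e -> qle q e.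
Proof. by move=> h0 h1 h2 h3 [|[|[|c]]]. Qed.

Lemma qcompD c p q : qcomp c (p + q) = qcomp c p + qcomp c q.
Proof. by case: c => [|[|[|c]]]. Qed.
Lemma qcompN c p : qcomp c (- p) = - qcomp c p.
Proof. by case: c => [|[|[|c]]]. Qed.
Lemma qcomp_map S T (f : S -> T) c (q : quat S) : qcomp c (qmap f q) = f (qcomp c q).
Proof. by case: c => [|[|[|c]]]. Qed.

Lemma qleD p q e f : qle p e -> qle q f -> qle (p + q) (e + f).
Proof. by move=> h1 h2 c; rewrite qcompD (le_trans (ler_normD _ _)) // lerD. Qed.
Lemma qleN p e : qle p e -> qle (- p) e.
Proof. by move=> h c; rewrite qcompN normrN. Qed.

Lemma qabs_qle q e : qle q e -> qabs q <= 2 * e.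
Proof. by move=> h; apply: qabs_comp;
  [exact: (h 0%nat) | exact: (h 1%nat) | exact: (h 2%nat) | exact: (h 3%nat)]. Qed.

Lemma qle_qabs q : qle q (qabs q).
Proof. by have [? ? ? ?] := qcomp_le q; apply: qleP. Qed.

Lemma hnorm_qle d (x : hvec R d) e : (d <= 6)%nat -> 0 <= e -> (forall k, qle (x k) e) ->
  hnorm x <= 5 * e.
Proof.
move=> d6 e0 H; apply: hnorm_comp => // k.
by split; [exact: (H k 0%nat) | exact: (H k 1%nat) | exact: (H k 2%nat) | exact: (H k 3%nat)].
Qed.

Lemma p2gt0 n : (0 : R) < 2 ^+ n. Proof. by rewrite exprn_gt0. Qed.
Lemma p2neq0 n : (2 : R) ^+ n != 0. Proof. by rewrite gt_eqF // p2gt0. Qed.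

Lemma shr_err s n z : `|zr (shr n z) / 2 ^+ s - zr z / 2 ^+ (s + n)| <= 1 / 2 ^+ s.
Proof.
have -> : zr z / 2 ^+ (s + n) = zr z / 2 ^+ n / 2 ^+ s.
  by rewrite addnC exprD (invfM (2 ^+ n) (2 ^+ s)) mulrA.
rewrite -mulrBl normrM [`|(2 ^+ s)^-1|]ger0_norm ?invr_ge0 ?(ltW (p2gt0 _)) //.
by rewrite ler_pM2r ?invr_gt0 ?p2gt0 // zr_shr.
Qed.

Lemma qR_shr s n (q : quat Z) : qle (qR s (qmap (shr n) q) - qR (s + n) q) (1 / 2 ^+ s).
Proof. by move=> c; rewrite qcompD qcompN !qcomp_map shr_err. Qed.

Lemma qR_shrf s n (f : Z -> Z) (q : quat Z) : qle (qR s (qmap (fun x => shr n (f x)) q) - qR (s +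
  n) (qmap f q)) (1 / 2 ^+ s).
Proof. by move=> c; rewrite qcompD qcompN !qcomp_map shr_err. Qed.

Lemma qRM s t (p q : quat Z) : qR (s + t) (zqmul p q) = qR s p * qR t q.
Proof.
apply: quatP; rewrite /= ?(zrB, zrD, zrM) exprD (invfM (2 ^+ s) (2 ^+ t));
  by move: (2 ^+ s)^-1 (2 ^+ t)^-1 => e f; ring.
Qed.

Lemma qR_conj s (q : quat Z) : qR s (zqconj q) = qconj (qR s q).
Proof. by apply: quatP; rewrite /= ?zrN ?mulNr. Qed.

Lemma qR_add s (p q : quat Z) : qR s (zqadd p q) = qR s p + qR s q.
Proof. by apply: quatP; rewrite /= ?zrD mulrDl. Qed.

Lemma qR_zero s : qR s zq0 = 0.
Proof. by apply: quatP; rewrite /= ?zr0 mul0r. Qed.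

Lemma qR_if s (c : bool) (q : quat Z) : qR s (if c then q else zq0) = if c then qR s q else 0.
Proof. by case: c => //; rewrite qR_zero. Qed.

Definition uR s (u : Z * Z) : quat R := Quat (zr u.1 / 2 ^+ s) (zr u.2 / 2 ^+ s) 0 0.

Lemma qR_rot s t (u : Z * Z) (q : quat Z) : qR (s + t) (zrot u q) = uR s u * qR t q.
Proof.
apply: quatP; rewrite /= ?(zrB, zrD, zrM) exprD (invfM (2 ^+ s) (2 ^+ t));
  by move: (2 ^+ s)^-1 (2 ^+ t)^-1 => e f; ring.
Qed.

Definition qdot p q : R := qre (qconj p * q).

Lemma qdotE p q : qdot p q = qre p * qre q + qi p * qi q + qj p * qj q + qk p * qk q.
Proof. by rewrite /qdot /=; ring. Qed.

Lemma qdotDl p p' q : qdot (p + p') q = qdot p q + qdot p' q.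
Proof. by rewrite !qdotE /=; ring. Qed.
Lemma qdotDr p q q' : qdot p (q + q') = qdot p q + qdot p q'.
Proof. by rewrite !qdotE /=; ring. Qed.
Lemma qdotBl p p' q : qdot (p - p') q = qdot p q - qdot p' q.
Proof. by rewrite !qdotE /=; ring. Qed.
Lemma qdotBr p q q' : qdot p (q - q') = qdot p q - qdot p q'.
Proof. by rewrite !qdotE /=; ring. Qed.
Lemma qdot0l q : qdot 0 q = 0. Proof. by rewrite qdotE /=; ring. Qed.
Lemma qdot0r q : qdot q 0 = 0. Proof. by rewrite qdotE /=; ring. Qed.
Lemma qdot_sumr p d (F : 'I_d -> quat R) : qdot p (\sum_k F k) = \sum_k qdot p (F k).
Proof. by apply: (big_morph (qdot p)) => [x y|]; rewrite ?qdotDr ?qdot0r. Qed.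
Lemma qdot_real a p q : qdot (qreal a * p) q = a * qdot p q.
Proof. by rewrite !qdotE /=; ring. Qed.

Lemma qdot_abs p q : `|qdot p q| <= qabs p * qabs q.
Proof. by have [h _ _ _] := qcomp_le (qconj p * q); rewrite -(qabsC p) -qabsM. Qed.

Lemma qdot_le p u e m : qle p e -> qle u m -> `|qdot p u| <= 4 * e * m.
Proof.
move=> pe um; rewrite qdotE.
have H c : `|qcomp c p * qcomp c u| <= e * m by rewrite normrM ler_pM.
have -> : 4 * e * m = e * m + e * m + e * m + e * m by ring.
apply: le_trans (ler_normD _ _) _; apply: lerD (H 3%nat).
apply: le_trans (ler_normD _ _) _; apply: lerD (H 2%nat).
by apply: le_trans (ler_normD _ _) _; apply: lerD (H 0%nat) (H 1%nat).
Qed.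

Lemma qnorm2_diff p q : qnorm2 p - qnorm2 q = qdot (p + q) (p - q).
Proof. by rewrite qdotE /qnorm2 /=; ring. Qed.

Lemma zr_sum_iota (f : nat -> Z) n : zr (zsum [seq f k | k <- iota 0 n]) = \sum_(k < n) zr (f k).
Proof.
rewrite -(big_mkord xpredT (fun k => zr (f k))) /index_iota subn0.
by elim: (iota 0 n) => [|k s IH]; rewrite ?big_nil // big_cons /= zrD IH.
Qed.

Lemma zr_qn2 (q : quat Z) : zr (zqn2 q) / 2 ^+ 76 = qnorm2 (qR 38 q).
Proof.
rewrite /qnorm2 /zqn2 /= !(zrD, zrM) -[76%nat]/(38 + 38)%nat exprD (invfM (2 ^+ 38) (2 ^+ 38)).
by move: (2 ^+ 38)^-1 => e; ring.
Qed.

End Rounding.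

(** * Variation of the equations *)

Section Slopes.
Variables (R : realType) (g : config) (V : seq (seq (quat Z))).
Local Notation zr := (zr R).
Local Notation d := (cdim g).
Local Notation ns := (norb g).
Hypothesis d6 : (d <= 6)%nat.
Hypothesis ns4 : (ns <= 4)%nat.
Hypothesis N64 : (npts g <= 64)%nat.

Definition center o : hvec R d := fun k => qR R 38 (vq V o k).
Hypothesis center_norm : forall o, (o < ns)%nat -> hnorm2 (center o) <= 1 + 1 / 2 ^+ 16.

Let ep : R := 1 / 2 ^+ 20.
Let ep_gt0 : 0 < ep. Proof. by rewrite divr_gt0 // p2gt0. Qed.

Lemma inv_pow n k : 1 / 2 ^+ n = 2 ^+ k * (1 / 2 ^+ (n + k)) :> R.
Proof. by rewrite exprD !mul1r (invfM (2 ^+ n) (2 ^+ k)) mulrC -mulrA mulVf ?mulr1 ?p2neq0. Qed.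
Lemma inv16 : 1 / 2 ^+ 16 = 16 * ep.
Proof. by rewrite (inv_pow 16 4); congr (_ * _); ring. Qed.
Lemma inv9 : 1 / 2 ^+ 9 = 512 * 4 * ep.
Proof. by rewrite (inv_pow 9 11); congr (_ * _); ring. Qed.
Lemma inv38 : 1 / 2 ^+ 38 <= ep / 1000.
Proof.
rewrite /ep (inv_pow 20 18) -[(20 + 18)%nat]/38%nat.
have h : (1000 : R) <= 2 ^+ 18.
  by rewrite (_ : 2 ^+ 18 = 512 * 512 :> R); [lra | rewrite (_ : 512 = 2 ^+ 9 :> R) -?exprD //;
    ring].
have a0 : 0 <= 1 / (2 : R) ^+ 38 by rewrite divr_ge0 // ltW // p2gt0.
by rewrite ler_pdivlMr ?ltr0n // mulrC ler_wpM2r.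
Qed.
Lemma ep_small : ep <= 1 / (100 * 100).
Proof.
have -> : ep = 1 / (1024 * 1024); last by lra.
by rewrite /ep (_ : 1024 = 2 ^+ 10 :> R) -?exprD //; ring.
Qed.

Lemma sum_le n (F : 'I_n -> R) B : (forall k, `|F k| <= B) -> `|\sum_k F k| <= n%:R * B.
Proof.
move=> H; apply: le_trans (ler_norm_sum _ _ _) _.
by apply: le_trans (ler_sum _ (fun k _ => H k)) _; rewrite sumr_const card_ord mulr_natl.
Qed.

Lemma pick_sum n (F : nat -> R) i : (i < n)%nat ->
  \sum_(j < n) (if (j : nat) == i then F j else 0) = F i.
Proof.
move=> lt; rewrite (bigD1 (Ordinal lt)) //= eqxx big1 ?addr0 // => j /negbTE.
by rewrite -val_eqE /= => ->.
Qed.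

Variables (x y : nat -> hvec R d) (m : R).
Hypothesis xc : forall o k, qle (x o k - center o k) ep.
Hypothesis yc : forall o k, qle (y o k - center o k) ep.
Definition dif o : hvec R d := fun k => x o k - y o k.
Hypothesis dm : forall o k, qle (dif o k) m.

Hypothesis m_ge0 : 0 <= m.

(** |x|^2 - |y|^2 is exactly <x + y, x - y>, so the error of the computed gradient 2 v is the sum of
    two displacements and one rounding: 4 (1 + 1 + 16) = 72 ep m per coordinate, at most 432 ep m in
    all. *)
Lemma slope_norm o us h : (o < ns)%nat ->
  `|hnorm2 (x o) - hnorm2 (y o) -
    \sum_(o' < ns) \sum_(k < d) qdot (qR R 16 (grad g V (ENorm o) us h o' k)) (dif o' k)|
  <= m * (1 / 2 ^+ 9).
Proof.
move=> os.
pose G o' := \sum_(k < d) qdot (qR R 16 (qmap (shr 21) (vq V o' k))) (dif o' k).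
rewrite (eq_bigr (fun o' : 'I_ns => if (o' : nat) == o then G o' else 0)); last first.
  move=> o' _; rewrite /G /=; case: eqP => // _; rewrite big1 // => k _.
  by rewrite qR_zero qdot0l.
rewrite pick_sum // -sumrB -sumrB.
rewrite (eq_bigr (fun k : 'I_d => qdot (x o k + y o k - qR R 16 (qmap (shr 21) (vq V o k))) (dif o
  k))); last first.
  by move=> k _; rewrite qdotBl qnorm2_diff.
have H (k : 'I_d) : `|qdot (x o k + y o k - qR R 16 (qmap (shr 21) (vq V o k))) (dif o k)| <= 72 *
  ep * m.
  have -> : 72 * ep * m = 4 * (ep + ep + 16 * ep) * m by ring.
  apply: qdot_le (dm o k); rewrite -inv16.
  have c2 : center o k + center o k = qR R 37 (vq V o k).
    have E t : zr t / 2 ^+ 37 = zr t / 2 ^+ 38 + zr t / 2 ^+ 38.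
      by rewrite -[(_ ^+ 37)^-1]mul1r (inv_pow 37 1) -[(37 + 1)%nat]/38%nat expr1 mul1r; ring.
    by apply: quatP; rewrite /= E.
  have -> : x o k + y o k - qR R 16 (qmap (shr 21) (vq V o k)) =
    (x o k - center o k) + (y o k - center o k) + - (qR R 16 (qmap (shr 21) (vq V o k)) - qR R 37
      (vq V o k)).
    by rewrite -c2 opprB; apply: quatP => /=; ring.
  by apply: qleD (qleN (qR_shr _ _ _ _)); apply: qleD.
apply: le_trans (sum_le H) _; rewrite inv9.
have : (d%:R : R) <= 6 by rewrite ler_nat.
have : 0 <= ep * m by rewrite mulr_ge0 // ltW.
by move: (d%:R) => D; move: ep m {H} => e M *; nra.
Qed.

Let ns_le : (ns%:R : R) <= 4. Proof. by rewrite ler_nat. Qed.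

Let msum : \sum_(o < ns) ((osz g o)%:R : R) <= 64.
Proof.
rewrite -natr_sum ler_nat; apply: leq_trans N64.
rewrite /npts sumnE big_map -(big_mkord xpredT (fun o => osz g o)) /index_iota subn0.
exact: leqnn.
Qed.

(** Displacement errors are weighted by orbit sizes, whose sum is at most 64; rounding errors occur
    once for each of at most four orbits. *)
Let sum_tau (F : 'I_ns -> R) a b : 0 <= a -> 0 <= b ->
  (forall o, `|F o| <= a * (osz g o)%:R + b) -> `|\sum_o F o| <= 64 * a + 4 * b.
Proof.
move=> a0 b0 H; apply: le_trans (ler_norm_sum _ _ _) _.
apply: le_trans (ler_sum _ (fun o _ => H o)) _.
rewrite big_split /= -mulr_sumr sumr_const card_ord -[b *+ ns]mulr_natl.
by apply: lerD; [rewrite mulrC ler_wpM2r | rewrite ler_wpM2r].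
Qed.

(** Same identity as for the norms, weighted by n_o / 32. The total is 64/4 + 4 * 64 = 272 ep m;
    without the division by 32 the weights would exceed the budget. *)
Lemma slope_tight k us h : (k < d)%nat ->
  forall kk : 'I_d, kk = k :> nat ->
  `|(\sum_(o < ns) qnorm2 (x o kk) *+ osz g o) / 32 - (\sum_(o < ns) qnorm2 (y o kk) *+ osz g o) /
    32 -
    \sum_(o' < ns) \sum_(k' < d) qdot (qR R 16 (grad g V (ETight k) us h o' k')) (dif o' k')|
  <= m * (1 / 2 ^+ 9).
Proof.
move=> kd kk kkE.
pose G o := qR R 16 (qmap (fun t => shr 26 (Z.of_nat (osz g o) * t)%Z) (vq V o kk)).
rewrite [X in _ - X](eq_bigr (fun o : 'I_ns => qdot (G o) (dif o kk))); last first.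
  move=> o _; rewrite (bigD1 kk) //= kkE eqxx -kkE big1 ?addr0 // => k' ne.
  by rewrite -val_eqE /= in ne; rewrite (negbTE ne) qR_zero qdot0l.
rewrite -mulrBl -!sumrB mulr_suml -sumrB.
have H (o : 'I_ns) : `|(qnorm2 (x o kk) *+ osz g o - qnorm2 (y o kk) *+ osz g o) / 32 - qdot (G o)
  (dif o kk)|
    <= (ep * m / 4) * (osz g o)%:R + 64 * ep * m.
  pose w : R := (osz g o)%:R / 32.
  have -> : (qnorm2 (x o kk) *+ osz g o - qnorm2 (y o kk) *+ osz g o) / 32 - qdot (G o) (dif o kk) =
     qdot (qreal w * (x o kk + y o kk) - G o) (dif o kk).
    by rewrite qdotBl qdot_real -qnorm2_diff -mulrnBl -[_ *+ osz g o]mulr_natl mulrAC.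
  have -> : ep * m / 4 * (osz g o)%:R + 64 * ep * m = 4 * (w * (ep + ep) + 16 * ep) * m by rewrite
    /w; field.
  apply: qdot_le (dm o kk); rewrite -inv16.
  have c2 : qreal w * (center o kk + center o kk) = qR R (16 + 26) (qmap (fun t => Z.of_nat (osz g
    o) * t)%Z (vq V o kk)).
    have E t : zr (Z.of_nat (osz g o) * t)%Z / 2 ^+ (16 + 26) = w * (zr t / 2 ^+ 38 + zr t / 2 ^+
      38).
      rewrite zrM zr_nat /w -[(16 + 26)%nat]/(38 + 4)%nat exprD (invfM (2 ^+ 38) (2 ^+ 4)).
      have -> : ((2 : R) ^+ 4)^-1 = 2 / 32 by rewrite (_ : 2 ^+ 4 = 16 :> R); [field | ring].
      by move: (2 ^+ 38)^-1 => e; ring.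
    by apply: quatP; rewrite /= !E; ring.
  have -> : qreal w * (x o kk + y o kk) - G o =
    qreal w * ((x o kk - center o kk) + (y o kk - center o kk)) +
    - (G o - qR R (16 + 26) (qmap (fun t => Z.of_nat (osz g o) * t)%Z (vq V o kk))).
    by rewrite -c2 opprB; apply: quatP => /=; ring.
  apply: qleD; last by apply: qleN; apply: qR_shrf.
  have w0 : 0 <= w by rewrite divr_ge0.
  have xy := qleD (xc o kk) (yc o kk).
  move=> c; have -> : qcomp c (qreal w * (x o kk - center o kk + (y o kk - center o kk))) =
     w * qcomp c (x o kk - center o kk + (y o kk - center o kk)).
    by case: c => [|[|[|c]]] /=; ring.
  by rewrite normrM (ger0_norm w0) ler_wpM2l.
apply: le_trans (sum_tau _ _ H) _; rewrite ?inv9.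
- by rewrite divr_ge0 // mulr_ge0 // ltW.
- by rewrite mulr_ge0 // mulr_ge0 // ltW.
have : 0 <= ep * m by rewrite mulr_ge0 // ltW.
by move: ep m {H} => e M *; nra.
Qed.

(** Split the bilinear difference as (x1 - y1) x2^* + y1 (x2 - y2)^*: each gradient is compared with
    a single displaced vector. The total is 64/4 + 4 * 128 = 528 ep m. *)
Lemma slope_off (k1 k2 : 'I_d) c us h :
  let F (v : nat -> hvec R d) := qcomp c (\sum_(o < ns) (v o k1 * qconj (v o k2)) *+ osz g o) / 32
    in
  `|F x - F y -
    \sum_(o' < ns) \sum_(k' < d) qdot (qR R 16 (grad g V (EOff k1 k2 c) us h o' k')) (dif o' k')|
  <= m * (1 / 2 ^+ 9).
Proof.
pose f (q : quat Z) o := qmap (fun t => shr 27 (Z.of_nat (osz g o) * t)%Z) q.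
pose G1 o := f (zqmul (zbasis c) (vq V o k2)) o.
pose G2 o := f (zqmul (zqconj (zbasis c)) (vq V o k1)) o.
rewrite /= [X in _ - X](eq_bigr (fun o : 'I_ns => qdot (qR R 16 (G1 o)) (dif o k1) + qdot (qR R 16
  (G2 o)) (dif o k2))); last first.
  move=> o _; rewrite [LHS](eq_bigr (fun k' : 'I_d =>
     (if (k' : nat) == k1 then qdot (qR R 16 (G1 o)) (dif o k1) else 0) +
     (if (k' : nat) == k2 then qdot (qR R 16 (G2 o)) (dif o k2) else 0))); last first.
    move=> k' _; rewrite qR_add qdotDl !qR_if; congr (_ + _).
      by case: eqP => [/val_inj -> //|]; rewrite qdot0l.
    by case: eqP => [/val_inj -> //|]; rewrite qdot0l.
  by rewrite big_split /= !(pick_sum (fun=> _)).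
pose e : quat R := qR R 0 (zbasis c).
have qe p : qcomp c p = qdot e p.
  by rewrite qdotE /e; case: (c) => [|[|[|c']]] /=; rewrite ?zr0 ?zr1 !divr1; ring.
have qen p a : qle p a -> qle (e * p) a /\ qle (qconj e * p) a.
  move=> H; have Hn t : `|qcomp t p| <= a by [].
  move: (Hn 0%nat) (Hn 1%nat) (Hn 2%nat) (Hn 3%nat) => /= h0 h1 h2 h3.
  have E : e = match c with O => 1 | 1%nat => Quat 0 1 0 0 | 2%nat => Quat 0 0 1 0 | _ => Quat 0 0
    0 1 end.
    by rewrite /e; case: (c) => [|[|[|c']]]; apply: quatP; rewrite /= ?zr0 ?zr1 ?mul0r ?divr1.
  rewrite E; case: (c) => [|[|[|c']]];
    split; apply: qleP; rewrite /= ?(mul0r, mul1r, oppr0, addr0, add0r, subr0, sub0r, opprK,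
      mulN1r, mulNr) ?normrN //.
have dif_sum (v : nat -> hvec R d) : qcomp c (\sum_(o < ns) (v o k1 * qconj (v o k2)) *+ osz g o) /
  32 =
    \sum_(o < ns) ((osz g o)%:R / 32) * qdot e (v o k1 * qconj (v o k2)).
  rewrite qe qdot_sumr mulr_suml; apply: eq_bigr => o _.
  have -> : forall (p : quat R) n, qdot e (p *+ n) = n%:R * qdot e p.
    by move=> p n; elim: n => [|n IH];
      rewrite ?mulr0n ?qdot0r ?mul0r // mulrS qdotDr IH -nat1r mulrDl mul1r.
  by rewrite mulrAC.
rewrite !dif_sum -!sumrB.
have H (o : 'I_ns) : `|(osz g o)%:R / 32 * qdot e (x o k1 * qconj (x o k2)) -
    (osz g o)%:R / 32 * qdot e (y o k1 * qconj (y o k2)) -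
    (qdot (qR R 16 (G1 o)) (dif o k1) + qdot (qR R 16 (G2 o)) (dif o k2))|
    <= (ep * m / 4) * (osz g o)%:R + 128 * ep * m.
  set w : R := (osz g o)%:R / 32.
  have w0 : 0 <= w by rewrite divr_ge0.
  have -> : w * qdot e (x o k1 * qconj (x o k2)) - w * qdot e (y o k1 * qconj (y o k2)) -
    (qdot (qR R 16 (G1 o)) (dif o k1) + qdot (qR R 16 (G2 o)) (dif o k2)) =
    qdot (qreal w * (e * x o k2) - qR R 16 (G1 o)) (dif o k1) +
    qdot (qreal w * (qconj e * y o k1) - qR R 16 (G2 o)) (dif o k2).
    have -> : qdot e (x o k1 * qconj (x o k2)) = qdot (e * x o k2) (x o k1) by rewrite !qdotE /=;
      ring.
    have -> : qdot e (y o k1 * qconj (y o k2)) = qdot (e * y o k2) (y o k1) by rewrite !qdotE /=;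
      ring.
    rewrite !qdotBl !qdot_real /dif !qdotBr.
    have -> : qdot (qconj e * y o k1) (x o k2) = qdot (e * x o k2) (y o k1) by rewrite !qdotE /=;
      ring.
    have -> : qdot (qconj e * y o k1) (y o k2) = qdot (e * y o k2) (y o k1) by rewrite !qdotE /=;
      ring.
    by ring.
  have -> : ep * m / 4 * (osz g o)%:R + 128 * ep * m =
     4 * (w * ep + 16 * ep) * m + 4 * (w * ep + 16 * ep) * m by rewrite /w; field.
  have c2 (q : quat Z) (p v : quat R) : qle (v - p * qR R 38 q) ep ->
      forall b : quat Z, p = qR R 0 b ->
      qle (qreal w * v - qR R 16 (f (zqmul b q) o)) (w * ep + 16 * ep).
    move=> Hv b pE.
    have cc : qreal w * (p * qR R 38 q) = qR R (16 + 27) (qmap (fun t => Z.of_nat (osz g o) * t)%Z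
      (zqmul b q)).
      rewrite pE -qRM.
      have E t : zr (Z.of_nat (osz g o) * t)%Z / 2 ^+ (16 + 27) = w * (zr t / 2 ^+ (0 + 38)).
        rewrite zrM zr_nat /w -[(16 + 27)%nat]/(38 + 5)%nat exprD (invfM (2 ^+ 38) (2 ^+ 5)).
        have -> : ((2 : R) ^+ 5)^-1 = 1 / 32 by rewrite (_ : 2 ^+ 5 = 32 :> R);
          [rewrite mul1r | ring].
        by rewrite add0n; move: (2 ^+ 38)^-1 => e'; ring.
      by apply: quatP; rewrite /qR [qmap]lock /= -lock /= !E; ring.
    have -> : qreal w * v - qR R 16 (f (zqmul b q) o) = qreal w * (v - p * qR R 38 q) +
       - (qR R 16 (f (zqmul b q) o) - qR R (16 + 27) (qmap (fun t => Z.of_nat (osz g o) * t)%Z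
         (zqmul b q))).
      by rewrite -cc opprB mulrBr addrA subrK.
    apply: qleD; last by apply: qleN; rewrite -inv16; apply: qR_shrf.
    move=> t; have -> : qcomp t (qreal w * (v - p * qR R 38 q)) = w * qcomp t (v - p * qR R 38 q).
      by move: (v - _) => a; case: t => [|[|[|t]]] /=; ring.
    by rewrite normrM (ger0_norm w0) ler_wpM2l.
  apply: le_trans (ler_normD _ _) _; apply: lerD.
    apply: qdot_le (dm o k1); apply: (c2 _ e) => //.
    by have := (qen _ _ (xc o k2)).1; rewrite mulrBr.
  apply: qdot_le (dm o k2); apply: (c2 _ (qconj e)); last by rewrite qR_conj.
  by have := (qen _ _ (yc o k1)).2; rewrite mulrBr.
apply: le_trans (sum_tau _ _ H) _; rewrite ?inv9.
- by rewrite divr_ge0 // mulr_ge0 // ltW.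
- by rewrite mulr_ge0 // mulr_ge0 // ltW.
have : 0 <= ep * m by rewrite mulr_ge0 // ltW.
by move: ep m {H} => e' M *; nra.
Qed.

End Slopes.

Section HNorm.
Variables (R : realType) (d : nat).
Implicit Types x y : hvec R d.

Lemma hnorm_ext x y : x =1 y -> hnorm x = hnorm y.
Proof. by move=> E; rewrite /hnorm /hnorm2; congr Num.sqrt; apply: eq_bigr => k _; rewrite E. Qed.

Lemma hnorm_mul (a : 'I_d -> quat R) x e : 0 <= e -> (forall k, qabs (a k) <= e) ->
  hnorm (fun k => a k * x k) <= e * hnorm x.
Proof.
move=> e0 H; rewrite hnorm_le ?mulr_ge0 ?hnorm_ge0 // exprMn sqr_hnorm /hnorm2 mulr_sumr.
apply: ler_sum => k _; rewrite qnorm2M ler_wpM2r ?qnorm2_ge0 //.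
by rewrite -sqr_qabs ler_sqr ?nnegrE ?qabs_ge0.
Qed.

Lemma hinner_adj (w : 'I_d -> quat R) x y :
  hinner x (fun k => w k * y k) = hinner (fun k => qconj (w k) * x k) y.
Proof. by rewrite !hinnerE; apply: eq_bigr => k _; rewrite qconjM qconjK mulrA. Qed.

Lemma hinner_mulB (w : 'I_d -> quat R) x y z :
  hinner x (fun k => w k * (y k - z k)) = hinner x (fun k => w k * y k) - hinner x (fun k => w k *
    z k).
Proof. by rewrite -hinnerBr; apply: hinner_ext => // k; rewrite mulrBr. Qed.

Lemma qdot_hinner q x y :
  qdot q (hinner x y) = \sum_k qdot (y k * qconj q) (x k).
Proof.
rewrite hinnerE qdot_sumr; apply: eq_bigr => k _.
by rewrite !qdotE /=; ring.
Qed.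

Lemma qdot_hinner_r q x y :
  qdot q (hinner x y) = \sum_k qdot (x k * q) (y k).
Proof.
rewrite hinnerE qdot_sumr; apply: eq_bigr => k _.
by rewrite !qdotE /=; ring.
Qed.

End HNorm.

(** * Variation of the overlaps *)

Section PairSlope.
Variables (R : realType) (g : config) (V : seq (seq (quat Z))).
Local Notation zr := (zr R).
Local Notation d := (cdim g).
Local Notation ns := (norb g).
Local Notation center := (center R V).
Hypothesis d6 : (d <= 6)%nat.
Hypothesis center_norm : forall o, (o < ns)%nat -> hnorm2 (center o : hvec R d) <= 1 + 1 / 2 ^+ 16.

Let ep : R := 1 / 2 ^+ 20.
Let ep_gt0 : 0 < ep. Proof. by rewrite divr_gt0 // p2gt0. Qed.
Let ep_ge0 : 0 <= ep. Proof. exact: ltW. Qed.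
Let ep_sm : ep <= 1 / (100 * 100). Proof. exact: ep_small. Qed.

Lemma center_hnorm o : (o < ns)%nat -> hnorm (center o : hvec R d) <= 1001 / 1000.
Proof.
move=> os; rewrite hnorm_le; last by lra.
apply: le_trans (center_norm os) _.
have := inv16 R; rewrite -/ep => ->; move: ep ep_sm => e *; lra.
Qed.

Definition hshift (w : 'I_d -> quat R) (x : hvec R d) : hvec R d := fun k => w k * x k.

(* The coarse rotated vector stored in the gradient differs from the true one
   by the perturbation, two truncations and the trigonometric error. *)
Lemma rot_err (w : 'I_d -> quat R) (u : nat -> Z * Z) o (x : hvec R d) : (o < ns)%nat ->
  (forall k, qabs (w k) = 1) ->
  (forall k : 'I_d, qle (w k - uR R 20 (u k)) (101 / 100 * ep)) ->
  (forall k, qle (x k - center o k) ep) ->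
  hnorm (fun k : 'I_d => w k * x k - qR R 20 (qmap (shr 20) (zrot (u k) (vc V o k)))) <= 171 / 10 *
    ep.
Proof.
move=> os w1 wu xc.
pose Xc k := qR R 20 (vc V o k).
have cX (k : 'I_d) : qle (center o k - Xc k) ep.
  by rewrite -opprB; apply: qleN; apply: (qR_shr R 20 18).
(* The four parts cost 5, 5, 2.1 and 5 in units of ep, together 17.1; each 5 is the passage from a
   componentwise bound to the norm. *)
pose A : hvec R d := fun k => w k * (x k - center o k).
pose B : hvec R d := fun k => w k * (center o k - Xc k).
pose C : hvec R d := fun k => (w k - uR R 20 (u k)) * Xc k.
pose D : hvec R d := fun k => uR R 20 (u k) * Xc k - qR R 20 (qmap (shr 20) (zrot (u k) (vc V o
  k))).
have bw v : (forall k : 'I_d, qle (v k) ep) -> hnorm (fun k => w k * v k) <= 5 * ep.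
  move=> H; apply: le_trans (_ : 1 * hnorm v <= _); last by rewrite mul1r; apply: hnorm_qle.
  by apply: hnorm_mul => // k; rewrite w1.
have hX : hnorm (fun k : 'I_d => Xc k) <= 101 / 100.
  rewrite (hnorm_ext (y := fun k => center o k + - (center o k - Xc k))); last first.
    by move=> k; rewrite opprB addrC subrK.
  apply: le_trans (hnorm_add (center o) (fun k => - (center o k - Xc k))) _;
    apply: le_trans (lerD (center_hnorm os) _) _.
  - by apply: (@hnorm_qle R d _ ep) => // k; apply: qleN.
  - by move: ep ep_sm => e *; lra.
have hA : hnorm A <= 5 * ep by apply: bw.
have hB : hnorm B <= 5 * ep by apply: bw.
have hC : hnorm C <= 21 / 10 * ep.
  apply: le_trans (_ : 2 * (101 / 100 * ep) * hnorm (fun k : 'I_d => Xc k) <= _).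
    by apply: hnorm_mul => [|k]; [move: ep ep_ge0 => e *; lra | apply: qabs_qle].
  have c0 : 0 <= 2 * (101 / 100 * ep) by move: ep ep_ge0 => e *; lra.
  by apply: le_trans (ler_wpM2l c0 hX) _; move: ep ep_ge0 => e *; lra.
have hD : hnorm D <= 5 * ep.
  apply: hnorm_qle => // k; rewrite /D -(qR_rot R 20 20) -opprB; apply: qleN.
  exact: (qR_shr R 20 20).
rewrite (hnorm_ext (y := fun k => (A k + B k) + (C k + D k))); last first.
  by move=> k; rewrite /A /B /C /D !mulrBr mulrBl; apply: quatP => /=; ring.
apply: le_trans (hnorm_add (fun k => A k + B k) (fun k => C k + D k)) _.
apply: le_trans (lerD (hnorm_add A B) (hnorm_add C D)) _.
by move: hA hB hC hD; move: (hnorm A) (hnorm B) (hnorm C) (hnorm D) (ep) ep_ge0 => *; lra.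
Qed.

Variables (x y : nat -> hvec R d) (m : R).
Hypothesis m_ge0 : 0 <= m.
Hypothesis xc : forall o k, qle (x o k - center o k) ep.
Hypothesis yc : forall o k, qle (y o k - center o k) ep.
Hypothesis dm : forall o k, qle (dif x y o k) m.
Variables (o p : nat) (w : 'I_d -> quat R) (us : seq (Z * Z)) (hc : quat Z).
Hypothesis os : (o < ns)%nat.
Hypothesis ps : (p < ns)%nat.
Hypothesis w1 : forall k, qabs (w k) = 1.
Let u k := nth (0, 0)%Z us k.
Hypothesis wu : forall k : 'I_d, qle (w k - uR R 20 (u k)) (101 / 100 * ep).
Let H0 := hinner (center o) (hshift w (center p)).
Hypothesis hcE : qabs (H0 - qR R 20 hc) <= 21 / 10 * ep.

Let Hr := qR R 20 hc.
Let Wr : hvec R d := fun k => qR R 20 (qmap (shr 20) (zrot (u k) (vc V p k))).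
Let Vr : hvec R d := fun k => qR R 20 (qmap (shr 20) (zrot ((u k).1, - (u k).2)%Z (vc V o k))).

Let h_shift v : hnorm (hshift w v) = hnorm v.
Proof. by rewrite /hnorm /hnorm2; congr Num.sqrt; apply: eq_bigr => k _;
  rewrite qnorm2M -(sqr_qabs (w k)) w1 expr1n mul1r. Qed.

Let pert_norm (v : nat -> hvec R d) q : (q < ns)%nat -> (forall o k, qle (v o k - center o k) ep) ->
  hnorm (v q) <= 101 / 100.
Proof.
move=> qs vc; rewrite (hnorm_ext (y := fun k => center q k + (v q k - center q k))); last first.
  by move=> k; rewrite addrC subrK.
apply: le_trans (hnorm_add (center q) (fun k => v q k - center q k)) _;
  apply: le_trans (lerD (center_hnorm qs) (hnorm_qle d6 ep_ge0 (vc q))) _.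
by move: ep ep_sm => e *; lra.
Qed.

(** The inner product is moved by each of its two arguments, about 5 ep each, and its coarse stored
    value is off by 2.1 ep. *)
Let h_err (v : nat -> hvec R d) : (forall o k, qle (v o k - center o k) ep) ->
  qabs (hinner (v o) (hshift w (v p)) - Hr) <= 123 / 10 * ep.
Proof.
move=> vc.
have E : hinner (v o) (hshift w (v p)) - Hr =
   hinner (fun k => v o k - center o k) (hshift w (v p)) +
   hinner (center o) (hshift w (fun k => v p k - center p k)) + (H0 - Hr).
  by rewrite hinnerBl {2}/hshift hinner_mulB -/(hshift w (v p)) -/(hshift w (center p)) -/H0 !addrA
    !subrK.
rewrite E; apply: le_trans (qabsD _ _) _; apply: le_trans (lerD (qabsD _ _) hcE) _.
have h1 := qabs_hinner (fun k => v o k - center o k) (hshift w (v p)).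
have h2 := qabs_hinner (center o) (hshift w (fun k => v p k - center p k)).
rewrite !h_shift in h1 h2.
have a1 := ler_pM (hnorm_ge0 _) (hnorm_ge0 _) (hnorm_qle d6 ep_ge0 (vc o)) (pert_norm ps vc).
have a2 := ler_pM (hnorm_ge0 _) (hnorm_ge0 _) (center_hnorm os) (hnorm_qle d6 ep_ge0 (vc p)).
apply: le_trans (lerD (lerD (le_trans h1 a1) (le_trans h2 a2)) (lexx _)) _.
by move: ep ep_ge0 => e *; lra.
Qed.

Let Hr_le : qabs Hr <= 101 / 100.
Proof.
have -> : Hr = H0 - (H0 - Hr) by rewrite opprB addrC subrK.
apply: le_trans (qabsB _ _) _; apply: le_trans (lerD (qabs_hinner _ _) hcE) _.
rewrite h_shift; have a := ler_pM (hnorm_ge0 _) (hnorm_ge0 _) (center_hnorm os) (center_hnorm ps).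
apply: le_trans (lerD a (lexx _)) _.
by move: ep ep_sm => e *; lra.
Qed.

(** The product has 40 fractional bits; a shift by 23 leaves 17, and reading the result with 16
    supplies the factor 2. *)
Let grad_round (A B : quat Z) (U : quat R) : qle U m ->
  `|qdot (qR R 16 (qmap (shr 23) (zqmul A B))) U - 2 * qdot (qR R 20 A * qR R 20 B) U| <= 64 * ep *
    m.
Proof.
move=> Um.
have E : qdot (qR R 16 (qmap (shr 23) (zqmul A B))) U - 2 * qdot (qR R 20 A * qR R 20 B) U =
   qdot (qR R 16 (qmap (shr 23) (zqmul A B)) - qR R (16 + 23) (zqmul A B)) U.
  rewrite qdotBl -qRM; congr (_ - _); rewrite -[2]/(2%:R) mulr_natl mulr2n -qdotDl; congr qdot.
  have e t : zr t / 2 ^+ (16 + 23) = zr t / 2 ^+ (20 + 20) + zr t / 2 ^+ (20 + 20).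
    rewrite -[(_ ^+ (16 + 23))^-1]mul1r (inv_pow R (16 + 23) 1) -[(16 + 23 + 1)%nat]/(20 + 20)%nat
      expr1 mul1r.
    by move: (2 ^+ (20 + 20))^-1 => a; ring.
  by apply: quatP; rewrite /qR [zqmul]lock /= -lock e.
rewrite E (_ : 64 * ep * m = 4 * (16 * ep) * m); last by ring.
by apply: qdot_le Um; rewrite -(inv16 R); apply: qR_shr.
Qed.

(** With h(x) the inner product, |h(x)|^2 - |h(y)|^2 = <a, b> for a = h(x) + h(y) and b = h(x) -
    h(y), where b is itself linear in the displacement. Replacing a by twice the stored value costs
    24.6 * 10.1, replacing b by its stored form costs 2.02 * 171, and rounding the gradients costs 2
    * 6 * 64: about 1362 ep m, within 2048 ep m. *)
Lemma slope_pair j :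
  `|qnorm2 (hinner (x o) (hshift w (x p))) - qnorm2 (hinner (y o) (hshift w (y p))) -
    \sum_(o' < ns) \sum_(k < d) qdot (qR R 16 (grad g V (EPair o p j) us hc o' k)) (dif x y o' k)|
  <= m * (1 / 2 ^+ 9).
Proof.
pose gv k := qmap (shr 23) (zqmul (qmap (shr 20) (zrot (u k) (vc V p k))) (zqconj hc)).
pose gw k := qmap (shr 23) (zqmul (qmap (shr 20) (zrot ((u k).1, - (u k).2)%Z (vc V o k))) hc).
rewrite [X in _ - X](_ : _ = \sum_(k < d) qdot (qR R 16 (gv k)) (dif x y o k) +
   \sum_(k < d) qdot (qR R 16 (gw k)) (dif x y p k)); last first.
  rewrite (eq_bigr (fun o' : 'I_ns =>
     (if (o' : nat) == o then \sum_(k < d) qdot (qR R 16 (gv k)) (dif x y o k) else 0) +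
     (if (o' : nat) == p then \sum_(k < d) qdot (qR R 16 (gw k)) (dif x y p k) else 0)));
       last first.
    move=> o' _; rewrite (eq_bigr (fun k : 'I_d =>
      qdot (qR R 16 (if (o' : nat) == o then gv k else zq0)) (dif x y o' k) +
      qdot (qR R 16 (if (o' : nat) == p then gw k else zq0)) (dif x y o' k))); last first.
      by move=> k _; rewrite -qdotDl -qR_add.
    rewrite big_split /=; congr (_ + _); case: eqP => [-> //|_];
      by rewrite big1 // => k _; rewrite qR_zero qdot0l.
  by rewrite big_split /= !(pick_sum (fun=> _)).
pose a := hinner (x o) (hshift w (x p)) + hinner (y o) (hshift w (y p)).
pose b := hinner (dif x y o) (hshift w (x p)) + hinner (fun k => qconj (w k) * y o k) (dif x y p).
pose b0 := hinner (dif x y o) Wr + hinner Vr (dif x y p).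
have FE : qnorm2 (hinner (x o) (hshift w (x p))) - qnorm2 (hinner (y o) (hshift w (y p))) = qdot a
  b.
  rewrite qnorm2_diff -/a; congr qdot.
  by rewrite /b -hinner_adj hinner_mulB hinnerBl addrA subrK.
have SE : `|(\sum_(k < d) qdot (qR R 16 (gv k)) (dif x y o k) +
   \sum_(k < d) qdot (qR R 16 (gw k)) (dif x y p k)) - qdot (Hr + Hr) b0| <= 768 * ep * m.
  have -> : qdot (Hr + Hr) b0 = \sum_(k < d) 2 * qdot (Wr k * qconj Hr) (dif x y o k) +
      \sum_(k < d) 2 * qdot (Vr k * Hr) (dif x y p k).
    by rewrite -!mulr_sumr -mulrDr -qdot_hinner -qdot_hinner_r -qdotDr qdotDl -/b0 mulr_natl mulr2n.
  rewrite opprD addrACA -!sumrB.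
  have h1 (k : 'I_d) : `|qdot (qR R 16 (gv k)) (dif x y o k) - 2 * qdot (Wr k * qconj Hr) (dif x y
    o k)| <= 64 * ep * m.
    by rewrite /Hr -qR_conj; apply: grad_round.
  have h2 (k : 'I_d) : `|qdot (qR R 16 (gw k)) (dif x y p k) - 2 * qdot (Vr k * Hr) (dif x y p k)|
    <= 64 * ep * m.
    exact: grad_round.
  apply: le_trans (ler_normD _ _) _; apply: le_trans (lerD (sum_le h1) (sum_le h2)) _.
  have dl : (d%:R : R) <= 6 by rewrite ler_nat.
  have em : 0 <= ep * m by rewrite mulr_ge0.
  have := ler_wpM2r em dl; rewrite -!mulrA.
  by move: (ep * m) em (d%:R : R) {dl} => t ? D ?; lra.
have qb : qabs (a - (Hr + Hr)) <= 246 / 10 * ep.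
  have -> : a - (Hr + Hr) = (hinner (x o) (hshift w (x p)) - Hr) + (hinner (y o) (hshift w (y p)) -
    Hr).
    by rewrite opprD addrACA.
  apply: le_trans (qabsD _ _) _; apply: le_trans (lerD (h_err xc) (h_err yc)) _.
  by move: ep ep_ge0 => e *; lra.
have wc1 k : qabs (qconj (w k)) = 1 by rewrite qabsC.
have dn q : hnorm (dif x y q) <= 5 * m by apply: hnorm_qle.
have cy : hnorm (fun k => qconj (w k) * y o k) <= 101 / 100.
  apply: le_trans (_ : 1 * hnorm (y o) <= _); last by rewrite mul1r; apply: pert_norm.
  by apply: hnorm_mul => // k; rewrite wc1.
have bb : qabs b <= 101 / 10 * m.
  apply: le_trans (qabsD _ _) _; apply: le_trans (lerD (qabs_hinner _ _) (qabs_hinner _ _)) _.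
  rewrite h_shift.
  have a1 := ler_pM (hnorm_ge0 _) (hnorm_ge0 _) (dn o) (pert_norm ps xc).
  have a2 := ler_pM (hnorm_ge0 _) (hnorm_ge0 _) cy (dn p).
  by apply: le_trans (lerD a1 a2) _; lra.
have bd : qabs (b - b0) <= 171 * ep * m.
  have -> : b - b0 = hinner (dif x y o) (fun k => hshift w (x p) k - Wr k) +
      hinner (fun k => qconj (w k) * y o k - Vr k) (dif x y p).
    have -> : hinner (dif x y o) (fun k => hshift w (x p) k - Wr k) =
        hinner (dif x y o) (hshift w (x p)) - hinner (dif x y o) Wr by exact: hinnerBr.
    have -> : hinner (fun k => qconj (w k) * y o k - Vr k) (dif x y p) =
        hinner (fun k => qconj (w k) * y o k) (dif x y p) - hinner Vr (dif x y p) by exact: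
          hinnerBl.
    by rewrite /b /b0 opprD addrACA.
  apply: le_trans (qabsD _ _) _; apply: le_trans (lerD (qabs_hinner _ _) (qabs_hinner _ _)) _.
  have e1 : hnorm (fun k => hshift w (x p) k - Wr k) <= 171 / 10 * ep.
    exact: rot_err.
  have e2 : hnorm (fun k => qconj (w k) * y o k - Vr k) <= 171 / 10 * ep.
    apply: (@rot_err (fun k => qconj (w k)) (fun k => ((u k).1, - (u k).2)%Z)) => // k.
    have -> : qconj (w k) - uR R 20 ((u k).1, - (u k).2)%Z = qconj (w k - uR R 20 (u k)).
      by apply: quatP; rewrite /= ?zrN; ring.
    have Hn t := wu k t.
    by apply: qleP; [exact: (Hn 0%nat)| | |]; rewrite /= normrN;
      [exact: (Hn 1%nat) | exact: (Hn 2%nat) | exact: (Hn 3%nat)].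
  have a1 := ler_pM (hnorm_ge0 _) (hnorm_ge0 _) (dn o) e1.
  have a2 := ler_pM (hnorm_ge0 _) (hnorm_ge0 _) e2 (dn p).
  by apply: le_trans (lerD a1 a2) _; move: ep ep_ge0 => e *; nra.
rewrite FE.
have -> : forall S, qdot a b - S = (qdot (a - (Hr + Hr)) b + qdot (Hr + Hr) (b - b0)) - (S - qdot
  (Hr + Hr) b0).
  by move=> S; rewrite !qdotBl !qdotBr; ring.
apply: le_trans (ler_normB _ _) _; apply: le_trans (lerD (ler_normD _ _) SE) _.
have t1 := le_trans (qdot_abs _ _) (ler_pM (qabs_ge0 _) (qabs_ge0 _) qb bb).
have HH : qabs (Hr + Hr) <= 202 / 100.
  by apply: le_trans (qabsD _ _) _; apply: le_trans (lerD Hr_le Hr_le) _; lra.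
have t2 := le_trans (qdot_abs _ _) (ler_pM (qabs_ge0 _) (qabs_ge0 _) HH bd).
apply: le_trans (lerD (lerD t1 t2) (lexx _)) _.
rewrite (inv9 R) -/ep.
have : 0 <= ep * m by rewrite mulr_ge0.
by move: ep m => e M *; nra.
Qed.

End PairSlope.

(** * Rounding errors of the computed values *)

Section Values.
Variables (R : realType) (g : config) (V : seq (seq (quat Z))).
Local Notation zr := (zr R).
Local Notation d := (cdim g).
Local Notation ns := (norb g).
Local Notation center := (center R V).
Hypothesis d6 : (1 < d <= 6)%nat.
Hypothesis N1 : (1 < npts g)%nat.
Hypothesis center_norm : forall o, (o < ns)%nat -> hnorm2 (center o : hvec R d) <= 1 + 1 / 2 ^+ 16.

Let t38 : R := 1 / 2 ^+ 38.
Let t38_gt0 : 0 < t38. Proof. by rewrite divr_gt0 // p2gt0. Qed.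
Let t38_ge0 : 0 <= t38. Proof. exact: ltW. Qed.

Let inv_split n : (2 ^+ (n + 5))^-1 = (2 ^+ n)^-1 / 32 :> R.
Proof. by rewrite exprD (invfM (2 ^+ n) (2 ^+ 5)); have -> : (2 : R) ^+ 5 = 32 by ring. Qed.

Lemma zr_div a b : (0 < b)%Z -> `|zr (a / b)%Z - zr a / zr b| <= 1.
Proof.
move=> b0; have bR : 0 < zr b.
  by have := zr_le R b 0; rewrite zr0 ltNge => ->; lia.
have [h1 h2] := Z.mod_pos_bound a b b0.
have E := Z.div_mod a b; rewrite {2}E; last by lia.
rewrite zrD zrM mulrDl mulrAC mulfV ?gt_eqF // mul1r opprD addNKr normrN.
rewrite normrM normfV (gtr0_norm bR) ler_pdivrMr // mul1r -zr_abs zr_le; lia.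
Qed.

Let scale38 (a b : R) : `|a - b| <= 1 -> `|a / 2 ^+ 38 - b / 2 ^+ 38| <= t38.
Proof.
move=> h; rewrite -mulrBl normrM [`|(2 ^+ 38)^-1|]gtr0_norm ?invr_gt0 ?p2gt0 //.
by rewrite /t38 ler_pM2r // invr_gt0 p2gt0.
Qed.

Lemma val_norm o h : `|(hnorm2 (center o : hvec R d) - 1) - zr (fval g V (ENorm o) h) / 2 ^+ 38| <=
  t38.
Proof.
set S := zsum [seq zqn2 (vq V o k) | k <- iota 0 d].
have -> : zr (fval g V (ENorm o) h) / 2 ^+ 38 = zr (shr 38 S) / 2 ^+ 38 - 1.
  have p38 : zr (2 ^ 38)%Z = 2 ^+ 38 by exact: (zr_pow R 38).
  by rewrite [fval _ _ _ _]/= -/S zrB p38 mulrBl mulfV ?p2neq0.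
have -> : hnorm2 (center o : hvec R d) = zr S / 2 ^+ (38 + 38).
  by rewrite zr_sum_iota mulr_suml /hnorm2; apply: eq_bigr => k _; rewrite /center -zr_qn2.
have -> : forall a b : R, a - 1 - (b - 1) = - (b - a) by move=> *; ring.
rewrite normrN.
exact: shr_err.
Qed.

Let zqcompM c (p q : quat Z) : zr (qcomp c (zqmul p q)) / 2 ^+ 76 = qcomp c (qR R 38 p * qR R 38 q).
Proof. by rewrite -(qRM R 38 38) qcomp_map. Qed.

Lemma val_off k l c h (kk ll : 'I_d) : kk = k :> nat -> ll = l :> nat ->
  `|qcomp c (\sum_(o < ns) (center o kk * qconj (center o ll)) *+ osz g o) / 32
   - zr (fval g V (EOff k l c) h) / 2 ^+ 38| <= t38.
Proof.
move=> kE lE; set S := zsum [seq (Z.of_nat (osz g o) * qcomp c (zqmul (vq V o k) (zqconj (vq V o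
  l))))%Z | o <- iota 0 ns].
rewrite [fval _ _ _ _]/= -/S.
have -> : qcomp c (\sum_(o < ns) (center o kk * qconj (center o ll)) *+ osz g o) / 32 = zr S / 2 ^+
  (38 + 43).
  rewrite zr_sum_iota mulr_suml.
  have qs (F : 'I_ns -> quat R) : qcomp c (\sum_o F o) = \sum_o qcomp c (F o).
    by apply: (big_morph (qcomp c)) => [a b|]; [exact: qcompD | case: (c) => [|[|[|?]]]].
  have qn (q : quat R) n : qcomp c (q *+ n) = qcomp c q *+ n.
    elim: n => [|n IH]; first by rewrite !mulr0n; case: (c) => [|[|[|?]]].
    by rewrite !mulrS qcompD IH.
  rewrite qs mulr_suml; apply: eq_bigr => o _.
  rewrite qn zrM zr_nat /center kE lE -(qR_conj R 38) -zqcompM -[_ *+ osz g o]mulr_natl.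
  rewrite (inv_split 76 : (2 ^+ (38 + 43))^-1 = _).
  by rewrite !mulrA.
rewrite -normrN opprB; exact: shr_err.
Qed.

Lemma val_tight k h (kk : 'I_d) : kk = k :> nat ->
  `|((\sum_(o < ns) qnorm2 (center o kk) *+ osz g o) / 32 - (npts g)%:R / d%:R / 32)
   - zr (fval g V (ETight k) h) / 2 ^+ 38| <= 2 * t38.
Proof.
move=> kE; set S := zsum [seq (Z.of_nat (osz g o) * zqn2 (vq V o k))%Z | o <- iota 0 ns].
rewrite [fval _ _ _ _]/= -/S.
have -> : (\sum_(o < ns) qnorm2 (center o kk) *+ osz g o) / 32 = zr S / 2 ^+ (38 + 43).
  rewrite zr_sum_iota !mulr_suml; apply: eq_bigr => o _.
  rewrite zrM zr_nat /center kE -zr_qn2 -[_ *+ osz g o]mulr_natl.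
  rewrite (inv_split 76 : (2 ^+ (38 + 43))^-1 = _).
  by rewrite !mulrA.
have e1 := shr_err R 38 43 S.
have e2 : `|zr (zN g * 2 ^ 33 / zd g)%Z / 2 ^+ 38 - (npts g)%:R / d%:R / 32| <= t38.
  have zd0 : (0 < zd g)%Z by rewrite /zd; case/andP: d6; lia.
  have p33 : zr (2 ^ 33)%Z = 2 ^+ 33 by exact: (zr_pow R 33).
  have -> : (npts g)%:R / d%:R / 32 = zr (zN g * 2 ^ 33)%Z / zr (zd g) / 2 ^+ 38.
    rewrite zrM p33 /zN /zd !zr_nat (inv_split 33 : (2 ^+ 38)^-1 = _).
    have := p2neq0 R 33; move: (2 ^+ 33) => b b0.
    by rewrite -[in RHS](mulrA _ b) [b / _]mulrC !mulrA mulfK.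
  by apply: scale38; apply: zr_div.
rewrite zrB mulrBl.
have -> : forall a b c' e' : R, a - b - (c' - e') = (e' - b) - (c' - a) by move=> *; ring.
apply: le_trans (ler_normB _ _) _; apply: le_trans (lerD e2 e1) _.
by rewrite -/t38; move: t38 => e; lra.
Qed.

Definition gam : R := ((npts g)%:R - d%:R) / (d%:R * ((npts g)%:R - 1)).

Lemma target_err : `|zr (target g) / 2 ^+ 38 - gam| <= t38.
Proof.
have p38 : zr (2 ^ 38)%Z = 2 ^+ 38 by exact: (zr_pow R 38).
have D0 : (0 < zd g * (zN g - 1))%Z.
  by case/andP: d6 => d1 _; apply: Z.mul_pos_pos; rewrite /zd /zN; lia.
have -> : gam = zr ((zN g - zd g) * 2 ^ 38)%Z / zr (zd g * (zN g - 1))%Z / 2 ^+ 38.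
  rewrite /gam [zr (_ * 2 ^ 38)]zrM p38 zrM !zrB zr1 /zN /zd !zr_nat.
  have := p2neq0 R 38; move: (2 ^+ 38) => b b0.
  by rewrite -[in RHS](mulrA _ b) [b / _]mulrC !mulrA mulfK.
by apply: scale38; apply: zr_div.
Qed.

Variables (o p : nat) (w : 'I_d -> quat R) (us : seq (Z * Z)).
Hypothesis os : (o < ns)%nat.
Hypothesis ps : (p < ns)%nat.
Hypothesis w1 : forall k, qabs (w k) = 1.
Hypothesis w_cpx : forall k, qj (w k) = 0 /\ qk (w k) = 0.
Let u k := nth (0, 0)%Z us k.
Hypothesis wu : forall k : 'I_d, `|qre (w k) - zr (u k).1 / 2 ^+ 38| <= 2 * t38 /\
  `|qi (w k) - zr (u k).2 / 2 ^+ 38| <= 2 * t38.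
Let H0 := hinner (center o) (hshift w (center p)).
Let h := hval g (nth [::] (nth [::] (abtab g V) o) p) us.

Let t_sm : t38 <= 1 / (100 * 100).
Proof.
apply: le_trans (inv38 R) _; have := ep_small R; move: (1 / 2 ^+ 20) => e; lra.
Qed.

Let abE k : (k < d)%nat -> nth (zq0, zq0) (nth [::] (nth [::] (abtab g V) o) p) k =
  (qmap (shr 38) (zqmul (zqconj (vq V o k)) (vq V p k)),
   qmap (shr 38) (zqmul (zqconj (vq V o k)) (ziq (vq V p k)))).
Proof.
move=> kd; rewrite /abtab (nth_map 0%nat) ?size_iota // nth_iota // add0n.
rewrite (nth_map 0%nat) ?size_iota // nth_iota // add0n.
by rewrite (nth_map 0%nat) ?size_iota // nth_iota.
Qed.

Let num102 : 1001 / 1000 * (1001 / 1000) <= 102 / 100 :> R.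
Proof. lra. Qed.

Let arith32 : 2 * t38 * (102 / 100) + 102 / 100 * t38 <= 32 / 10 * t38.
Proof. by move: t38 t38_ge0 => e *; lra. Qed.

(** Each coordinate contributes two products, each off by at most 3.2 units from the table error 2
    and the truncation of [abtab]; six coordinates give 38.4 units, and the final shift adds one. *)
Lemma hval_err : qle (H0 - qR R 38 h) (40 * t38).
Proof.
pose P (k : 'I_d) : quat R := qconj (center o k) * center p k.
pose Q (k : 'I_d) : quat R := qconj (center o k) * (Quat 0 1 0 0 * center p k).
pose A k := qmap (shr 38) (zqmul (zqconj (vq V o k)) (vq V p k)).
pose B k := qmap (shr 38) (zqmul (zqconj (vq V o k)) (ziq (vq V p k))).
have HE c : qcomp c H0 = \sum_k (qre (w k) * qcomp c (P k) + qi (w k) * qcomp c (Q k)).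
  rewrite /H0 hinnerE.
  have -> : forall F : 'I_d -> quat R, qcomp c (\sum_o F o) = \sum_o qcomp c (F o).
    by move=> F; apply: (big_morph (qcomp c)) => [a b|]; [exact: qcompD | case: (c) => [|[|[|?]]]].
  apply: eq_bigr => k _; have [e1 e2] := w_cpx k; rewrite /hshift /P /Q.
  by case: c => [|[|[|c]]] /=; rewrite e1 e2; ring.
pose S c := zsum [seq (let v := nth (0, 0) us k in
    let x := nth (zq0, zq0) (nth [::] (nth [::] (abtab g V) o) p) k in
    v.1 * qcomp c x.1 + v.2 * qcomp c x.2)%Z | k <- iota 0 d].
(* [qcomp] reads every index above 2 as the last component, hence the clamping. *)
have hE c : qcomp c h = shr 38 (S (if (c <= 2)%nat then c else 3%nat)).
  by case: c => [|[|[|c]]].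
have cn q (k : 'I_d) : (q < ns)%nat -> qabs (center q k) <= 1001 / 1000.
  move=> qs; apply: le_trans (center_hnorm center_norm qs).
  rewrite qabs_le ?hnorm_ge0 // sqr_hnorm /hnorm2 (bigD1 k) //= lerDl.
  by apply: sumr_ge0 => j _; apply: qnorm2_ge0.
have main c : `|qcomp c H0 - zr (S c) / 2 ^+ (38 + 38)| <= 39 * t38.
  rewrite HE /S zr_sum_iota mulr_suml -sumrB.
  have term (k : 'I_d) : `|qre (w k) * qcomp c (P k) + qi (w k) * qcomp c (Q k) -
     zr (let v := nth (0, 0) us k in
    let x := nth (zq0, zq0) (nth [::] (nth [::] (abtab g V) o) p) k in
    v.1 * qcomp c x.1 + v.2 * qcomp c x.2)%Z / 2 ^+ (38 + 38)| <= 64 / 10 * t38.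
    rewrite abE //= -/(u k) -/(A k) -/(B k) zrD !zrM exprD (invfM (2 ^+ 38) (2 ^+ 38)).
    have [wu1 wu2] := wu k.
    have one (a b : R) (z1 : Z) (X : quat R) (Y : quat Z) : `|a - zr z1 / 2 ^+ 38| <= 2 * t38 ->
      `|a| <= 1 ->
       qabs X <= 102 / 100 -> qle (X - qR R 38 Y) t38 ->
       `|a * qcomp c X - zr z1 / 2 ^+ 38 * (zr (qcomp c Y) / 2 ^+ 38)| <= 32 / 10 * t38.
      move=> h1 ha hX hY; set z' := zr z1 / 2 ^+ 38 in h1 *.
      have hy := hY c; rewrite qcompD qcompN qcomp_map in hy.
      set y' := zr (qcomp c Y) / 2 ^+ 38 in hy *.
      have -> : a * qcomp c X - z' * y' = (a - z') * qcomp c X + z' * (qcomp c X - y') by ring.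
      have hz : `|z'| <= 102 / 100.
        rewrite -[z'](subrK a) addrC; apply: le_trans (ler_normD _ _) _.
        rewrite distrC; apply: le_trans (lerD ha h1) _.
        by move: t38 t_sm => e *; lra.
      have hx := le_trans (qle_qabs X c) hX.
      apply: le_trans (ler_normD _ _) _; rewrite [`|(_ - _) * _|]normrM [`|z' * _|]normrM.
      apply: le_trans (lerD (ler_pM (normr_ge0 _) (normr_ge0 _) h1 hx) (ler_pM (normr_ge0 _)
        (normr_ge0 _) hz hy)) _.
      exact: arith32.
    have [wr wi _ _] := qcomp_le (w k); rewrite w1 in wr wi.
    have PA : qle (P k - qR R 38 (A k)) t38.
      rewrite /P /center -(qR_conj R 38) -(qRM R 38 38) -opprB; apply: qleN;
        exact: (qR_shr R 38 38).
    have QB : qle (Q k - qR R 38 (B k)) t38.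
      have -> : Q k = qR R (38 + 38) (zqmul (zqconj (vq V o k)) (ziq (vq V p k))).
        rewrite qRM qR_conj /Q; congr (_ * _).
        by apply: quatP; rewrite /= ?zrN ?mulNr; ring.
      by rewrite -opprB; apply: qleN; exact: (qR_shr R 38 38).
    have cc : qabs (center o k) * qabs (center p k) <= 102 / 100.
      apply: le_trans (ler_pM (qabs_ge0 _) (qabs_ge0 _) (cn o k os) (cn p k ps)) _.
      exact: num102.
    have Pn : qabs (P k) <= 102 / 100 by rewrite /P qabsM qabsC; exact: cc.
    have Qn : qabs (Q k) <= 102 / 100.
      have i1 : qabs (Quat 0 1 0 0 : quat R) = 1.
        by rewrite /qabs /qnorm2 /= !expr0n expr1n add0r !addr0 sqrtr1.
      by rewrite /Q qabsM qabsM qabsC i1 mul1r; exact: cc.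
    have t1 := one _ 0 _ _ _ wu1 wr Pn PA.
    have t2 := one _ 0 _ _ _ wu2 wi Qn QB.
    set b := (2 ^+ 38)^-1 in t1 t2 *.
    have -> : forall a1 a2 z1 z2 x1 x2 : R, a1 + a2 - (z1 * x1 + z2 * x2) * (b * b) =
       (a1 - z1 * b * (x1 * b)) + (a2 - z2 * b * (x2 * b)) by move=> *; ring.
    apply: le_trans (ler_normD _ _) _; apply: le_trans (lerD t1 t2) _.
    by move: t38 => e; lra.
  apply: le_trans (sum_le term) _.
  have dl : (d%:R : R) <= 6 by rewrite ler_nat; case/andP: d6.
  have := ler_wpM2r t38_ge0 dl; move: (d%:R : R) {dl} => D; move: t38 t38_ge0 => e *; lra.
move=> c; rewrite qcompD qcompN qcomp_map hE.
have e1 := main (if (c <= 2)%nat then c else 3%nat).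
have -> : qcomp c H0 = qcomp (if (c <= 2)%nat then c else 3%nat) H0 by case: c {e1} => [|[|[|c]]].
have e2 := shr_err R 38 38 (S (if (c <= 2)%nat then c else 3%nat)).
set s := zr (S _) / _ in e1 e2; set a := qcomp _ _ in e1 *; set b := zr _ / _ in e2 *.
have -> : a - b = (a - s) - (b - s) by ring.
apply: le_trans (ler_normB _ _) _; apply: le_trans (lerD e1 e2) _.
by rewrite -/t38; move: t38 => e; lra.
Qed.

Let H0_le : qabs H0 <= 102 / 100.
Proof.
apply: le_trans (qabs_hinner _ _) _.
have -> : hnorm (hshift w (center p)) = hnorm (center p : hvec R d).
  by rewrite /hnorm /hnorm2; congr Num.sqrt; apply: eq_bigr => k _;
    rewrite qnorm2M -(sqr_qabs (w k)) w1 expr1n mul1r.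
apply: le_trans (ler_pM (hnorm_ge0 _) (hnorm_ge0 _) (center_hnorm center_norm os) (center_hnorm
  center_norm ps)) _; lra.
Qed.

Lemma hc_err : qabs (H0 - qR R 20 (qmap (shr 18) h)) <= 21 / 10 * (1 / 2 ^+ 20).
Proof.
have e1 := qabs_qle hval_err.
have e2 := qabs_qle (qR_shr R 20 18 h).
have -> : H0 - qR R 20 (qmap (shr 18) h) = (H0 - qR R 38 h) - (qR R 20 (qmap (shr 18) h) - qR R (20
  + 18) h).
  by rewrite opprB addrA subrK.
apply: le_trans (qabsB _ _) _; apply: le_trans (lerD e1 e2) _.
have := inv38 R; have : (0 : R) <= 1 / 2 ^+ 20 by rewrite divr_ge0 // ltW // p2gt0.
by rewrite -/t38; move: (1 / 2 ^+ 20) t38 => e f; lra.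
Qed.

(** The error 80 of the inner product in absolute value is multiplied by at most 2.06, the size of
    the sum of exact and computed values; squaring and [target] add one unit each. *)
Lemma val_pair j : `|(qnorm2 H0 - gam) - zr (fval g V (EPair o p j) h) / 2 ^+ 38| <= 512 * t38.
Proof.
have e0 := qabs_qle hval_err.
have e1 := shr_err R 38 38 (zqn2 h).
have e2 := target_err.
rewrite [fval _ _ _ _]/= zrB mulrBl.
have E : zr (zqn2 h) / 2 ^+ (38 + 38) = qnorm2 (qR R 38 h) by rewrite -zr_qn2.
rewrite E in e1.
have hn : qabs (qR R 38 h) <= 104 / 100.
  rewrite -[qR R 38 h](subrK H0) addrC; apply: le_trans (qabsD _ _) _.
  rewrite -opprB qabsN; apply: le_trans (lerD H0_le e0) _.
  by move: t38 t_sm => e *; lra.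
have e3 : `|qnorm2 H0 - qnorm2 (qR R 38 h)| <= 206 / 100 * (2 * (40 * t38)).
  rewrite qnorm2_diff; apply: le_trans (qdot_abs _ _) _.
  apply: ler_pM (qabs_ge0 _) (qabs_ge0 _) _ e0.
  by apply: le_trans (qabsD _ _) _; apply: le_trans (lerD H0_le hn) _; lra.
move: (qnorm2 H0) (qnorm2 (qR R 38 h)) (zr (shr 38 _) / _) (zr (target g) / _) gam e1 e2 e3 => a b
  s t ga e1 e2 e3.
have -> : a - ga - (s - t) = (a - b) - (s - b) + (t - ga) by ring.
apply: le_trans (ler_normD _ _) _.
apply: le_trans (lerD (ler_normB _ _) e2) _.
apply: le_trans (lerD (lerD e3 e1) (lexx _)) _.
by rewrite -/t38; move: t38 t38_ge0 => e *; lra.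
Qed.

End Values.

(** * Zeros of the system *)

(** Gives equations a decidable equality, so that membership in [eqs] makes sense. *)
Definition equation_code (e : equation) : nat * nat * nat * nat :=
  match e with
  | ENorm o => (0, o, 0, 0) | ETight k => (1, k, 0, 0)
  | EOff k l c => (2, k, l, c) | EPair o p m => (3, o, p, m)
  end%nat.
Definition equation_decode (x : nat * nat * nat * nat) : equation :=
  match x with
  | (0, o, _, _) => ENorm o | (1, k, _, _) => ETight k
  | (2, k, l, c) => EOff k l c | (_, o, p, m) => EPair o p m
  end%nat.
Fact equation_codeK : cancel equation_code equation_decode. Proof. by case. Qed.
HB.instance Definition _ := Equality.copy equation (can_type equation_codeK).

Lemma pivposE (g : config) (o k c i : nat) (d := cdim g) : (k < d)%nat -> (c < 4)%nat ->
  (i == 4 * (d * o + k) + c)%nat =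
  [&& o == (pivpos g i).1.1, k == (pivpos g i).1.2 & c == (pivpos g i).2].
Proof.
rewrite /pivpos -/d; move: d => d kd c4.
have d0 : (0 < 4 * d)%nat by rewrite muln_gt0; lia.
have kc : (4 * k + c < 4 * d)%nat by lia.
apply/eqP/and3P => [->|[/eqP oE /eqP kE /eqP cE]].
  have -> : (4 * (d * o + k) + c = o * (4 * d) + (4 * k + c))%nat by lia.
  rewrite divnMDl // modnMDl (divn_small kc) (modn_small kc) addn0 eqxx.
  rewrite [(4 * k)%nat]mulnC divnMDl // (divn_small c4) addn0 eqxx.
  have -> : (o * (4 * d) + (k * 4 + c) = (o * d + k) * 4 + c)%nat by lia.
  by rewrite modnMDl (modn_small c4) eqxx.
have h1 := divn_eq i (4 * d); have h2 := divn_eq (i %% (4 * d)) 4.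
have h3 : ((i %% (4 * d)) %% 4 = i %% 4)%nat by rewrite modn_dvdm // dvdn_mulr.
rewrite /= in oE kE cE; move: h1 h2; rewrite h3 -oE -kE -cE.
by move: (i %% (4 * d))%nat => r -> ->; lia.
Qed.

Lemma dotp_sum (R : realType) n (a b : seq Z) : size a = n -> size b = n ->
  zr R (dotp a b) = \sum_(k < n) zr R (nth 0%Z a k) * zr R (nth 0%Z b k).
Proof.
elim: a b n => [|x a IH] [|y b] n <- //=; first by rewrite big_ord0 zr0.
by case=> ab; rewrite zrD zrM big_ord_recl /= (IH b (size a)).
Qed.

Lemma zsum_abs (R : realType) (a : seq Z) :
  zr R (zsum [seq Z.abs x | x <- a]) = \sum_(k < size a) `|zr R (nth 0%Z a k)|.
Proof.
elim: a => [|x a IH]; first by rewrite big_ord0 -zr0.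
by rewrite big_ord_recl /= zrD zr_abs IH.
Qed.

Lemma contractsP (R : realType) n (F : seq Z) (J A : seq (seq Z)) :
  size J = n -> size F = n -> contracts n F J A -> forall i, (i < n)%nat ->
  let a j := zr R (nth 0%Z (nth [::] A i) j) in
  \sum_(j < n) `|(if i == j :> nat then 2 ^+ 26 else 0)
      - \sum_(k < n) a k * zr R (nth 0%Z (nth [::] J k) j)| + 2 ^+ 7 * \sum_(j < n) `|a j| <= 2 ^+
        25
  /\ `|\sum_(k < n) a k * zr R (nth 0%Z F k)| + 2 ^+ 9 * \sum_(j < n) `|a j| <= 2 ^+ 27.
Proof.
move=> sJ sF /allP H i lt_in a; have i_in : i \in iota 0 n by rewrite mem_iota.
case/and3P: (H i i_in) => {H} /eqP sa; rewrite -!(zr_le R).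
have p2 k : zr R (2 ^ Z.of_nat k)%Z = 2 ^+ k by exact: zr_pow.
rewrite !zrD ![zr R (_ * zsum _)]zrM !zr_abs zsum_abs zr_sum_iota sa.
rewrite (p2 25%nat) (p2 27%nat) (p2 7%nat) (p2 9%nat) (dotp_sum R sa sF) => h1 h2.
split; last exact: h2.
move: h1; congr (_ + _ <= _); apply: eq_bigr => j _.
rewrite zr_abs zrB (nth_map 0%nat) ?size_iota // nth_iota // add0n.
rewrite (dotp_sum R sa) ?size_map //; congr (`|_ - _|).
  by case: eqP => _; [exact: (p2 26%nat) | exact: zr0].
by apply: eq_bigr => k _; rewrite (nth_map [::]) ?sJ.
Qed.

Section Solve.
Variables (R : realType) (g : config) (V : seq (seq (quat Z))) (tab : seq (Z * Z)).
Variable u : nat -> quat R.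
Local Notation zr := (zr R).
Local Notation d := (cdim g).
Local Notation ns := (norb g).
Local Notation ep := (1 / 2 ^+ 20 : R).
Local Notation t38 := (1 / 2 ^+ 38 : R).
Hypothesis d6 : (1 < d <= 6)%nat.
Hypothesis ns4 : (ns <= 4)%nat.
Hypothesis N64 : (1 < npts g <= 64)%nat.
Hypothesis center_norm : forall o, (o < ns)%nat -> hnorm2 (center R V o : hvec R d) <= 1 + 1 / 2 ^+
  16.
Hypothesis u_cpx : forall n, qj (u n) = 0 /\ qk (u n) = 0.
Hypothesis u_unit : forall n, qnorm2 (u n) = 1.
Hypothesis u_tab : forall b m (t := nth (0, 0)%Z tab (uidx g b m)),
  `|qre (u (b * m)%nat) - zr t.1 / 2 ^+ 38| <= 2 * t38 /\
  `|qi (u (b * m)%nat) - zr t.2 / 2 ^+ 38| <= 2 * t38.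

Let ep_gt0 : 0 < ep. Proof. by rewrite divr_gt0 // p2gt0. Qed.

Implicit Types X Y : nat -> nat -> quat R.
Definition hv X o : hvec R d := fun k => X o k.
Definition turn m (k : 'I_d) : quat R := u (chr g k * m)%nat.

(** The real functions whose rounded values and gradients are [fval] and [grad]; the scaling by 1/32
    of the frame equations is kept so that both agree. *)
Definition residual X (e : equation) : R :=
  match e with
  | ENorm o => hnorm2 (hv X o) - 1
  | ETight k => (\sum_(o < ns) qnorm2 (X o k) *+ osz g o) / 32 - (npts g)%:R / d%:R / 32
  | EOff k l c => qcomp c (\sum_(o < ns) (X o k * qconj (X o l)) *+ osz g o) / 32
  | EPair o p m => qnorm2 (hinner (hv X o) (hshift (turn m) (hv X p))) - gam R g
  end.

Definition wf (e : equation) : bool :=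
  match e with
  | ENorm o => (o < ns)%nat
  | ETight k => (k < d)%nat
  | EOff k l _ => (k < d)%nat && (l < d)%nat
  | EPair o p _ => (o < ns)%nat && (p < ns)%nat
  end.

Let X0 o k := qR R 38 (vq V o k).

Let dat e := eqdata g tab (abtab g V) e.

Let turn1 m k : qabs (turn m k) = 1.
Proof. by rewrite /qabs u_unit sqrtr1. Qed.

Let turn_cpx m k : qj (turn m k) = 0 /\ qk (turn m k) = 0.
Proof. exact: u_cpx. Qed.

Let turn_tab m (k : 'I_d) (t := nth (0, 0)%Z (trig g tab m) k) :
  `|qre (turn m k) - zr t.1 / 2 ^+ 38| <= 2 * t38 /\
  `|qi (turn m k) - zr t.2 / 2 ^+ 38| <= 2 * t38.
Proof.
rewrite /t /trig (nth_map 0%nat) ?size_iota // nth_iota // add0n; exact: u_tab.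
Qed.

(** The worst case is an overlap; 512 units of 2^-38 are the 2^-29 allowed for in [contracts]. *)
Lemma residual_center e : wf e ->
  `|residual X0 e - zr (fval g V e (dat e).1) / 2 ^+ 38| <= 512 * t38.
Proof.
have t0 : 0 <= t38 by rewrite divr_ge0 // ltW // p2gt0.
have N1 : (1 < npts g)%nat by case/andP: N64.
have grow (a : R) k : k <= 512 -> a <= k * t38 -> a <= 512 * t38.
  by move=> k5 /le_trans; apply; rewrite ler_wpM2r.
case: e => [o|k|k l c|o p m].
- move=> os; have h := @val_norm R g V o (dat (ENorm o)).1.
  by apply: (grow _ 1); [rewrite ler1n | rewrite mul1r; exact: h].
- move=> kd; have h := @val_tight R g V d6 N1 k (dat (ETight k)).1 (Ordinal kd) erefl.
  by apply: (grow _ 2); [rewrite ler_nat | exact: h].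
- case/andP=> kd ld.
  have h := @val_off R g V k l c (dat (EOff k l c)).1 (Ordinal kd) (Ordinal ld) erefl erefl.
  by apply: (grow _ 1); [rewrite ler1n | rewrite mul1r; exact: h].
- case/andP=> os ps.
  exact: (val_pair d6 N1 center_norm os ps (turn1 m) (turn_cpx m) (turn_tab m) m).
Qed.

Let coarse_tab m (k : 'I_d) :
  qle (turn m k - uR R 20 (nth (0, 0)%Z [seq (shr 18 t.1, shr 18 t.2) | t <- trig g tab m] k))
    (101 / 100 * ep).
Proof.
have [h1 h2] := turn_tab m k; have [c1 c2] := turn_cpx m k.
rewrite (nth_map (0, 0)%Z) ?size_map ?size_iota //.
set t := nth _ _ _ in h1 h2 *.
have tri (a b c : R) : `|a - b| <= 2 * t38 -> `|c - b| <= ep -> `|a - c| <= 101 / 100 * ep.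
  move=> ab cb; have -> : a - c = (a - b) - (c - b) by ring.
  apply: le_trans (ler_normB _ _) _; apply: le_trans (lerD ab cb) _.
  by have := inv38 R; have := ep_gt0; move: ep t38 => e f; lra.
have e0 : 0 <= 101 / 100 * ep by move: ep ep_gt0 => e; lra.
apply: qleP => /=.
- by apply: tri h1 _; exact: (shr_err R 20 18).
- by apply: tri h2 _; exact: (shr_err R 20 18).
- by rewrite c1 subrr normr0.
- by rewrite c2 subrr normr0.
Qed.

Let us e := [seq (shr 18 t.1, shr 18 t.2) | t <- (dat e).2].
Let hc e := qmap (shr 18) (dat e).1.

Lemma residual_slope X Y m e : wf e -> 0 <= m ->
  (forall o k, qle (X o k - X0 o k) ep) -> (forall o k, qle (Y o k - X0 o k) ep) ->
  (forall o k, qle (X o k - Y o k) m) ->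
  `|residual X e - residual Y e - \sum_(o < ns) \sum_(k < d)
      qdot (qR R 16 (grad g V e (us e) (hc e) o k)) (X o k - Y o k)| <= m * (1 / 2 ^+ 9).
Proof.
move=> we m0 xc yc dm.
have d6' : (d <= 6)%nat by case/andP: d6.
have N64' : (npts g <= 64)%nat by case/andP: N64.
have N1 : (1 < npts g)%nat by case/andP: N64.
have xc' o (k : 'I_d) : qle (hv X o k - center R V o k) ep by exact: xc.
have yc' o (k : 'I_d) : qle (hv Y o k - center R V o k) ep by exact: yc.
have dm' o (k : 'I_d) : qle (dif (hv X) (hv Y) o k) m by exact: dm.
have shift (a b c : R) : a - c - (b - c) = a - b by ring.
case: e we => [o|k|k l c|o p j]; rewrite /residual.
- by move=> os; rewrite shift; exact: (slope_norm d6' xc' yc' dm' m0 _ _ os).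
- move=> kd; rewrite shift.
  exact: (@slope_tight R g V ns4 N64' (hv X) (hv Y) m xc' yc' dm' m0 k (us (ETight k)) (hc (ETight
    k)) kd (Ordinal kd) erefl).
- case/andP=> kd ld.
  exact: (@slope_off R g V ns4 N64' (hv X) (hv Y) m xc' yc' dm' m0 (Ordinal kd) (Ordinal ld) c (us
    (EOff k l c)) (hc (EOff k l c))).
- case/andP=> os ps; rewrite shift.
  have hE := hc_err d6 center_norm os ps (turn1 j) (turn_cpx j) (turn_tab j).
  exact: (slope_pair d6' center_norm m0 xc' yc' dm' os ps (turn1 j) (coarse_tab j) hE j).
Qed.

Let P := [seq iv.1 | iv <- cpiv g].
Let pos j := pivpos g (nth 0%nat P j).
Let S := system g tab V.
Let n := size (eqs g).
Hypothesis P_uniq : uniq P.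
Hypothesis P_lt : all (fun i => (i < 4 * d * ns)%nat) P.
Hypothesis P_size : size P = n.
Hypothesis eqs_wf : all wf (eqs g).

Let delta (w : 'cV[R]_n) i := \sum_(j < n) (if nth 0%nat P j == i then w j 0 else 0).
(** The unknowns are displacements of the coordinates listed in [P]; all the others keep their
    frozen values. *)
Definition perturbed (w : 'cV[R]_n) o k : quat R :=
  let w' c := delta w (4 * (d * o + k) + c)%nat in
  X0 o k + Quat (w' 0%nat) (w' 1%nat) (w' 2%nat) (w' 3%nat).

Let delta_at (w : 'cV[R]_n) (j : 'I_n) : delta w (nth 0%nat P j) = w j 0.
Proof.
rewrite /delta (bigD1 j) //= eqxx big1 ?addr0 // => i ij.
rewrite (nth_uniq 0%nat _ _ P_uniq) ?P_size //; case: eqP => // E.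
by move: ij; rewrite (ord_inj E) eqxx.
Qed.

Let delta_notin (w : 'cV[R]_n) i : i \notin P -> delta w i = 0.
Proof.
move=> iP; rewrite /delta big1 // => j _; case: eqP => // jE.
by rewrite -jE mem_nth ?P_size in iP.
Qed.

Let delta_le (w : 'cV[R]_n) m i : 0 <= m -> in_box w m -> `|delta w i| <= m.
Proof.
move=> m0 wm; case: (boolP (i \in P)) => [/(nthP 0%nat) [j]|/delta_notin ->];
  last by rewrite normr0.
by rewrite P_size => jn <-; rewrite (delta_at w (Ordinal jn)).
Qed.

Let deltaB (w v : 'cV[R]_n) i : delta (w - v) i = delta w i - delta v i.
Proof.
rewrite /delta -sumrB; apply: eq_bigr => j _.
by rewrite !mxE; case: ifP => _; rewrite ?subrr.
Qed.

Let perturbed_comp w o k c : qcomp c (perturbed w o k - X0 o k) = delta w (4 * (d * o + k) + minn c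
  3)%nat.
Proof. by rewrite /perturbed addrAC subrr add0r; case: c => [|[|[|c]]]. Qed.

Let perturbedB w v o k c :
  qcomp c (perturbed w o k - perturbed v o k) = delta (w - v) (4 * (d * o + k) + minn c 3)%nat.
Proof.
rewrite deltaB -!perturbed_comp -qcompN -qcompD; congr qcomp.
by rewrite opprB addrA subrK.
Qed.

(** Newton's method cannot create a component forbidden by the stabiliser, so the orbits keep their
    sizes at the exact solution. *)
Lemma perturbed_inactive w o k c : (c < 4)%nat -> ~~ active g V o k c -> qcomp c (perturbed w o k)
  = 0.
Proof.
move=> c4; rewrite /active negb_or negbK => /andP [/Z.eqb_spec v0 iP].
rewrite -[perturbed w o k](subrK (X0 o k)) qcompD perturbed_comp.
have -> : minn c 3 = c by lia.
by rewrite delta_notin // add0r qcomp_map v0 mul0r.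
Qed.

(** The gradient paired with a displacement involves only the chosen coordinates. Reindexing the sum
    over orbits, coordinates and components by the distinct positions in [P] yields a row of the
    Jacobian. *)
Lemma jacobian_sum (G : nat -> nat -> quat Z) (w v : 'cV[R]_n) :
  \sum_(o < ns) \sum_(k < d) qdot (qR R 16 (G o k)) (perturbed w o k - perturbed v o k) =
  \sum_(j < n) zr (qcomp (pos j).2 (G (pos j).1.1 (pos j).1.2)) / 2 ^+ 16 * (w - v) j 0.
Proof.
set e := w - v.
pose a (j : 'I_n) (o k c : nat) : R := if [&& o == (pos j).1.1, k == (pos j).1.2 & c == (pos j).2]
  then zr (qcomp c (G o k)) / 2 ^+ 16 * e j 0 else 0.
have term o (k : 'I_d) :
  qdot (qR R 16 (G o k)) (perturbed w o k - perturbed v o k) = \sum_(j < n) \sum_(c < 4) a j o k c.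
  have cE c : (c < 4)%nat -> qcomp c (qR R 16 (G o k)) * qcomp c (perturbed w o k - perturbed v o k)
      = \sum_(j < n) a j o k c.
    move=> c4; rewrite perturbedB -/e qcomp_map /delta mulr_sumr.
    have -> : minn c 3 = c by lia.
    apply: eq_bigr => j _; rewrite pivposE // /a -/(pos j).
    by case: ifP => _; rewrite ?mulr0.
  rewrite exchange_big /= !big_ord_recr big_ord0 /= add0r -!cE //.
  exact: qdotE.
under eq_bigr => o _ do under eq_bigr => k _ do rewrite term.
under eq_bigr => o _ do rewrite exchange_big /=.
rewrite exchange_big /=; apply: eq_bigr => j _.
have Pj : (nth 0%nat P j < 4 * d * ns)%nat by apply: (allP P_lt); rewrite mem_nth ?P_size.
have d0 : (0 < 4 * d)%nat by case/andP: d6; lia.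
have po : ((pos j).1.1 < ns)%nat by rewrite /pos /= ltn_divLR //; move: Pj; rewrite mulnC.
have pk : ((pos j).1.2 < d)%nat by rewrite /pos /= ltn_divLR // [(d * 4)%nat]mulnC ltn_pmod.
have pc : ((pos j).2 < 4)%nat by rewrite /pos /= ltn_pmod.
set b := (X in _ = X); rewrite -[RHS](pick_sum (fun=> b) po).
apply: eq_bigr => o _; case: eqP => [oE|oN]; last first.
  by rewrite big1 // => k _; rewrite big1 // => c _; rewrite /a; case: eqP oN.
rewrite -[RHS](pick_sum (fun=> b) pk).
apply: eq_bigr => k _; case: eqP => [kE|kN]; last first.
  by rewrite big1 // => c _; rewrite /a oE eqxx; case: eqP kN.
rewrite -[RHS](pick_sum (fun=> b) pc); apply: eq_bigr => c _.
by rewrite /a oE kE !eqxx /=; case: eqP => // ->.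
Qed.

Let eqn_at i := nth (ENorm 0) (eqs g) i.
Let entry (i j : nat) := nth 0%Z (nth [::] (map snd S) i) j.
Let size_S : size S = n. Proof. by rewrite /S /system size_map. Qed.

Let entryE i j : (i < n)%nat -> (j < n)%nat -> entry i j =
  qcomp (pos j).2 (grad g V (eqn_at i) (us (eqn_at i)) (hc (eqn_at i)) (pos j).1.1 (pos j).1.2).
Proof.
move=> lt_in lt_jn; rewrite /entry (nth_map (0%Z, [::])) ?size_S //.
rewrite /S /system (nth_map (ENorm 0)) // -/(eqn_at i) [snd _]/=.
by rewrite -P_size size_map in lt_jn;
  rewrite (nth_map (0, 0, 0)%nat) ?size_map // (nth_map (0%nat, 0%Z)) // /pos /P (nth_map (0%nat,
    0%Z)).
Qed.

Let value_at i : (i < n)%nat -> nth 0%Z (map fst S) i = fval g V (eqn_at i) (dat (eqn_at i)).1.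
Proof.
move=> lt_in; rewrite (nth_map (0%Z, [::])) ?size_S //.
by rewrite /S /system (nth_map (ENorm 0)) // -/(eqn_at i).
Qed.

Let wf_at i : (i < n)%nat -> wf (eqn_at i).
Proof. by move=> lt_in; apply: (allP eqs_wf); rewrite mem_nth. Qed.

(** Krawczyk with radius 2^-20, variation 2^-9 and residual error 2^-29. The inverse has 10
    fractional bits, the Jacobian 16 and the values 38, so the integer tests carry 26 and 48
    bits. *)
Lemma residual_root (B : seq (seq Z)) : contracts n (map fst S) (map snd S) B ->
  exists2 w : 'cV[R]_n, in_box w ep & forall e, e \in eqs g -> residual (perturbed w) e = 0.
Proof.
move=> Hc; have sJ : size (map snd S) = n by rewrite size_map.
have sF : size (map fst S) = n by rewrite size_map.
have H i lt_in := @contractsP R n (map fst S) (map snd S) B sJ sF Hc i lt_in.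
clear Hc.
pose A : 'M[R]_n := \matrix_(i, j) (zr (nth 0%Z (nth [::] B i) j) / 2 ^+ 10).
pose J : 'M[R]_n := \matrix_(i, j) (zr (entry i j) / 2 ^+ 16).
pose F (w : 'cV[R]_n) : 'cV[R]_n := \col_i residual (perturbed w) (eqn_at i).
pose f0 : 'cV[R]_n := \col_i (zr (nth 0%Z (map fst S) i) / 2 ^+ 38).
have sumA (i : 'I_n) : \sum_j `|A i j| = (\sum_(j < n) `|zr (nth 0%Z (nth [::] B i) j)|) / 2 ^+ 10.
  rewrite mulr_suml; apply: eq_bigr => j _; rewrite mxE normrM normfV.
  by rewrite [`|2 ^+ 10|]gtr0_norm // p2gt0.
have pw a b : (2 : R) ^+ (a + b) = 2 ^+ a * 2 ^+ b by rewrite exprD.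
have mix (a b c s t : R) : a != 0 -> b != 0 -> c != 0 ->
    s / (a * b * c) + 1 / a * (t / b) = (s + c * t) / (a * b * c).
  by move=> a0 b0 c0; field; rewrite a0 b0 c0.
have fin1 (s t : R) : s + 2 ^+ 7 * t <= 2 ^+ 25 -> s / 2 ^+ 26 + 1 / 2 ^+ 9 * (t / 2 ^+ 10) <= 1 /
  2.
  have -> : (2 : R) ^+ 26 = 2 ^+ 9 * 2 ^+ 10 * 2 ^+ 7 by rewrite -!exprD.
  rewrite mix ?p2neq0 // -!exprD => h; rewrite ler_pdivrMr ?p2gt0 //; apply: le_trans h _.
  by rewrite (pw 25%nat 1%nat) expr1 mulrCA mul1r mulVf ?mulr1 ?pnatr_eq0.
have fin2 (s t : R) : s + 2 ^+ 9 * t <= 2 ^+ 27 -> s / 2 ^+ 48 + 1 / 2 ^+ 29 * (t / 2 ^+ 10) <= ep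
  / 2.
  have -> : (2 : R) ^+ 48 = 2 ^+ 29 * 2 ^+ 10 * 2 ^+ 9 by rewrite -!exprD.
  rewrite mix ?p2neq0 // -!exprD => h; rewrite ler_pdivrMr ?p2gt0 //; apply: le_trans h _.
  rewrite (pw 27%nat 21%nat) (pw 20%nat 1%nat) expr1.
  have key (x y : R) : x != 0 -> 1 / x / 2 * (y * (x * 2)) = y by move=> x0; field.
  by rewrite key // p2neq0.
have contr (i : 'I_n) : \sum_j `|(1%:M - A *m J) i j| + 1 / 2 ^+ 9 * \sum_j `|A i j| <= 1 / 2.
  have [h _] := H i (ltn_ord i).
  have -> : \sum_j `|(1%:M - A *m J) i j| = (\sum_(j < n) `|(if i == j :> nat then 2 ^+ 26 else 0)
      - \sum_(k < n) zr (nth 0%Z (nth [::] B i) k) * zr (entry k j)|) / 2 ^+ 26.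
    rewrite mulr_suml; apply: eq_bigr => j _.
    rewrite -[(2 ^+ 26)^-1]gtr0_norm ?invr_gt0 ?p2gt0 // -normrM; congr `|_|.
    rewrite !mxE mulrBl; congr (_ - _).
      by rewrite val_eqE; case: eqP => _; rewrite ?mul0r // mulfV // p2neq0.
    rewrite mulr_suml; apply: eq_bigr => k _;
      by rewrite !mxE (pw 10%nat 16%nat) (invfM (2 ^+ 10) (2 ^+ 16)) mulrACA.
  by rewrite sumA; exact: fin1 h.
have resid (i : 'I_n) : `|(A *m f0) i 0| + 1 / 2 ^+ 29 * \sum_j `|A i j| <= ep / 2.
  have [_ h] := H i (ltn_ord i).
  have -> : (A *m f0) i 0 = (\sum_(k < n) zr (nth 0%Z (nth [::] B i) k) * zr (nth 0%Z (map fst S)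
    k)) / 2 ^+ 48.
    rewrite mxE mulr_suml; apply: eq_bigr => k _;
      by rewrite !mxE (pw 10%nat 38%nat) (invfM (2 ^+ 10) (2 ^+ 38)) mulrACA.
  rewrite normrM [`|_^-1|]gtr0_norm ?invr_gt0 ?p2gt0 // sumA; exact: fin2 h.
have pert0 o k : perturbed 0 o k = X0 o k.
  have z i : delta 0 i = 0 by rewrite /delta big1 // => j _; rewrite mxE; case: ifP.
  by rewrite /perturbed !z; exact: addr0.
have approx : in_box (F 0 - f0) (1 / 2 ^+ 29).
  move=> i; rewrite !mxE value_at //.
  rewrite (_ : perturbed 0 = X0); last by do 2 apply: boolp.funext => ?; exact: pert0.
  apply: le_trans (residual_center (wf_at (ltn_ord i))) _.
  rewrite (pw 29%nat 9%nat).
  suff -> : 512 * (1 / (2 ^+ 29 * 2 ^+ 9)) = 1 / 2 ^+ 29 :> R by [].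
  have -> : (512 : R) = 2 ^+ 9 by ring.
  have key (x y : R) : x != 0 -> y != 0 -> y * (1 / (x * y)) = 1 / x by move=> x0 y0; field;
    rewrite x0 y0.
  by rewrite key // p2neq0.
have box w m o k : 0 <= m -> in_box w m -> qle (perturbed w o k - X0 o k) m.
  by move=> m0 wm c; rewrite perturbed_comp; apply: delta_le.
have slope x y m : in_box x ep -> in_box y ep -> in_box (x - y) m ->
  in_box (F x - F y - J *m (x - y)) (1 / 2 ^+ 9 * m).
  move=> xe ye xym i; rewrite !mxE [leRHS]mulrC.
  have m0 : 0 <= m by apply: le_trans (xym i).
  have h := @residual_slope (perturbed x) (perturbed y) m _ (wf_at (ltn_ord i)) m0
     (fun o k => box _ _ o k (ltW ep_gt0) xe) (fun o k => box _ _ o k (ltW ep_gt0) ye).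
  rewrite jacobian_sum in h.
  have e1 : \sum_j J i j * (x - y) j 0 = \sum_(j < n) zr
            (qcomp (pos j).2
               (grad g V (eqn_at i) (us (eqn_at i)) (hc (eqn_at i)) (pos j).1.1 (pos j).1.2)) / 2
                 ^+ 16 *
          (x - y) j 0.
    by apply: eq_bigr => j _; rewrite mxE entryE.
  rewrite e1; apply: h => o k c; rewrite perturbedB; exact: delta_le.
have [w we Fw] := krawczyk contr resid approx slope (ltW ep_gt0) (ltW (divr_gt0 ltr01 (p2gt0 _ 9))).
exists w => // e /(nthP (ENorm 0)) [i lt_in <-].
by have := congr1 (fun M : 'cV[R]_n => M (Ordinal lt_in) 0) Fw; rewrite !mxE.
Qed.

End Solve.

(** * Membership in the list of equations and consequences of the tests *)

Section Equations.
Variable g : config.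
Local Notation d := (cdim g).
Local Notation ns := (norb g).

Lemma eqs_wf : all (wf g) (eqs g).
Proof.
apply/allP => e; rewrite /eqs !mem_cat => /orP [|/orP [|/orP []]].
- by case/mapP => o; rewrite mem_iota => /andP [_ lt] ->.
- by case/mapP => k; rewrite mem_iota => /andP [_ lt] ->; rewrite /wf; lia.
- case/flatten_mapP => k; rewrite mem_iota => kd /flatten_mapP [l]; rewrite mem_iota => ld.
  by case: ifP => // _ /mapP [c _ ->]; rewrite /wf; lia.
- case/flatten_mapP => o; rewrite mem_iota => od; rewrite mem_cat => /orP [/mapP [m _ ->]|].
    by rewrite /wf; lia.
  case/flatten_mapP => p; rewrite mem_iota => ph /mapP [m _ ->].
  by rewrite /wf; lia.
Qed.

Lemma norm_eqs o : (o < ns)%nat -> ENorm o \in eqs g.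
Proof. by move=> os; rewrite /eqs mem_cat map_f // mem_iota. Qed.

Lemma tight_eqs k : (k < d.-1)%nat -> ETight k \in eqs g.
Proof. by move=> kd; rewrite /eqs !mem_cat orbC [_ \in map ETight _]map_f // mem_iota. Qed.

Lemma off_eqs k l c : (k < l < d)%nat -> chr g k = chr g l ->
  (c < if period g %| (chr g k).*2 then 4 else 2)%nat -> EOff k l c \in eqs g.
Proof.
move=> kl kE cE; rewrite /eqs !mem_cat; apply/or4P; apply: Or43.
apply/flatten_mapP; exists k; first by rewrite mem_iota; lia.
apply/flatten_mapP; exists l; first by rewrite mem_iota; lia.
by rewrite kE eqxx map_f // mem_iota -kE.
Qed.

Lemma self_eqs o m : (o < ns)%nat -> (2 <= m <= (osz g o)./2)%nat -> EPair o o m \in eqs g.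
Proof.
move=> os mh; rewrite /eqs !mem_cat; apply/or4P; apply: Or44.
apply/flatten_mapP; exists o; first by rewrite mem_iota; lia.
by rewrite mem_cat map_f // mem_iota; lia.
Qed.

Lemma pair_eqs o p m : (o < p < ns)%nat -> (m < gcdn (osz g o) (osz g p))%nat ->
  ~~ ((o == 0) && (osz g p == 1))%nat -> EPair o p m \in eqs g.
Proof.
move=> os mh cond; rewrite /eqs !mem_cat; apply/or4P; apply: Or44.
apply/flatten_mapP; exists o; first by rewrite mem_iota; lia.
rewrite mem_cat; apply/orP; right.
apply/flatten_mapP; exists p; first by rewrite mem_iota; lia.
by rewrite map_f // mem_filter cond mem_iota.
Qed.

Lemma uidxE b m : (0 < period g)%nat -> uidx g b m = ((b * m) %% period g)%nat.
Proof.
move=> p0; rewrite /uidx; have -> : N.mul (N.of_nat b) (N.of_nat m) = N.of_nat (b * m)%nat by lia.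
move: (b * m)%nat (period g) p0 => x y y0; rewrite N2Nat.inj_mod !Nat2N.id; symmetry.
have e := divn_eq x y; have h := ltn_pmod x y0.
by apply: (Nat.mod_unique _ _ (x %/ y)%nat); lia.
Qed.

End Equations.

Lemma checkP g tab (S := system g tab (vecs g)) : check g tab ->
  [/\ shape_ok g (vecs g), stab_ok g (vecs g), size (cpiv g) = size (eqs g) &
      contracts (size (eqs g)) (map fst S) (map snd S) (inverse (map snd S))].
Proof.
rewrite /check -/S; have -> : size S = size (eqs g) by rewrite /S /system size_map.
by case/and4P => -> -> /eqP.
Qed.

Section Shape.
Variables (R : realType) (g : config) (V : seq (seq (quat Z))).
Hypothesis ok : shape_ok g V.
Local Notation d := (cdim g).
Local Notation ns := (norb g).

Lemma shape_dims : [/\ (1 < d <= 6)%nat, (0 < ns <= 4)%nat, (1 < npts g <= 64)%nat & osz g 0 !=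
  1%nat].
Proof. by case/and5P: ok => -> -> -> ->. Qed.

Lemma shape_osz o : (o < ns)%nat -> (0 < osz g o)%nat /\ (osz g o %| period g)%nat.
Proof.
case/and5P: ok => _ _ _ _ /andP [/allP H _] os.
by apply/andP; apply: H; rewrite mem_iota.
Qed.

Lemma shape_chr k : (k < d)%nat -> ((chr g k).*2 <= period g)%nat.
Proof.
case/and5P: ok => _ _ _ _ /and3P [_ /allP H _] kd.
by apply: H; rewrite mem_iota.
Qed.

Lemma shape_piv : uniq [seq iv.1 | iv <- cpiv g] /\
  all (fun i => (i < 4 * d * ns)%nat) [seq iv.1 | iv <- cpiv g].
Proof. by case/and5P: ok => _ _ _ _ /and5P [_ _ -> H _]; rewrite all_map. Qed.

Lemma shape_norm o : (o < ns)%nat -> hnorm2 (center R V o : hvec R d) <= 1 + 1 / 2 ^+ 16.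
Proof.
case/and5P: ok => _ _ _ _ /and5P [_ _ _ _ /allP H] os.
have oi : o \in iota 0 ns by rewrite mem_iota.
move: (H o oi); rewrite -(zr_le R) zrD (zr_pow R 76) (zr_pow R 60) => h.
have -> : hnorm2 (center R V o : hvec R d) = zr R (zsum [seq zqn2 (vq V o k) | k <- iota 0 d]) / 2
  ^+ 76.
  by rewrite zr_sum_iota mulr_suml; apply: eq_bigr => k _; rewrite zr_qn2.
rewrite ler_pdivrMr ?p2gt0 //; apply: le_trans h _.
have -> : (2 : R) ^+ 76 = 2 ^+ 16 * 2 ^+ 60 by rewrite -exprD.
have key (a b : R) : a != 0 -> (1 + 1 / a) * (a * b) = a * b + b by move=> a0; field.
by rewrite key // p2neq0.
Qed.

End Shape.

Section Roots.
Variables (R : realType) (z : quat R) (q : nat) (tab : seq (Z * Z)).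
Local Notation L := (4 * q)%nat.
Hypothesis q0 : (0 < q)%nat.
Hypothesis z_cpx : qj z = 0 /\ qk z = 0.
Hypothesis z_unit : qnorm2 z = 1.
Hypothesis zL : z ^+ L = 1.
Hypothesis z_tab : forall n, (n < L)%nat ->
  `|qre (z ^+ n) - zr R (nth (0, 0)%Z tab n).1 / 2 ^+ 38| <= 2 / 2 ^+ 38 /\
  `|qi (z ^+ n) - zr R (nth (0, 0)%Z tab n).2 / 2 ^+ 38| <= 2 / 2 ^+ 38.
Hypothesis sz_tab : size tab = L.
Hypothesis tab_lt : all (fun t => t.1 + 2 <? 2 ^ 38)%Z (behead tab).

Lemma pow_cpx n : qj (z ^+ n) = 0 /\ qk (z ^+ n) = 0.
Proof.
case: z_cpx => z1 z2; elim: n => [|n [IH1 IH2]]; first by rewrite expr0.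
by rewrite exprS /= IH1 IH2 z1 z2; split; ring.
Qed.

Lemma pow_unit n : qnorm2 (z ^+ n) = 1.
Proof.
elim: n => [|n IH]; first by rewrite expr0 /qnorm2 /= expr1n expr0n !addr0.
by rewrite exprS qnorm2M z_unit IH mulr1.
Qed.

Lemma pow_mod n : z ^+ n = z ^+ (n %% L).
Proof. by rewrite {1}(divn_eq n L) exprD mulnC exprM zL expr1n mul1r. Qed.

(** If z^r = 1 with 0 < r < L, the real part 1 would be within 2 units of a table entry that lies
    more than 2 units below 1. *)
Lemma pow_eq1 n : (z ^+ n == 1) = (L %| n)%nat.
Proof.
rewrite pow_mod /dvdn; have := ltn_pmod n (_ : 0 < L)%nat; move: (n %% L)%nat => r /(_ _) rL.
have {}rL : (r < L)%nat by apply: rL; rewrite muln_gt0.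
case: r rL => [|r] rL; first by rewrite expr0 !eqxx.
apply/negbTE/eqP => E; have [h _] := z_tab rL; move: h; rewrite E [qre 1]/=.
have : nth (0, 0)%Z (behead tab) r \in behead tab by rewrite mem_nth // size_behead sz_tab -ltnS
  prednK // muln_gt0.
move/(allP tab_lt) => lt; rewrite -nth_behead.
have {lt} : zr R (nth (0, 0)%Z (behead tab) r).1 + 2 < 2 ^+ 38.
  have -> : (2 : R) = zr R 2 by [].
  rewrite -(zr_pow R 38) -zrD ltNge zr_le.
  by move: lt; rewrite -[Z.of_nat 38]/(38%Z); move: (_ + 2)%Z (2 ^ 38)%Z => a b; lia.
move: (zr R _) => a h1 h2; have p := p2gt0 R 38.
move: (2 ^+ 38) p h1 h2 => b b0 ab; rewrite ler_distl => /andP [_].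
by rewrite -mulrDl ler_pdivlMr // mul1r leNgt ab.
Qed.

End Roots.

(** * From an exact zero to a tight simplex *)

Section Assembly.
Variables (R : realType) (g : config) (V : seq (seq (quat Z))) (u : nat -> quat R).
Local Notation d := (cdim g).
Local Notation ns := (norb g).
Local Notation L := (period g).
Hypothesis ok : shape_ok g V.
Hypothesis stab : stab_ok g V.
Hypothesis L_gt0 : (0 < L)%nat.
Hypothesis uD : forall m n, u (m + n)%nat = u m * u n.
Hypothesis uL : u L = 1.
Hypothesis u_cpx : forall n, qj (u n) = 0 /\ qk (u n) = 0.
Hypothesis u_unit : forall n, qnorm2 (u n) = 1.
Hypothesis u_prim : forall n, (u n == 1) = (L %| n)%nat.
Variable X : nat -> nat -> quat R.
Hypothesis X_inactive : forall o k c, (c < 4)%nat -> ~~ active g V o k c -> qcomp c (X o k) = 0.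
Hypothesis X_root : forall e, e \in eqs g -> residual g u X e = 0.
Local Opaque shape_ok active.

Lemma stab_okP o k (m := osz g o) (e := (nth (0, 0) (corbs g) o).2%nat) : (o < ns)%nat -> (k <
  d)%nat ->
  ((active g V o k 0 || active g V o k 1) ==> (chr g k * m == e %[mod L])%nat) /\
  ((active g V o k 2 || active g V o k 3) ==> (L %| chr g k * m + e)%nat).
Proof.
move: (stab); rewrite [stab_ok _ _]/stab_ok => /allP H os kd.
have oi : o \in iota 0 ns by rewrite mem_iota.
move/allP: (H o oi) => {}H.
have ki : k \in iota 0 d by rewrite mem_iota.
by apply/andP; exact: (H k ki).
Qed.

Local Opaque stab_ok.
(** The scalar is z^e. On the complex part of a coordinate z^(b m) and z^e commute past it and must
    agree; on the j part they must be conjugate; a part without active components is zero. *)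
Lemma orbit_stab o : (o < ns)%nat -> exists2 l, qnorm2 l = 1 &
  forall k : 'I_d, twist u (fun k : 'I_d => chr g k) (osz g o) (hv X o) k = hv X o k * l.
Proof.
move=> os; pose e := (nth (0, 0) (corbs g) o).2%nat.
exists (u e) => // k; rewrite /twist /hv.
have [h1 h2] := stab_okP os (ltn_ord k).
set b := (chr g k * osz g o)%nat in h1 h2 *.
have u_mod m n : (m == n %[mod L])%nat -> u m = u n.
  move=> E; have uq c r : u (c * L + r)%nat = u r.
    elim: c => [|c IH]; first by [].
    by rewrite mulSn -addnA uD uL mul1r.
  by rewrite (divn_eq m L) (divn_eq n L) !uq (eqP E).
have [b2 b3] := u_cpx b; have [e2 e3] := u_cpx e.
have H01 : (qre (X o k) = 0 /\ qi (X o k) = 0) \/ (qre (u b) = qre (u e) /\ qi (u b) = qi (u e)).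
  case: (boolP (active g V o k 0 || active g V o k 1)) h1 => [_ /u_mod ->|]; first by right.
  rewrite negb_or => /andP [a0 a1] _; left.
  by split; [exact: (X_inactive _ a0) | exact: (X_inactive _ a1)].
have H23 : (qj (X o k) = 0 /\ qk (X o k) = 0) \/ (qre (u b) = qre (u e) /\ qi (u b) = - qi (u e)).
  case: (boolP (active g V o k 2 || active g V o k 3)) h2 => [_ be|]; last first.
    rewrite negb_or => /andP [a0 a1] _; left.
    by split; [exact: (X_inactive _ a0) | exact: (X_inactive _ a1)].
  right; have /eqP E : u (b + e)%nat == 1 by rewrite u_prim.
  have {}E : u b = qconj (u e).
    rewrite -[u b]mulr1 -[X in _ * X = _](_ : u e * qconj (u e) = 1).
      by rewrite mulrA -uD E mul1r.
    by rewrite qmulC u_unit.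
  by rewrite E.
change (u b * X o k = X o k * u e).
apply: quatP; rewrite /= b2 b3 e2 e3;
  [case: H01 | case: H01 | case: H23 | case: H23] => -[-> ->]; ring.
Qed.

Lemma assembled_simplex : exists y : 'I_(npts g) -> hvec R d, tight_simplex y.
Proof.
have [/andP [d1 d6] /andP [ns0 _] /andP [N1 _] o0] := shape_dims ok.
have X_norm o : (o < ns)%nat -> hnorm2 (hv X o : hvec R d) = 1.
  by move=> /norm_eqs /X_root /eqP; rewrite /residual subr_eq0 => /eqP.
have sizes : (\sum_(p < ns) osz g p = npts g)%nat.
  by rewrite /npts sumnE big_map -(big_mkord xpredT (osz g)) /index_iota subn0.
pose c : R := (npts g)%:R / d%:R.
have d0 : (d%:R : R) != 0 by rewrite pnatr_eq0; case: (d) d1.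
have N10 : ((npts g)%:R - 1 : R) != 0 by rewrite subr_eq0 (eqr_nat R _ 1);
  case: (npts g) N1 => [|[]].
have diag_lt (k : 'I_d) : (k < d.-1)%nat -> \sum_(p < ns) qnorm2 (hv X p k) *+ osz g p = c.
  move/tight_eqs/X_root; rewrite /residual -mulrBl => /eqP.
  by rewrite mulf_eq0 invr_eq0 pnatr_eq0 orbF subr_eq0 => /eqP.
have diag_sum : \sum_(k < d) \sum_(p < ns) qnorm2 (hv X p k) *+ osz g p = (npts g)%:R.
  rewrite exchange_big /= -sizes natr_sum; apply: eq_bigr => p _.
  by rewrite sumrMnl -/(hnorm2 (hv X p : hvec R d)) X_norm.
(* The trace of the frame operator is N by the unit norms; d - 1 diagonal entries equal N / d, hence
   so does the last. *)
have diag (k : 'I_d) : \sum_(p < ns) qnorm2 (hv X p k) *+ osz g p = c.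
  have [|kd] := ltnP k d.-1; first exact: diag_lt.
  move: diag_sum; rewrite (bigD1 k) //=.
  have -> : \sum_(i < d | i != k) \sum_(p < ns) qnorm2 (hv X p i) *+ osz g p = \sum_(i < d | i !=
    k) c.
    apply: eq_bigr => i; rewrite -val_eqE /= => ik; apply: diag_lt; have := ltn_ord i;
      have := ltn_ord k; lia.
  rewrite sumr_const (_ : #|_| = d.-1); last first.
    by have := cardC1 k; rewrite card_ord => <-; apply: eq_card => i; rewrite !inE.
  move=> E; apply: (addIr (c *+ d.-1)); rewrite E -mulrS prednK; last by lia.
  by rewrite /c -[RHS]mulr_natr mulfVK.
have off (k l : 'I_d) : (k < l)%nat -> chr g k = chr g l ->
    let Q := \sum_(p < ns) (hv X p k * qconj (hv X p l)) *+ osz g p in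
  [/\ qre Q = 0, qi Q = 0 & (L %| (chr g k).*2)%nat -> qj Q = 0 /\ qk Q = 0].
  move=> kl kE Q; have kld : (k < l < d)%nat by rewrite kl ltn_ord.
  have Qc e : (e < if L %| (chr g k).*2 then 4 else 2)%nat -> qcomp e Q = 0.
    move=> ce; have /eqP := X_root (off_eqs kld kE ce).
    by rewrite /residual mulf_eq0 invr_eq0 pnatr_eq0 orbF => /eqP.
  split; [by apply: (Qc 0%nat); case: ifP | by apply: (Qc 1%nat); case: ifP |].
  by move=> kL; split; [apply: (Qc 2%nat) | apply: (Qc 3%nat)]; rewrite kL.
have pair o p m : EPair o p m \in eqs g ->
    overlap u (fun k : 'I_d => chr g k) (hv X) o p m = gam R g.
  by move=> /X_root /eqP; rewrite /residual subr_eq0 => /eqP.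
have gamN : gam R g *+ (npts g).-1 = c - 1.
  rewrite -[LHS]mulr_natr -subn1 natrB ?(ltnW N1) // /gam /c.
  by field; rewrite d0 N10.
apply: (@orbits_tight_simplex R d L u (fun k : 'I_d => chr g k) L_gt0 uD u_cpx u_unit u_prim
  (fun k => shape_chr ok (ltn_ord k)) ns (osz g) (hv X) (fun o os => (shape_osz ok os).1)
  (fun o os => (shape_osz ok os).2) orbit_stab c diag off (npts g) (gam R g) sizes X_norm) => //.
- by rewrite gamN addrCA subrr addr0.
- by move=> o m os mh; apply: pair; apply: self_eqs.
- by move=> o p m op mg cond; apply: pair; apply: pair_eqs.
- by move=> p _ p1; case: p p1 => // p1; rewrite p1 in o0.
(* An overlap equal to 1 would give N = N / d, against d > 1; this is what keeps the lines
   distinct. *)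
- apply/eqP => E; move: gamN; rewrite E -subn1 natrB ?(ltnW N1) // => /addIr.
  move/(congr1 (fun x => x * d%:R)); rewrite /c mulfVK // -natrM => /eqP.
  by rewrite eqr_nat -{2}[npts g]muln1 eqn_mul2l; lia.
Qed.

End Assembly.

Theorem check_simplex (R : realType) (g : config) (c0 : Z) (tab := mktab c0 (4 * cq g)%nat) :
  tab_ok c0 (cq g) tab -> check g tab ->
  exists y : 'I_(npts g) -> hvec R (cdim g), tight_simplex y.
Proof.
move=> ok /checkP [shape stab piv_size contr].
have [z [[zj zk zn] zL z_tab]] := @trig_table R c0 (cq g) ok.
case: (tab_okP ok) => /andP [q0 _] _ _ _ tab_lt.
have sz_tab : size tab = (4 * cq g)%nat by rewrite size_map size_traject.
have L0 : (0 < period g)%nat by rewrite muln_gt0.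
pose u n := z ^+ n.
have [d16 ns4 N64 _] := shape_dims shape.
have u_tab b m (t := nth (0, 0)%Z tab (uidx g b m)) :
  `|qre (u (b * m)%nat) - zr R t.1 / 2 ^+ 38| <= 2 * (1 / 2 ^+ 38) /\
  `|qi (u (b * m)%nat) - zr R t.2 / 2 ^+ 38| <= 2 * (1 / 2 ^+ 38).
  rewrite mulrA mulr1 /u (pow_mod zL) /t uidxE //.
  by apply: z_tab; rewrite ltn_pmod.
have [P_uniq P_lt] := shape_piv shape.
have [w _ root] := @residual_root R g (vecs g) tab u d16 (proj2 (andP ns4)) N64 (shape_norm R shape)
  (pow_cpx (conj zj zk)) (pow_unit zn) u_tab P_uniq P_lt (etrans (size_map _ _) piv_size) (eqs_wf
    g) _ contr.
apply: (@assembled_simplex R g (vecs g) u shape stab L0 _ zL (pow_cpx (conj zj zk)) (pow_unit zn) _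
  _ _ root).
- by move=> m n; rewrite /u exprD.
- exact: (pow_eq1 q0 zL z_tab sz_tab tab_lt).
- move=> o k c; exact: (perturbed_inactive d16 (proj2 (andP ns4)) N64 P_uniq P_lt
    (etrans (size_map _ _) piv_size) (eqs_wf g)).
Qed.

(** * The certificates *)
(* cos (2 pi / 4 q) in units of 2^-56. *)
Definition cosines : seq (nat * Z) := [::
  (3%nat, 62403706972431700);
  (4%nat, 66572536293648945);
  (5%nat, 68530844358322171);
  (6%nat, 69602291061487782);
  (7%nat, 70250959712242503);
  (8%nat, 70673027573671297);
  (9%nat, 70962877271957691);
  (10%nat, 71170445482599133);
  (11%nat, 71324151629092731);
  (13%nat, 71532213047606089);
  (15%nat, 71662854998277683);
  (17%nat, 71750209045158164);
  (19%nat, 71811480821568848);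
  (21%nat, 71856106390361705)]%Z.

(** A table depends only on the order of z, so it is evaluated once and shared by all cases with
    that order. *)
Definition tables : seq (nat * Z * seq (Z * Z)) := Eval vm_compute in
  [seq (qc, mktab qc.2 (4 * qc.1)%nat) | qc <- cosines].

Lemma tables_ok : all (fun t => tab_ok t.1.2 t.1.1 t.2) tables.
Proof. by vm_cast_no_check (erefl true). Qed.

Lemma tablesE : tables = [seq (qc, mktab qc.2 (4 * qc.1)%nat) | qc <- cosines].
Proof. by vm_cast_no_check (erefl tables). Qed.

(** The conditional, unlike a boolean conjunction, is not strict: under call-by-value evaluation
    [check] runs only on the table of the right order. *)
Definition certified (g : config) : bool :=
  has (fun t => if t.1.1 == cq g then check g t.2 else false) tables.

(** Orbits of odd size q come with characters divisible by 4, so that U^q = 1 and e = 0; orbits of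
    size 2q come with odd characters, so that U^(2q) = -1 and e = 2q. Both leave all components
    free. Smaller orbits live on the few components allowed by the congruences of [stab_ok], and
    adding them fills in the values of N that are not multiples of q. *)
Definition cases : seq config := [::
 Config 3 5 [:: 0; 4; 8]%nat [:: (5, 0)]%nat [:: 152; 238; 0; 292; -3; 0; -227; 0; 75; 188; 0;
  -227]%Z (zip [:: 10; 2; 7; 5]%nat [:: 136091040271; -115306491005; 116954618740; 88282883104]%Z);
 Config 3 3 [:: 1; 3; 5]%nat [:: (6, 6)]%nat [:: -84; -354; -4; 0; 0; 256; -327; 0; 0; -164; 0;
  201]%Z (zip [:: 8; 3; 7; 10; 4]%nat [:: 142577975873; -125085545991; -99833105218; 2866263313;
  -52838364112]%Z);
 Config 3 7 [:: 4; 8; 12]%nat [:: (7, 0)]%nat [:: 0; 218; 0; 272; -73; 0; -160; 0; 89; 150; 0;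
  -221]%Z (zip [:: 10; 2; 5; 0; 7]%nat [:: 139551157490; -117672185001; 110573765307; 50829492581;
  103589225672]%Z);
 Config 3 7 [:: 4; 8; 12]%nat [:: (7, 0); (1, 4)]%nat [:: -206; 99; 0; -42; 0; -297; -146; 0; -161;
  0; 122; 0; -553; 0; 0; 0; 0; 0; 0; 0; 0; 0; 0; 0]%Z (zip [:: 11; 13; 2; 4; 9; 7]%nat [::
  -155219124839; -231348228761; -118738306448; 120406114063; 41840903976; 79963790526]%Z);
 Config 3 9 [:: 4; 8; 12]%nat [:: (9, 0)]%nat [:: -73; 0; 0; 0; 48; 139; -99; 0; -8; 0; -253; 0]%Z
  (zip [:: 7; 1; 11; 3; 2; 9]%nat [:: 151398390431; -121849874606; 118509698556; 37889076479;
  -92298351008; -80774127669]%Z);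
 Config 3 9 [:: 4; 8; 12]%nat [:: (9, 0); (1, 8)]%nat [:: 0; 319; 45; -284; 0; 0; 0; -59; 0; 139;
  344; 0; 0; 0; 0; 0; 0; -202; 0; 0; 0; 0; 0; 0]%Z (zip [:: 0; 16; 8; 6; 11; 5; 4]%nat [::
  121218592687; 269476577199; -119043925961; -102340068103; -62399562833; 94140718590;
  1509589363]%Z);
 Config 3 3 [:: 1; 3; 5]%nat [:: (6, 6); (3, 3); (2, 2)]%nat [:: -439; 84; 53; 0; -376; 0; 0; 136;
  0; 0; 0; 0; 0; 0; 0; 0; 0; 0; -272; 0; 0; -164; 0; 0; -17; 0; 0; 0; 0; 0; 0; 0; 0; 0; 0; -447]%Z
  (zip [:: 3; 19; 34; 9; 5; 10; 6; 20; 11; 12; 13; 8; 25]%nat [:: -155928319187; -205072548021;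
  207099330230; 100979785542; -99923803952; 14828706903; 31249996638; 154558817532; -57930224612;
  42022660033; -24075125222; 19807173839; 135089417397]%Z);
 Config 4 5 [:: 0; 4; 4; 8]%nat [:: (5, 0); (1, 4)]%nat [:: -198; 276; -196; 0; 0; 163; 0; 0; -20;
  0; -115; 0; 80; -190; 194; 0; 0; 0; 0; 0; -662; 172; 0; 0; 178; 0; 0; 0; 0; 0; 0; 0]%Z (zip [::
  15; 25; 3; 4; 11; 7; 6; 9]%nat [:: -129972888565; -198907593653; -107634517628; -88414374904;
  -113976304081; -50193813886; 60615412553; -18042055942]%Z);
 Config 4 7 [:: 0; 4; 8; 12]%nat [:: (7, 0)]%nat [:: -128; 4; 0; 33; 0; 265; 137; -82; 91; 0; -27;
  0; -18; 0; -183; 0]%Z (zip [:: 2; 11; 4; 13; 15; 9]%nat [:: -132775188455; 132677737539;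
  -109509164664; 97253359062; -83634721590; -25235787501]%Z);
 Config 4 4 [:: 1; 3; 5; 7]%nat [:: (8, 8)]%nat [:: 81; 0; 0; 24; 0; -108; -287; -143; -207; 0; -8;
  0; 0; -137; -104; 0]%Z (zip [:: 12; 2; 4; 11; 15; 1; 9]%nat [:: -129031647719; -95884499747;
  103151192193; -103125037211; 10415176364; -95819380039; 71850435621]%Z);
 Config 4 9 [:: 4; 8; 12; 16]%nat [:: (9, 0)]%nat [:: -310; 0; -123; 0; 166; 0; 247; 0; 0; 195; 223;
  -7; -70; 0; -30; 0]%Z (zip [:: 13; 3; 5; 8; 1; 7; 15]%nat [:: 135910013343; 83884064312;
  87301721714; -112082973739; -61951880995; 69900604442; -12613021]%Z);
 Config 4 9 [:: 4; 8; 12; 16]%nat [:: (9, 0); (1, 4)]%nat [:: 0; -95; -95; 0; 2; 0; -379; 0; 0;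
  -139; -258; 136; 0; 148; 0; -270; 632; 0; 0; 0; 0; 0; 0; 0; 0; 0; 0; 0; 0; 0; 0; 0]%Z (zip [:: 12;
  17; 0; 5; 8; 3; 7; 14]%nat [:: -117808603128; 216278365272; 99638923500; 86642851431;
  116046765384; -36938091978; 55951753142; 16675741761]%Z);
 Config 4 11 [:: 4; 8; 12; 16]%nat [:: (11, 0)]%nat [:: 0; -194; 0; 183; -194; 0; 229; -89; -11; 0;
  0; 2; 0; 49; 0; 0]%Z (zip [:: 12; 2; 5; 9; 0; 14; 15; 10]%nat [:: 125464735001; 98006044813;
  -108756451905; -113252977782; -64491741609; -50238768560; 21239634008; -77808879671]%Z);
 Config 4 11 [:: 4; 8; 12; 16]%nat [:: (11, 0); (1, 4)]%nat [:: 0; 121; 0; -181; 0; -293; 0; 0; 0;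
  99; 43; 159; 68; 0; 0; 223; 0; -70; 0; 0; 0; 0; 0; 0; 0; 0; 0; 0; 0; 0; 0; 0]%Z (zip [:: 8; 16; 0;
  4; 13; 7; 2; 6; 14]%nat [:: 133960931251; -274234902073; -86640513674; -96461768360;
  -106039950366; 25475835095; 53061669050; -66833575301; -73794800797]%Z);
 Config 4 13 [:: 4; 8; 12; 20]%nat [:: (13, 0)]%nat [:: -56; 0; 0; 0; 0; -169; -180; 0; -20; 0; 231;
  0; 0; 54; 0; -82]%Z (zip [:: 11; 1; 4; 14; 7; 12; 2; 3; 9]%nat [:: -119875568658; 115342970066;
  119734772496; 99778618819; -12662827361; -90769256643; 62968202039; 37342979325; 25405228937]%Z);
 Config 4 13 [:: 4; 8; 12; 20]%nat [:: (13, 0); (1, 4)]%nat [:: 0; 83; 0; 0; -105; 0; 59; 0; 163; 0;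
  0; 0; 0; -35; -162; 110; 716; 0; 0; 0; 0; 0; 0; 0; 0; 0; 0; 0; 0; 0; 0; 0]%Z (zip [:: 12; 17; 0;
  5; 9; 2; 10; 3; 11; 7]%nat [:: -132254507802; -196512355329; 103125280786; 103653487222;
  114075898393; 47363545260; -73560901000; 33997421766; -1867299181; -92483452033]%Z);
 Config 4 6 [:: 1; 3; 5; 11]%nat [:: (12, 12); (3, 9)]%nat [:: 49; 0; -322; 0; 0; -267; 51; 276; 0;
  0; 0; 95; 0; 0; 0; 99; 0; 0; 0; 0; 0; 0; 0; 0; 0; 0; -336; 0; 0; -89; 0; 0]%Z (zip [:: 3; 27; 4;
  14; 10; 28; 1; 12; 8; 13; 20; 21; 9]%nat [:: -111717438392; -178446398745; 109412965865;
  104017512188; -100503180299; -178044945252; 59049271884; 61443542992; -49703282382; -15586899466;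
  -27382760688; 50588003019; 19891562485]%Z);
 Config 4 6 [:: 1; 3; 5; 11]%nat [:: (12, 12); (3, 9); (1, 3)]%nat [:: 0; 220; -239; 0; 0; 0; 0; 0;
  0; 0; 0; 0; -40; 0; 86; -293; 0; 0; 0; 0; -49; 0; 0; 0; 0; 0; 397; 0; 0; -65; 0; 0; 0; 0; 0; 0; 0;
  -459; 0; 0; 0; 0; 0; 0; 0; 0; 0; 0]%Z (zip [:: 13; 27; 36; 0; 5; 10; 7; 3; 8; 6; 28; 4; 11; 9;
  21]%nat [:: 123118645998; 190566422374; 245716702233; 119512747428; -73284197424; -72816797773;
  56203956620; 57437517330; 48031928151; -68250585235; -111666292904; 43863105551; 64124422239;
  -39326062851; -122223412086]%Z);
 Config 4 6 [:: 1; 3; 7; 9]%nat [:: (12, 12); (3, 3); (2, 6)]%nat [:: 0; 169; 0; 0; 0; 98; -1; 45;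
  236; 0; 0; 0; 0; 0; 0; 0; 0; 382; 0; 0; 0; 0; 0; 0; 0; 0; 0; 0; -365; 0; 0; 0; 0; 0; 0; 0; -13; 0;
  0; 0; 0; 0; 0; 0; 0; 0; 0; -270]%Z (zip [:: 4; 16; 46; 0; 9; 14; 12; 11; 3; 2; 13; 27; 26; 10; 15;
  37; 29]%nat [:: 149877774724; -189824836591; 222604285118; 110450545777; -113928178408;
  -76696723242; 61087164407; -71068034249; 11668509273; 27008561365; -18012590338; -19947718319;
  86327562935; -52477345154; 48964689197; -144013956386; 107513860653]%Z);
 Config 4 9 [:: 4; 8; 12; 16]%nat [:: (9, 0); (9, 0)]%nat [:: 0; 139; -2; -378; 0; 0; 0; 0; 0; 0; 0;
  0; -76; 0; 72; -248; 0; 0; 0; 0; 0; -305; 0; -241; -313; 0; 212; 0; 0; -357; 0; 27]%Z (zip [:: 0;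
  28; 11; 20; 13; 8; 25; 5; 17; 16; 22; 7; 6; 19; 4; 30; 27; 9; 10; 18]%nat [:: -143663452760;
  -120571319441; 100860309053; 95137003765; 92331627820; 30032478862; -89391975286; -81014863426;
  -53175815260; -28752201696; 73357997280; -50220507873; 57931762129; 11753594899; -4068812777;
  16080407723; 49644905910; 74746533969; 19069004396; 40728988558]%Z);
 Config 4 9 [:: 4; 8; 12; 16]%nat [:: (9, 0); (9, 0); (1, 4)]%nat [:: 0; 0; 0; -332; 0; -116; -50;
  0; 0; 0; 0; 0; 0; 294; 0; 39; -191; 0; 0; 50; 0; 0; 0; 0; -44; 458; 0; -103; 0; 0; 0; -127; 0;
  402; 0; 0; 0; 0; 0; 0; 0; 0; 0; 0; 0; 0; 0; 0]%Z (zip [:: 4; 26; 32; 17; 12; 0; 30; 14; 9; 10; 29;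
  21; 11; 23; 7; 2; 1; 28; 18; 22; 8; 20]%nat [:: 158981161172; -127522420227; 252810340570;
  111822590033; -99611884253; -84362085025; 79725325549; 80548785224; -18219820428; 11085439547;
  -66226160748; 14636727760; 82456416450; -43191944609; 55195428949; 14252951559; 21877782028;
  72283528491; -20689439206; -64104088870; -18515740256; 64941153113]%Z);
 Config 4 4 [:: 1; 3; 5; 7]%nat [:: (8, 8); (8, 8); (4, 4)]%nat [:: 360; 316; 241; 0; 0; -155; 0; 0;
  0; 0; 0; 0; 0; 0; 0; 0; 0; 0; 0; 0; 0; 0; 0; 0; 294; 0; 280; -28; 0; 119; 0; 0; 0; 0; 0; 0; 0; 0;
  -68; 0; 186; 0; 0; 0; 0; 0; 0; -66]%Z (zip [:: 3; 28; 39; 6; 13; 25; 11; 15; 4; 9; 12; 22; 8; 19;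
  18; 10; 21; 20; 14; 7; 17; 31; 16; 23; 41; 33; 30; 46; 32]%nat [:: 115322080412; 139778810171;
  205433665384; -111212080050; 100356644110; 137449009722; 89459257833; -11168033440; -685013534;
  -2741988791; 37971363405; -48446717190; -25213647939; 87794855608; 59664924997; 38243898307;
  4711914236; 70185050750; 40476601287; -63675078295; 13035052224; 59425725980; 31900006463;
  -22495534189; 100419146123; 37667048023; 19618220177; 136495771929; -8999109157]%Z);
 Config 4 9 [:: 4; 8; 12; 16]%nat [:: (9, 0); (9, 0); (3, 12)]%nat [:: 11; 0; 0; 47; 0; -37; -12;
  -425; 0; 0; 0; 0; 0; 0; 0; 0; -78; 0; 0; 0; 0; 0; 0; 0; 0; -280; 0; 266; 0; 0; 0; 42; 161; 0; 0;
  0; 0; 0; 0; 0; 0; 0; 0; 0; 0; -426; 0; 0]%Z (zip [:: 1; 26; 44; 4; 17; 29; 2; 8; 11; 9; 10; 19;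
  20; 13; 12; 22; 30; 18; 38; 23; 15; 14; 21; 24; 28; 33; 39]%nat [:: -153293180898; -129531427382;
  -187961449320; -131019117673; -122449898131; -121380305109; -3144298644; 94897964185;
  -24085440434; -39318203607; -23166419899; -21192686304; -33893913054; -14844599339; 248347568;
  -47920510087; -2890156; -1511401339; -92850751240; 65404089716; 92865412964; 32834485303;
  -39072027869; 69863231657; 56189057262; -108061767283; 70606096838]%Z);
 Config 5 7 [:: 0; 4; 4; 8; 12]%nat [:: (7, 0); (1, 4)]%nat [:: 174; 278; 0; -20; 0; 4; -112; 0;
  279; 0; 66; 0; 0; -193; 258; 0; 0; 205; 0; 28; 0; 0; 0; 0; -607; 0; 0; 0; -287; -94; 0; 0; 0; 0;
  0; 0; 0; 0; 0; 0]%Z (zip [:: 9; 25; 2; 7; 16; 15; 11; 4; 18; 12]%nat [:: 101956941330;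
  206000733970; 97421922581; 79746915519; -86264339195; 81608656509; 3657038228; -12273279270;
  -82122585759; 55945339614]%Z);
 Config 5 9 [:: 0; 4; 8; 12; 16]%nat [:: (9, 0)]%nat [:: -133; 304; 22; 0; -24; 0; -127; 0; 0; -241;
  0; -271; -137; 0; 219; 82; 0; -85; 82; 0]%Z (zip [:: 5; 3; 13; 10; 19; 7; 8; 16]%nat [::
  114387825846; 84515060659; -99089122676; -60866331151; -95745606254; 28692785418; -43928391665;
  -70279586289]%Z);
 Config 5 5 [:: 1; 3; 5; 7; 9]%nat [:: (10, 10)]%nat [:: 0; -109; 18; -64; 0; 82; 0; -276; 16; 0; 0;
  99; 0; 98; -206; 0; -98; 0; -181; 0]%Z (zip [:: 10; 0; 6; 12; 19; 4; 17; 15; 9]%nat [::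
  119466504520; -118054910549; 95574448505; -86411991328; 79004052368; -1876963589; 76270652831;
  62407237611; -10707185426]%Z);
 Config 5 11 [:: 4; 8; 12; 16; 20]%nat [:: (11, 0)]%nat [:: 0; 214; 67; 249; -231; 0; 106; 0; 0; 57;
  0; -214; 0; 104; -264; 0; 124; 0; 0; 45]%Z (zip [:: 18; 0; 7; 8; 15; 12; 17; 5; 10]%nat [::
  -117681891055; 83788506020; -89944945711; 90227402730; -83954877520; -47556811023; -2944667919;
  -48649512682; 58621871705]%Z);
 Config 5 11 [:: 4; 8; 12; 16; 20]%nat [:: (11, 0); (1, 4)]%nat [:: 0; 124; 110; 97; 0; 217; 219; 0;
  0; 0; -68; 0; 0; 248; 192; -260; 246; 0; 0; -200; 0; 454; 0; 0; 0; 0; 0; 0; 0; 0; 0; 0; 0; 0; 0;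
  0; 0; 0; 0; 0]%Z (zip [:: 11; 20; 0; 7; 17; 12; 4; 8; 18; 9]%nat [:: 105724383408; -246385147022;
  83418289525; -97475562297; -85665634509; 67276276044; -11610018399; -17636326567; -43632671560;
  68289622265]%Z);
 Config 5 13 [:: 4; 8; 12; 16; 20]%nat [:: (13, 0)]%nat [:: 0; 0; 248; 0; 0; 37; 0; -109; 0; 12; 31;
  0; -82; -142; -105; 0; 0; -183; -89; 0]%Z (zip [:: 8; 3; 6; 15; 19; 4; 11; 1; 0; 16]%nat [::
  -119078142083; -96925456802; 115821800766; -111263889840; -94558324333; 27241881202; 29194951307;
  30864935551; -18236064781; 56448127298]%Z);
 Config 5 13 [:: 4; 8; 12; 16; 20]%nat [:: (13, 0); (1, 4)]%nat [:: 0; 119; 0; 92; 227; 0; 0; 8; 0;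
  140; 0; 0; 220; 0; 0; -112; 121; 0; -52; -38; 251; 0; 0; 0; 0; 0; 0; 0; 0; 0; 0; 0; 0; 0; 0; 0; 0;
  0; 0; 0]%Z (zip [:: 17; 21; 2; 5; 8; 14; 6; 0; 13; 10; 11]%nat [:: 122147907405; -266492332430;
  -87758326069; -87018824041; -92123445933; -97054484247; -70597862795; 33615936619; -49628122012;
  -50440489650; 61892651325]%Z);
 Config 5 15 [:: 4; 8; 12; 16; 20]%nat [:: (15, 0)]%nat [:: -298; 0; 0; 130; 153; 88; 84; 0; 89; 0;
  0; 0; 0; 0; 0; -248; -156; 0; 0; 187]%Z (zip [:: 7; 1; 14; 9; 17; 2; 12; 10; 13; 11; 18]%nat [::
  -111167999598; 81066330823; 92069382339; 88803784276; -79923225423; 30381685798; 6637513156;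
  -38917158937; -46464123109; -71694819767; -66711881766]%Z);
 Config 5 15 [:: 4; 8; 12; 16; 20]%nat [:: (15, 0); (1, 8)]%nat [:: 115; 0; 118; 0; -38; 0; -45; 0;
  0; 0; 165; 0; 0; 134; 173; 1; 0; 0; -20; 0; 0; 0; 0; 0; 320; 0; 0; 0; 0; 0; 0; 0; 0; 0; 0; 0; 0;
  0; 0; 0]%Z (zip [:: 12; 25; 3; 5; 11; 19; 16; 1; 8; 17; 7; 9]%nat [:: -112554257939;
  -261111405527; 107582092413; 80761792486; 88635152183; -102610941384; -72478595450; -50880376371;
  -63413234223; 17550948709; 65645906908; -47747402582]%Z);
 Config 5 17 [:: 4; 8; 12; 16; 28]%nat [:: (17, 0)]%nat [:: 0; 289; 206; 0; 191; 0; 0; 0; 0; -187;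
  0; -213; 0; 136; 0; -127; 0; 0; 0; -59]%Z (zip [:: 18; 0; 5; 10; 12; 17; 7; 14; 3; 6; 8; 16]%nat
  [:: 118405276063; -70494726949; -106148057814; -88577185320; 95049008260; 27962670984; 558404640;
  -59852022358; 32648244139; -34858537888; -38427750340; -7682440513]%Z);
 Config 5 17 [:: 4; 8; 12; 16; 28]%nat [:: (17, 0); (1, 4)]%nat [:: 0; 34; 0; 180; 0; 94; 0; 289; 0;
  -28; 0; 190; 105; 0; 0; 0; 0; 0; 0; -54; 0; 354; 0; 0; 0; 0; 0; 0; 0; 0; 0; 0; 0; 0; 0; 0; 0; 0;
  0; 0]%Z (zip [:: 10; 20; 2; 6; 13; 18; 8; 15; 17; 0; 4; 16; 14]%nat [:: -102243681482;
  257930018167; 87407052476; -76851470568; 96165689511; -91856284630; 53748917082; 76883902763;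
  84640461030; 38703373518; -58645690788; 13739875375; -6861448211]%Z);
 Config 5 15 [:: 4; 8; 12; 16; 24]%nat [:: (15, 0); (3, 12); (1, 4)]%nat [:: 0; 0; 0; 0; 0; -127;
  -79; 0; -179; -198; -211; 0; -222; 0; 0; 0; 0; -154; 0; 0; 0; 229; 0; 0; 0; 0; 0; 0; 0; 0; 0; 0;
  0; 0; 0; 424; 253; 0; 0; 0; 0; 486; 0; 0; 0; 0; 0; 0; 0; 0; 0; 0; 0; 0; 0; 0; 0; 0; 0; 0]%Z (zip
  [:: 4; 34; 40; 1; 16; 11; 13; 7; 2; 3; 14; 15; 18; 19; 0; 37; 20]%nat [:: 122724488576;
  -177833167825; 241946581386; 75014344116; 105928647025; 103920671889; -69798211582; -49679945675;
  -42000837426; -65922780881; 37013938412; -20795305116; -27801388583; 39918677066; -4050958118;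
  -120885160860; 89301025635]%Z);
 Config 5 15 [:: 4; 8; 12; 16; 20]%nat [:: (15, 0); (5, 20)]%nat [:: 70; 0; 0; 0; 0; 0; 98; 0; 77;
  343; 0; 7; 0; 0; 0; 0; 0; 218; 0; 0; -92; 0; 0; 0; 0; 0; 0; -184; 0; 0; 0; 0; 0; -271; 0; 0; 0; 0;
  0; 71]%Z (zip [:: 1; 32; 10; 4; 19; 14; 7; 13; 2; 3; 26; 16; 18; 21; 15; 5; 12; 38]%nat [::
  111333968647; 175584446460; 106021221848; 88193271209; 87592537686; -74388697825; 80569743705;
  34000399866; -34082302422; 11977777382; -88924597821; -40282081561; -61873140264; -132951794573;
  -5225506513; 41690892364; 37297796888; -102173874520]%Z);
 Config 5 9 [:: 1; 3; 5; 7; 17]%nat [:: (18, 18); (3, 15)]%nat [:: 0; 78; 0; 0; -114; 14; 321; 0; 0;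
  -63; 0; 0; -242; 0; 0; 0; 0; 0; 0; 0; 0; 0; 0; 0; 0; 0; 0; 0; 0; -442; 0; 0; 0; 0; 0; 55; -76; 0;
  0; 0]%Z (zip [:: 8; 28; 0; 7; 13; 19; 11; 3; 16; 10; 15; 2; 14; 37; 18; 17; 34]%nat [::
  -97074981682; 173194010640; -84984882001; -96201340297; 94306961761; 86647085109; -13526919686;
  81218225773; -78198912254; 19799944445; 10355285015; -58077012959; -27798361805; 96174911733;
  46749314858; -14522837500; 146970902123]%Z);
 Config 5 11 [:: 4; 8; 12; 16; 20]%nat [:: (11, 0); (11, 0)]%nat [:: 0; 0; -193; 0; 0; 0; 0; 50;
  -270; 0; 39; 0; 0; -153; 0; 80; 0; 176; -315; 132; 0; 0; 0; 0; 0; 30; -230; 0; -85; -147; -48; 0;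
  14; 0; 0; 0; 0; 0; 0; 0]%Z (zip [:: 14; 31; 3; 24; 20; 16; 1; 6; 12; 4; 21; 33; 5; 11; 34; 0; 27;
  37; 36; 9; 38; 35; 22; 39; 23]%nat [:: -142461574201; -140525224710; -95931600074; 103494390498;
  80611060021; -103426695919; 22591904094; 75521307764; -39389903474; 42111549736; 63391865935;
  -38567792432; -16883689191; -5664212103; 26190160601; -40706023544; 87711484843; -78064898628;
  13737841921; 53267211704; -50512216853; 63567237129; 52956333725; -7363490477; 53364602948]%Z);
 Config 5 15 [:: 4; 8; 12; 16; 28]%nat [:: (15, 0); (5, 20); (3, 24)]%nat [:: 0; 0; 117; 0; 0; 0; 0;
  0; 0; 160; 0; 0; 0; 24; 0; 247; 0; 0; 0; 32; -33; 0; 0; 0; 0; 0; 0; -292; 0; 0; 0; 0; 0; 0; 0; 0;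
  -205; 0; 0; 0; 0; 0; 0; 0; 130; 0; 0; 0; 0; 0; 0; 81; 0; 0; 0; 0; 0; 206; 0; 0]%Z (zip [:: 1; 26;
  56; 12; 6; 8; 17; 3; 14; 4; 5; 32; 16; 21; 10; 7; 11; 33; 18; 0; 50; 37; 45]%nat [::
  -116070351921; 172015683478; -204248705894; 104728916989; -69608167272; -80368312871;
  -72108885441; 43268910326; 73119496905; 31748660049; -10688772349; 80097998815; -37261452156;
  141536112435; 71568391825; 56441146869; -75469535979; 28995237248; 58324196217; -11683720625;
  140625363003; 97102905392; 96521799985]%Z);
 Config 5 6 [:: 1; 3; 5; 7; 9]%nat [:: (12, 12); (12, 12)]%nat [:: 0; 0; 0; 0; 0; 0; 132; 212; 0;
  -112; -248; 0; 0; 0; 0; 0; 101; 0; 0; -190; 0; -45; 73; 0; 0; 0; 1; 0; 0; 0; 0; 0; 0; -185; 169;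
  -143; 0; 0; 0; 0]%Z (zip [:: 17; 20; 32; 27; 28; 4; 18; 8; 12; 2; 11; 3; 30; 5; 38; 29; 1; 37; 24;
  14; 31; 13; 39; 15; 0; 36; 25; 23]%nat [:: 143833294942; -135177033478; -129475640126;
  -96553563917; -89586534631; 87988802295; 22301718428; 85376598645; 47582353351; 73346666030;
  -64439510000; 12829132972; -49464346568; -76102431306; 44084776604; -49708584194; -35531197945;
  -14775444317; 46215518164; -61589655956; 22414250168; -14154866811; 59059314497; -34695301396;
  44303872853; -7186065574; 27146108445; 51485768095]%Z);
 Config 5 6 [:: 1; 3; 5; 7; 9]%nat [:: (12, 12); (12, 12); (1, 1)]%nat [:: 0; 0; 0; 0; 0; 260; -211;
  0; 0; 0; 0; 0; -220; 0; 104; -324; 0; 133; 0; 0; -70; 0; 0; 186; 329; 0; 0; 0; 0; 103; -111; 0; 0;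
  0; 0; 0; 0; 0; 0; 0; 0; -650; 0; 0; 0; 0; 0; 0; 0; 0; 0; 0; 0; 0; 0; 0; 0; 0; 0; 0]%Z (zip [:: 13;
  31; 40; 2; 4; 39; 16; 18; 22; 0; 7; 19; 34; 27; 32; 33; 11; 10; 25; 8; 9; 21; 35; 26; 1; 28; 38;
  37; 3; 36]%nat [:: -117217396050; 132143707031; -212399459145; 83395652978; 93611458259;
  103804012386; -114262345831; 508682753; 81248749041; 13230415143; 10787286646; 17551543177;
  50118456359; 69177455962; 57637896248; -8205751508; 828541617; 72716586546; -28549357132;
  1131535950; 22506735748; 56085928118; 3150189282; -33520602696; -52325391975; 81067757539;
  47074299301; -21008025181; 52202986713; -58403917448]%Z);
 Config 5 13 [:: 4; 8; 12; 16; 20]%nat [:: (13, 0); (13, 0)]%nat [:: -366; 0; 0; 52; -120; 0; -182;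
  0; 0; 282; 0; -121; 0; 0; 0; 0; 0; 0; 0; 0; 0; 0; 0; 0; 0; 0; 0; 0; 0; 0; 0; 0; -199; 140; -269;
  0; 0; 75; 0; -1]%Z (zip [:: 8; 35; 1; 7; 26; 36; 5; 2; 30; 13; 16; 31; 17; 28; 19; 15; 22; 20; 18;
  23; 14; 12; 10; 38; 25; 24; 29; 21; 27]%nat [:: -104612303476; -121635246372; -101848395697;
  -94827713890; -92759400769; -112086310179; -54012606106; -61089843149; -76718668631; 68439263096;
  68140290451; 46185303578; -1936585269; 223351790; -53415146332; 22544338256; -76802946989;
  -16791107643; -66783531271; -769370706; 22402489000; 15934858320; -25183531662; -72762222924;
  66589852022; -34390888875; -61975895098; 9458549251; 25841350395]%Z);
 Config 5 9 [:: 0; 4; 8; 12; 16]%nat [:: (9, 0); (9, 0); (9, 0)]%nat [:: 0; 186; 0; 0; 127; 0; -150;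
  0; 0; 0; -57; 173; 0; 0; 0; 0; 0; 80; 0; 0; 76; -200; 0; 239; 0; 0; 0; 0; -85; 0; 0; 0; 0; 0; 0;
  0; 0; 38; -126; 0; 0; 0; 0; 0; 0; 0; 172; 0; 0; -115; 0; 0; -173; 0; -359; 224; 0; 0; 0; 0]%Z (zip
  [:: 5; 39; 53; 41; 16; 9; 35; 48; 45; 2; 24; 31; 18; 29; 8; 12; 25; 19; 27; 14; 50; 58; 0; 15; 44;
  13; 57; 51; 59; 22; 7; 32; 30; 26; 33; 3; 56; 36; 34; 40; 47; 42; 43]%nat [:: 127966618474;
  -156455781540; 116510868617; 101710649907; -105928263962; 89619901943; 105421242448; 89184856568;
  93584945654; 74556039922; -4578872216; -74840249550; -55584511170; 86200219669; -88473007962;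
  -3611754273; -287253767; -16250688857; 24429892400; 14317744541; -19993164429; 29774687276;
  -62670614743; 12269762824; 75751559359; -40096111230; 31814823010; -33551652356; -33600894650;
  -93984418712; -93148784690; 17287514603; -55680285164; 14730281708; 6303558522; -21935877917;
  13150371543; 37039347898; -57204791919; -30074795097; -6000984472; -20167440970; -70502237106]%Z);
 Config 6 9 [:: 0; 4; 4; 8; 12; 16]%nat [:: (9, 0)]%nat [:: 28; -170; 0; -23; -165; 0; -98; 7; 0; 0;
  -281; 0; 56; 128; 0; -106; -30; 0; 0; 0; 0; 87; 27; 0]%Z (zip [:: 2; 14; 5; 11; 17; 23; 9; 8; 18;
  20; 19]%nat [:: 102058322537; -101866451423; 99677667181; 78788740627; -89457254761; 82159272982;
  -25053716982; -8239127419; 7420721883; -72421662750; -66861483011]%Z);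
 Config 6 9 [:: 0; 4; 4; 8; 12; 16]%nat [:: (9, 0); (1, 4)]%nat [:: 104; -212; 179; 0; 0; -170; 0;
  0; -69; 0; 20; 0; 0; -121; 0; 183; 203; 62; 68; 0; 0; 2; 0; 53; 0; 0; 0; 0; 395; 0; 0; 0; 271;
  -47; 0; 0; 0; 0; 0; 0; 0; 0; 0; 0; 0; 0; 0; 0]%Z (zip [:: 22; 29; 3; 4; 11; 12; 19; 7; 6; 9; 14;
  20]%nat [:: 116457622522; -242618879371; 87552659424; 46914613658; -98541833411; -88630171047;
  102042108403; -21200115939; 38336308459; 57481568364; 51660020959; -15070538504]%Z);
 Config 6 11 [:: 0; 4; 8; 12; 16; 20]%nat [:: (11, 0)]%nat [:: 121; -43; 0; 49; -34; -132; -67; 0;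
  267; -120; 54; 0; 0; 4; -95; 0; 0; 0; 186; 0; 10; 0; 0; 53]%Z (zip [:: 22; 2; 7; 11; 15; 19; 21;
  12; 17; 16]%nat [:: 111275544142; -105979890917; -104549895508; 78792856072; -99532006012;
  -71960567123; 1055946305; 45109692520; -18073237338; 67787223249]%Z);
 Config 6 6 [:: 1; 3; 5; 7; 9; 11]%nat [:: (12, 12)]%nat [:: 0; 88; -84; 0; 47; 0; 0; 13; 40; 0; 0;
  89; 0; 192; -253; 195; -102; -221; 0; -88; 0; 26; 0; 0]%Z (zip [:: 0; 9; 5; 18; 12; 20; 6; 10; 23;
  3; 22]%nat [:: 106316032244; 99375394184; -91702206801; 88124407065; 50836223217; 81440065068;
  63342952228; 45071587121; -14172793754; 14947447397; -75570590001]%Z);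
 Config 6 13 [:: 4; 8; 12; 16; 20; 24]%nat [:: (13, 0)]%nat [:: 0; -96; 111; 0; 148; 0; -188; 0; 0;
  158; 0; 4; -138; 0; 179; 0; 213; 0; 0; 258; -7; 0; 117; -89]%Z (zip [:: 21; 3; 7; 8; 15; 17; 18;
  13; 5; 10; 0]%nat [:: 105034669792; 97873208104; 81272179653; -77955215242; -93498063863;
  52536320088; -42039144684; -13039445927; -43158509690; -68672869499; -38234905783]%Z);
 Config 6 13 [:: 4; 8; 12; 16; 20; 24]%nat [:: (13, 0); (1, 4)]%nat [:: 157; 0; -69; 123; 0; -98;
  -83; 0; -143; 0; 0; 0; 0; -42; 169; 101; 0; -34; -246; 0; 0; 131; 0; 85; 394; 0; 0; 0; 0; 0; 0; 0;
  0; 0; 0; 0; 0; 0; 0; 0; 0; 0; 0; 0; 0; 0; 0; 0]%Z (zip [:: 22; 25; 1; 4; 9; 12; 19; 7; 11; 16; 10;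
  20]%nat [:: 108644947316; 253716241218; 67380644876; 98964570429; 94309839207; -103157461157;
  72374853605; -50786176757; 26167865301; -62286535258; -50090509701; 864165892]%Z);
 Config 6 15 [:: 4; 8; 12; 16; 20; 24]%nat [:: (15, 0)]%nat [:: 85; 0; 0; 210; 98; 0; -20; 0; 0;
  211; 145; 0; 0; 0; 0; -14; -203; -119; 0; -179; 76; 0; -87; 0]%Z (zip [:: 23; 2; 7; 8; 14; 18; 5;
  13; 11; 1; 12; 21]%nat [:: -105604749664; 80908900692; -102938377433; 76634140967; -89939370667;
  -79336945588; 35718392579; 62782622968; 44688909889; -48459994454; 23411660696; -21886195274]%Z);
 Config 6 15 [:: 4; 8; 12; 16; 20; 24]%nat [:: (15, 0); (1, 4)]%nat [:: 0; -23; 0; 225; -145; 0; 0;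
  109; 77; -145; -88; 0; 0; 198; 0; 0; 0; 77; 75; 0; 0; -183; 0; -82; 156; 0; 0; 0; 0; 0; 0; 0; 0;
  0; 0; 0; 0; 0; 0; 0; 0; 0; 0; 0; 0; 0; 0; 0]%Z (zip [:: 19; 25; 2; 5; 11; 14; 22; 6; 15; 16; 0;
  12; 20]%nat [:: -111970536057; 271669413290; -54096774547; 76936244179; 104557423022; 70559960269;
  100864777815; -71709108550; -37072360885; -7909154223; -42223488842; 65226491975; 19004043628]%Z);
 Config 6 17 [:: 4; 8; 12; 16; 20; 24]%nat [:: (17, 0)]%nat [:: 0; 145; -9; 0; 0; 0; 127; 0; -249;
  -154; 0; 0; 0; -11; 0; -30; 92; -64; -233; 0; 159; 0; 0; 0]%Z (zip [:: 21; 0; 7; 11; 14; 19; 22;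
  12; 3; 23; 10; 5; 4]%nat [:: -96305023150; 80610913379; -84725486790; 62306991475; -89664723670;
  88181626112; 37188609073; -66930141292; 67631430209; 10660165293; 50341387674; -22088362800;
  -61355166616]%Z);
 Config 6 17 [:: 4; 8; 12; 16; 20; 24]%nat [:: (17, 0); (1, 8)]%nat [:: 203; 0; 0; -182; 175; 0;
  112; 0; 0; -8; 0; 0; 0; 0; 190; 0; 0; -46; -28; 0; 0; 219; 195; 5; 0; 0; 0; 0; 0; -576; 0; 0; 0;
  0; 0; 0; 0; 0; 0; 0; 0; 0; 0; 0; 0; 0; 0; 0]%Z (zip [:: 8; 28; 1; 5; 16; 15; 20; 7; 12; 10; 2; 19;
  13; 11]%nat [:: 103491133301; 227268307087; -82546119384; 63910706453; -101365139591;
  -79728481709; 84474818359; 41157353680; 19314201998; -20683579686; -34111899603; -53384287112;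
  63267624566; 46807091672]%Z);
 Config 6 19 [:: 4; 8; 12; 16; 20; 24]%nat [:: (19, 0)]%nat [:: 9; 0; 0; -116; 0; -221; 0; 184;
  -211; 0; -20; 0; 0; 0; 0; 109; 0; -15; 0; 0; -94; 0; 0; -17]%Z (zip [:: 2; 9; 6; 16; 14; 22; 11;
  18; 13; 19; 21; 4; 12; 1]%nat [:: 104442289392; 96073399608; -73949162541; -92075908945;
  -91307103983; -81822019719; -11224080973; 22721222918; 17171738544; -59854301015; -72392049503;
  34140178574; -55722573259; 26633471868]%Z);
 Config 6 19 [:: 4; 8; 12; 16; 20; 24]%nat [:: (19, 0); (1, 12)]%nat [:: 0; -216; 137; 0; 0; -245;
  0; 0; -174; 0; 0; 56; -185; 0; 0; 144; -133; 0; 0; 179; 92; 0; 0; 0; 0; 0; 0; 0; 0; 0; 0; 0; 625;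
  0; 0; 0; 0; 0; 0; 0; 0; 0; 0; 0; 0; 0; 0; 0]%Z (zip [:: 21; 33; 0; 4; 9; 14; 18; 22; 13; 3; 17;
  10; 7; 6; 23]%nat [:: -110770590782; 217739215703; 74635274336; -73759892569; -60669702065;
  74888478132; -97949800763; 9189136248; -60721692854; 54506635384; -8841829277; -56485704524;
  -59058874602; -1426906732; 17067691198]%Z);
 Config 6 21 [:: 4; 8; 12; 16; 20; 36]%nat [:: (21, 0)]%nat [:: 117; 0; 0; 223; 0; -64; 199; 0; 0;
  0; -78; 0; 0; 0; 277; 0; 0; 15; 0; 0; 0; -219; -130; 0]%Z (zip [:: 16; 2; 4; 11; 15; 20; 7; 23;
  13; 19; 9; 12; 18; 8; 1]%nat [:: 107449675000; 75818723601; 88975478183; 102213990661;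
  69737359038; -85788009924; 39085046796; 23657282897; 21973955292; -30584947657; -39374697185;
  41447752628; 9792479167; -12510484416; -47694338663]%Z);
 Config 6 21 [:: 4; 8; 12; 16; 20; 32]%nat [:: (21, 0); (1, 4)]%nat [:: -81; 0; 0; 66; 0; -75; 0; 0;
  0; 0; 0; 86; 0; 0; 17; 0; 182; 0; 0; 152; 0; 0; 216; -183; 0; -439; 0; 0; 0; 0; 0; 0; 0; 0; 0; 0;
  0; 0; 0; 0; 0; 0; 0; 0; 0; 0; 0; 0]%Z (zip [:: 10; 24; 2; 4; 17; 15; 20; 6; 21; 8; 9; 13; 12; 1;
  7; 18]%nat [:: -103713950665; 248336167614; 81751108671; 99889574844; 93431664246; 80824027937;
  85228861115; -49219487774; 12394685619; 43502070123; 3269746132; 44673110306; -68144023595;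
  -46095041371; -19668090072; -20285773127]%Z);
 Config 6 9 [:: 1; 3; 5; 7; 11; 13]%nat [:: (18, 18); (3, 3); (2, 10)]%nat [:: 0; 0; 0; 0; 239; 0;
  0; 0; 0; 68; 0; -219; 0; -144; 0; 0; -156; 0; 0; 86; 0; 0; 0; 0; 0; 43; 0; 0; 0; 0; 0; 0; 0; 0; 0;
  0; 0; 0; 0; 0; 0; 0; 0; -80; 0; -98; 0; 0; 0; 0; 0; 0; 0; 0; 0; 0; 0; -563; 0; 0; 0; 0; 0; 0; 0;
  0; 0; 0; 0; 0; 0; -198]%Z (zip [:: 1; 24; 56; 5; 18; 10; 12; 22; 14; 8; 17; 20; 2; 3; 15; 21; 42;
  7; 6; 44; 70; 0]%nat [:: -93876095733; -193569629877; -168809490973; 92327726710; -88112576572;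
  80050314037; -86431915334; -74224766488; -62108058587; -13775012810; -69094355884; 47402324547;
  -4031624766; -5642263578; -57174761342; -24170651566; -84490615859; 3743461712; -58622539012;
  172231105554; 146274570729; 31034551131]%Z);
 Config 6 21 [:: 4; 8; 12; 16; 20; 36]%nat [:: (21, 0); (3, 24)]%nat [:: 86; 0; 0; 0; -61; 0; 0; 0;
  -280; 0; 0; 0; -107; 0; 118; -103; 0; 0; 251; 0; 0; 0; 62; 0; 0; 0; 0; 0; -243; 0; 0; 0; 0; 0; 0;
  0; 0; 0; 0; 0; 0; 0; 0; -468; 0; 239; 0; 0]%Z (zip [:: 13; 29; 1; 6; 9; 23; 19; 11; 5; 2; 20; 17;
  3; 21; 16; 10; 42; 44; 7]%nat [:: -108624111938; -194517497147; 90712582543; -65948894263;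
  91992782351; -76955929747; -70026178774; 4513850562; 48788829936; -61769734934; 71539558915;
  41555881001; -42600038641; -38931677661; -249755355; 16112474012; 82275373536; 82451784475;
  37163158629]%Z);
 Config 6 21 [:: 4; 8; 12; 16; 28; 40]%nat [:: (21, 0); (3, 36); (1, 16)]%nat [:: 0; -257; -113;
  101; -229; 0; -144; 0; 0; 0; 0; 0; 0; -153; 0; 0; 0; 0; 0; 182; 0; 0; 0; 0; 0; 0; 0; 0; 0; 0; 0;
  0; 0; 22; 0; 0; 0; 0; 0; 101; 0; 0; 0; 0; -412; 0; 0; 0; 0; 0; 0; 0; 0; 0; 0; 0; 0; 0; 0; 0; 0;
  255; 0; 0; 0; 0; 0; 0; 0; 0; 0; 0]%Z (zip [:: 0; 45; 60; 18; 5; 8; 12; 22; 11; 7; 20; 17; 10; 16;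
  15; 14; 21; 23; 9; 32; 38]%nat [:: -92612875263; -171354830210; -266218554338; 86824156088;
  -71940402484; 62906987542; -75138262376; 75448883622; -41169079789; -67403705830; 52435240961;
  54318683021; 55162893765; -45998374728; -40755012286; 31239632433; -6205120919; -23857346573;
  53560362046; 154789293619; 96095685834]%Z);
 Config 6 13 [:: 4; 8; 12; 16; 20; 24]%nat [:: (13, 0); (13, 0)]%nat [:: 276; 0; -93; 0; 0; 260; 11;
  -95; -46; 0; 0; 0; 0; 13; -76; 0; 0; 0; 0; 0; -118; 0; 0; 0; 0; 0; 40; 0; 0; 0; 0; 0; 0; 0; 0;
  287; -195; 0; 323; -51; 0; -26; -83; 0; -58; 0; 0; -141]%Z (zip [:: 4; 40; 1; 9; 21; 37; 15; 3;
  45; 16; 23; 12; 18; 17; 24; 32; 10; 28; 34; 19; 29; 25; 11; 22; 33; 46; 27; 31; 30; 43]%nat [::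
  110235745323; 141864818127; 89719578079; -99293058043; -86266116816; 87593737674; 81099508133;
  69147235547; -77135871293; -44051044073; -13105603191; 7916472437; -14513630071; -22940287881;
  -32674043563; -2824311298; 52894153359; -49585112743; 54817637591; -24497113974; -63859896357;
  12922940165; -46775028564; -70517271623; 35219490133; -63019186599; -69948828660; -28196535361;
  -13118252224; 35181058984]%Z);
 Config 6 13 [:: 4; 8; 12; 16; 20; 24]%nat [:: (13, 0); (13, 0); (1, 4)]%nat [:: 0; 134; 0; 0; 0; 0;
  -47; 0; 0; 254; -159; 0; 99; 162; 0; -241; 0; -57; 0; -302; 0; 0; 0; 0; 0; -72; 0; 0; 0; 312; -22;
  191; 0; 0; 0; 109; 0; 309; 0; 0; 0; 0; 54; 0; 0; 0; 40; 0; 0; 100; 0; 0; 0; 0; 0; 0; 0; 0; 0; 0;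
  0; 0; 0; 0; 0; 0; 0; 0; 0; 0; 0; 0]%Z (zip [:: 18; 28; 48; 24; 47; 8; 14; 36; 2; 11; 3; 20; 33; 4;
  34; 40; 16; 21; 0; 27; 38; 7; 5; 41; 32; 43; 39; 45; 23; 22; 44; 26]%nat [:: 109502196482;
  -119790362542; -273564046953; -67069834654; -100108282675; -91196505355; -80442815601;
  73665072943; 63455938401; 62017465360; 53585838573; -59741481173; 69943840713; -7091721811;
  -39760724357; 20743012954; 21601053371; -17116463110; -44489172994; 66149443697; -18767846070;
  13775552937; 41565576840; -45184486686; -13854545667; 64878519538; 15562753726; -59099347286;
  64741384229; -63684855548; 20389368197; 30390667923]%Z);
 Config 6 7 [:: 1; 3; 5; 7; 9; 11]%nat [:: (14, 14); (14, 14)]%nat [:: 0; -247; 0; 0; -85; 134; 0;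
  82; 0; 0; 0; 0; -86; 0; 0; 0; 168; 0; 0; 168; 0; 0; 0; 0; 67; 0; 0; 0; 0; 0; 0; 0; 269; 0; 0; 0;
  -275; -194; 0; -202; 0; -81; 0; 0; 17; 0; 196; 0]%Z (zip [:: 6; 45; 25; 18; 33; 38; 0; 11; 2; 3;
  15; 13; 17; 31; 8; 21; 20; 27; 34; 28; 29; 43; 22; 23; 14; 42; 9; 40; 47; 10; 35; 26; 30]%nat [::
  129391491706; -125482990439; -81875372367; -99633592886; 104216362325; -84123524121; -78543101067;
  -61438357743; -43001326709; -54020666968; -24229442490; 68300315020; 70930027578; 36448301332;
  45098165236; 19867215495; -73283129391; 42811558804; -5878968156; 19586833857; -49988809248;
  14139450842; 4422944685; 18496259756; -34967086790; -67293632669; 35445337837; -30974165381;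
  -22895133525; -44265478866; 7201504482; -31520704781; -43974937534]%Z);
 Config 6 10 [:: 1; 3; 5; 9; 11; 19]%nat [:: (20, 20); (5, 15); (4, 4)]%nat [:: 0; 88; 0; 94; 0; 0;
  0; 0; 0; 0; 0; 0; 51; 0; 0; -99; 0; 0; 0; 0; 0; 0; 0; 0; 0; 0; 0; 0; 0; -300; 0; 0; 0; 0; 0; -39;
  0; 0; 0; 0; -274; 0; 0; 0; 0; -128; 0; 0; 0; 345; 0; 0; 0; 0; 0; 0; 0; 0; 0; 0; 0; 0; -115; 0;
  -248; 0; 0; 0; 0; 0; 0; 0]%Z (zip [:: 2; 34; 65; 14; 5; 8; 22; 16; 41; 20; 0; 11; 21; 7; 19; 10;
  13; 17; 18; 48; 44; 9; 23; 28; 63; 4; 6; 71; 70]%nat [:: -111091905136; -178089580237;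
  177217923561; 98105600932; -75786943262; 82612600185; 89521556416; -51343207971; 126604521878;
  -73114479971; 19542818321; 44527305710; 5222548010; 57074550646; 16180926756; -12733225949;
  -67509839572; 35945908731; 39275075502; -114595767750; 71874103557; -36521018791; -53551456084;
  -97273854659; 122337219937; 69976988118; 19365601842; 42544464014; -16781163052]%Z);
 Config 6 15 [:: 4; 8; 12; 16; 20; 24]%nat [:: (15, 0); (15, 0)]%nat [:: 0; 0; 0; 0; -201; 0; -75;
  -107; 0; 0; 0; 211; 0; 0; 0; 0; 0; -155; -180; 0; 0; -142; 0; 0; 247; 63; -227; 0; -4; 0; 0; -30;
  0; 0; 0; 0; 99; 0; 0; 0; 0; 0; 0; 0; 0; 0; 0; -208]%Z (zip [:: 5; 27; 37; 10; 20; 44; 16; 14; 40;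
  12; 19; 8; 22; 1; 9; 2; 23; 45; 34; 33; 15; 0; 43; 32; 42; 30; 46; 13; 3; 41; 35; 39; 38; 29]%nat
  [:: -122487533287; -114400801019; -93018488026; -102192000083; -81597040563; -88312244712;
  -75292015650; -67123242709; -73036050770; 62820870515; -75015574692; -56295071156; -45757097995;
  20438508414; 17837924024; 28133177257; 27049811364; 56178836847; 12430621768; -60507470981;
  -8494700888; 43509210807; 30706680216; -64233021030; 8183071804; 49673819195; 13299995663;
  27361962748; 24514026170; 58989432771; -10285503752; 72630352689; 35767057707; 59226307311]%Z);
 Config 6 15 [:: 4; 8; 12; 16; 20; 24]%nat [:: (15, 0); (15, 0); (1, 4)]%nat [:: 0; 0; 0; 0; 0; 0;
  0; 0; 0; 0; 0; 0; -78; -134; 0; -46; 0; 28; 0; 0; 137; 0; 0; 109; -108; 0; 149; 0; 0; -255; 0; 29;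
  -210; 0; -126; 0; 0; 0; 0; 0; 0; 0; 0; 0; 0; -111; 0; 0; 0; -303; 0; 0; 0; 0; 0; 0; 0; 0; 0; 0; 0;
  0; 0; 0; 0; 0; 0; 0; 0; 0; 0; 0]%Z (zip [:: 14; 33; 48; 27; 28; 47; 16; 7; 1; 21; 19; 3; 40; 10;
  18; 4; 39; 44; 36; 0; 42; 9; 25; 41; 8; 22; 37; 46; 2; 30; 43; 11; 6; 35; 38; 5]%nat [::
  -143736635832; -115449446772; -262568711150; 75971853988; 100682604348; 94387952196; 106018891396;
  -90037274671; -52473202685; -68348124052; 15392581842; -55040538103; 68814613699; -43055500898;
  49910682483; -27944593317; 4760447110; -49239270595; 55580460394; 67990060571; 20157329036;
  7761765398; 47772321686; -67689618918; -45213893760; 83014593375; -14725491815; -5711344672;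
  -9412840623; -42900143202; 47721343490; -38243268782; -15500385471; -54353660583; -12322253897;
  13193131729]%Z);
 Config 6 5 [:: 1; 1; 3; 5; 7; 9]%nat [:: (10, 10); (10, 10); (10, 10); (2, 2)]%nat [:: 0; 0; -93;
  0; 0; 0; 0; 0; 0; 0; 0; 0; 0; 0; -58; 0; 0; -340; 0; -33; 0; 0; 0; 0; 0; 88; -152; 349; 0; 0; -81;
  0; 0; 0; 0; 0; 0; 0; 0; 0; 0; 0; 0; 0; 74; 0; 0; 129; 0; 0; 0; 0; 0; 0; 0; 0; 0; 102; 73; 169;
  -53; 0; 0; -134; 0; 0; 0; 0; 0; 0; 0; 0; 28; -211; 0; 0; 0; 303; 0; 0; 0; 0; 0; 0; 0; 0; 0; 0; 0;
  0; 0; 0; 0; 0; 0; 61]%Z (zip [:: 13; 46; 56; 76; 0; 52; 62; 18; 23; 31; 5; 64; 8; 6; 20; 4; 16;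
  42; 36; 3; 40; 41; 39; 24; 22; 21; 11; 9; 10; 65; 28; 66; 7; 32; 43; 29; 1; 68; 37; 50; 49; 33;
  69; 71; 35; 67; 34; 55; 51; 15; 94; 45; 38; 54; 61; 48; 12; 70; 53]%nat [:: -120463343800;
  128057110736; 156271328892; -204996458181; 105446147000; 94218558769; -103564383396; -96194098203;
  86501088658; 68686893467; 13972659452; 68720081907; 40825440310; -43060531815; 5935962715;
  -83957293197; 79600455814; -59756801445; 48680956428; 40116666298; -48281152006; -42265671638;
  -76153412557; -80597811282; 37251806028; 30433153843; -13153275323; -26481897093; 35803697359;
  -1157316281; -48022382332; 4864966743; 19862304537; 66502804993; 17188236961; -62212453855;
  -16330123135; -55952321226; 30347179746; 56948226118; 42002639817; -18971576230; -34556877746;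
  -48624792878; -50487355415; -59736398021; -39123424397; -20705989896; -45574095761; 5573100257;
  152925094745; 4112293821; -52439021409; 19017103019; 37961549590; -38034593554; -3119644986;
  -32197737973; 6496530835]%Z);
 Config 6 15 [:: 4; 8; 12; 16; 20; 28]%nat [:: (15, 0); (15, 0); (3, 24)]%nat [:: 0; 0; 0; 0; 129;
  0; 0; 81; 0; 0; -155; 0; 0; 0; 0; 0; 118; 0; -77; 0; 0; 0; 0; 0; 0; -151; 0; 0; 0; 0; 0; 0; 0; 0;
  0; 0; 0; 329; 0; -258; 0; 0; 0; 0; 0; 0; 83; 0; 0; 0; 0; 0; 183; 0; 0; 0; 0; 0; -247; 0; 0; 0; 0;
  0; 0; 0; 0; 0; 33; 0; 0; 0]%Z (zip [:: 19; 45; 59; 3; 6; 33; 36; 24; 17; 20; 22; 11; 5; 21; 15;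
  13; 30; 9; 12; 1; 29; 47; 43; 27; 41; 31; 40; 0; 28; 8; 14; 69; 42; 38; 35; 23; 2; 34; 53; 44;
  32]%nat [:: 127331214420; 95846589050; 198219152082; 96190021150; 114807928800; 84879981219;
  -78891082653; -91467483051; -27521076642; 42638285280; -85600106388; -57385287645; 59481281977;
  -56441488425; 38891955916; -46309896471; -4814399389; 50188870745; 1604005164; 29955741476;
  54405722375; 13462031745; 1754456088; -51584513862; -61116691655; -32308388592; 22725007588;
  24227698531; -52533655918; 2063030174; -3084423011; -138410106765; -71053421509; 72218018119;
  40920119386; 13558622481; 65554971686; 49981949192; 101103435046; -38448734920; -6515737041]%Z);
 Config 6 11 [:: 0; 4; 8; 12; 16; 20]%nat [:: (11, 0); (11, 0); (11, 0); (1, 0)]%nat [:: -134; -85;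
  0; -125; 0; 0; 0; 0; 0; 0; 0; 0; -21; 309; 0; -256; 0; 0; 0; -201; 0; 0; 0; 0; 0; 0; 91; 0; 0; 0;
  0; 0; 41; 349; 0; -272; 0; 0; 0; 0; 0; 0; 0; 0; 0; 107; 215; 0; 0; 0; 103; 0; 212; 0; -362; 67; 0;
  0; 0; 0; 0; 0; 0; 0; 0; 0; 0; 0; 0; 0; 0; 0; -194; 0; 187; 27; 0; 0; 0; 0; 0; 0; 0; 0; 0; 0; 0; 0;
  0; 0; 0; 0; 0; 0; 0; 0]%Z (zip [:: 14; 47; 53; 73; 25; 59; 34; 18; 2; 9; 21; 22; 61; 43; 17; 37;
  16; 8; 39; 6; 23; 20; 66; 5; 68; 27; 7; 11; 41; 4; 69; 60; 48; 49; 64; 36; 10; 31; 44; 40; 63; 30;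
  57; 28; 51; 58; 42; 38; 24; 65; 29; 67; 62; 71; 70; 56]%nat [:: 120444469303; -124730789282;
  -124017827231; -265091667400; 92277501497; 89351333027; -93927496556; -117604521835; -88003228597;
  -75880583974; 83778561492; 43127422332; -83774099095; -80370104774; 10018186668; -45017062303;
  2809803724; -27367692623; 11829690460; -53217505068; -30568221126; -8314658975; 70568447115;
  33680393208; -69136834516; 32701472836; 23897982726; -18314258731; 928391825; 22498340671;
  -58926389650; 40077462320; -81086336459; -42207588611; 35166089448; 33964664781; 10634315337;
  32108261761; 9611628842; 5503304747; 26079905259; 41218616893; 5544765351; -49575790466;
  -39547653711; -24240170293; 81808815377; 4186079318; -22443660160; 48911293234; -17525798527;
  -16775220884; 11854934173; -30894330812; 5356539721; -17751145169]%Z)].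

Lemma cases_ok : all certified cases.
Proof. by vm_compute. Qed.

Definition dims : seq (nat * nat) :=
  [seq (3, N) | N <- iota 5 7] ++ [seq (4, N) | N <- iota 6 16] ++
  [seq (5, N) | N <- iota 8 20] ++ [seq (6, N) | N <- iota 9 26].

Lemma cases_cover : all (fun x => has (fun g => (cdim g, npts g) == x) cases) dims.
Proof. by vm_compute. Qed.

Theorem theorem4p5 (R : realType) (N d : nat) :
  [\/ (d = 3 /\ 5 <= N <= 11), (d = 4 /\ 6 <= N <= 21),
      (d = 5 /\ 8 <= N <= 27) | (d = 6 /\ 9 <= N <= 34)]%nat ->
  exists x : 'I_N -> hvec R d, tight_simplex x.
Proof.
move=> H; have /(allP cases_cover) /(has_nthP (Config 0 0 [::] [::] [::] [::])) [i lt_i /eqP [<-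
  <-]] :
    (d, N) \in dims.
  by rewrite !mem_cat; case: H => -[-> lt]; rewrite map_f ?orbT // mem_iota; lia.
have /hasP [t tT] := all_nthP (Config 0 0 [::] [::] [::] [::]) cases_ok i lt_i.
case: eqP => // tq; have := allP tables_ok t tT; move: tT tq; rewrite tablesE.
by case/mapP => [[q c] _ -> /= ->]; apply: check_simplex.
Qed.
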